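(* Let $\kappa_m>0$ and $p\ge 4$. Let $\mathcal{G}\colon X^{\kappa_m,p}\to\mathbb{R}$ be any weakly sequentially lower semicontinuous function such that $\mathcal{G}(\mathbf{u})\le \mathcal{F}(\mathbf{u},I)$ for all $\mathbf{u}$ in the dense subset $Y^{\kappa_m}$. Then $\mathcal{G}(\mathbf{u})\le\mathcal{F}(\mathbf{u},I)$ for all $\mathbf{u}\in X^{\kappa_m,p}$. Moreover, for every $\mathbf{u}\in X^{\kappa_m,p}$, $$\Gamma\text{-}\lim_{\varepsilon\searrow 0}\mathcal{F}_\varepsilon(\mathbf{u},I)=\mathcal{F}(\mathbf{u},I)$$ with respect to the weak topology of $W^{3,p}(I;\mathbb{R}^3)$ on $X^{\kappa_m,p}$.
   Context: $I=(0,1)$. Fix $\mathbf{A},\mathbf{B}\in\mathbb{R}^3\times\mathbb{S}^2$. For a curve $\mathbf{u}$ write $D^{[1]}\mathbf{u}(t)=(\mathbf{u}(t),\mathbf{u}'(t))$. Define $$Y=\{\mathbf{u}\in C^\infty([0,1];\mathbb{R}^3): D^{[1]}\mathbf{u}(0)=\mathbf{A},\ D^{[1]}\mathbf{u}(1)=\mathbf{B},\ |\mathbf{u}'(s)|=1\text{ for all }s\in I\},$$ $Y^{\kappa_m}=\{\mathbf{u}\in Y:|\mathbf{u}''(s)|\ge\kappa_m\text{ for all }s\in I\}$, and let $X^{\kappa_m,p}$ be the closure of $Y^{\kappa_m}$ in the norm of $W^{3,p}(I;\mathbb{R}^3)$. For $\mathbf{u}\in X^{\kappa_m,p}$ put $\kappa=|\mathbf{u}''|$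 and $\eta=\dfrac{\mathbf{u}'\cdot(\mathbf{u}''\times\mathbf{u}''')}{|\mathbf{u}''|^3}$. The Sadowsky functional is $\mathcal{F}(\mathbf{u},I)=\int_I\kappa^2(1+\eta^2)^2\,ds$. Let $g\colon\mathbb{R}\to[1,+\infty]$ be $g(0)=1$, $g(x)=\frac1x\ln\frac{2+x}{2-x}$ for $0<|x|<2$, and $g(x)=+\infty$ for $|x|\ge2$. For $\varepsilon>0$, $\mathcal{F}_\varepsilon(\mathbf{u},I)=\int_I\kappa^2(1+\eta^2)^2g(\varepsilon\eta')\,ds$ if $\eta\in W^{1,1}(I)$, and $\mathcal{F}_\varepsilon(\mathbf{u},I)=+\infty$ otherwise. A function $\mathcal{G}$ on $X=X^{\kappa_m,p}$ is weakly sequentially lower semicontinuous if $\mathcal{G}(\mathbf{u})\le\liminf_k\mathcal{G}(\mathbf{u}_k)$ whenever $\mathbf{u},\mathbf{u}_k\in X$ and $\mathbf{u}_k\rightharpoonup\mathbf{u}$ weakly in $W^{3,p}(I;\mathbb{R}^3)$. The statement that $\mathcal{F}$ is the $\Gamma$-limit of $\mathcal{F}_\varepsilon$ on $X$ as $\varepsilon\searrow0$ with respect to a mode of convergence means: for every sequence $\varepsilon_j>0$ with $\varepsilon_j\to0$ and every $\mathbf{u}\in X$, (1) $\mathcal{F}(\mathbf{u},I)\le\liminf_j\mathcal{F}_{\varepsilon_j}(\mathbf{u}_j,I)$ for every sequence $\{\mathbf{u}_j\}\subset X$ converging to $\mathbf{u}$; and (2) there is a sequence $\{\mathbf{u}_j\}\subset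 X$ converging to $\mathbf{u}$ with $\mathcal{F}(\mathbf{u},I)\ge\limsup_j\mathcal{F}_{\varepsilon_j}(\mathbf{u}_j,I)$. Here convergence is weak convergence in $W^{3,p}(I;\mathbb{R}^3)$. *)

(* Defs.v *)
From mathcomp Require Import all_boot all_order all_algebra.
From mathcomp Require Import all_classical all_reals all_analysis.

Set Implicit Arguments.
Unset Strict Implicit.
Unset Printing Implicit Defensive.

Import Order.TTheory GRing.Theory Num.Theory.
Import numFieldNormedType.Exports.

Local Open Scope classical_set_scope.
Local Open Scope ring_scope.

Section Euclidean3.
Context {R : realType}.
Implicit Types a b : 'rV[R]_3.

Definition dotp a b : R := \sum_(i < 3) a 0 i * b 0 i.

(* The library norm on row vectors is the maximum norm; lengths of curves,
   tangents and the unit sphere refer to the Euclidean one. *)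
Definition enorm a : R := Num.sqrt (dotp a a).

(* [k + 1] and [k + 2] are computed in the ring ['I_3], i.e. modulo 3. *)
Definition crossp a b : 'rV[R]_3 :=
  \row_(k < 3) (a 0 (k + 1) * b 0 (k + 2) - a 0 (k + 2) * b 0 (k + 1)).

Definition unit_sphere : set 'rV[R]_3 := [set a | enorm a = 1].

End Euclidean3.

(* A curve is a total function on [R]; only its restriction to [0, 1] (and, for
   Sobolev curves, only its class modulo a.e. equality on ]0, 1[) is used. *)
Definition curve (R : realType) := R -> 'rV[R]_3.

Definition unit_itv (R : realType) : set R := `]0, 1[%classic.
Arguments unit_itv R : clear implicits.

Section ClassicalDerivatives.
Context {R : realType}.
Implicit Types u : curve R.

Definition quot01 u (x y : R) : 'rV[R]_3 := (y - x)^-1 *: (u y - u x).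

(* Derivatives relative to [0, 1], hence one-sided at 0 and at 1. *)
Definition derivable01 u (x : R) : Prop :=
  cvg (quot01 u x y @[y --> within `[0, 1] x^']).

Definition deriv01 u : curve R :=
  fun x => lim (quot01 u x y @[y --> within `[0, 1] x^']).

Definition smooth01 u : Prop :=
  forall n x, x \in `[0, 1] -> derivable01 (iter n deriv01 u) x.

Definition D1 u (x : R) : 'rV[R]_3 * 'rV[R]_3 := (u x, deriv01 u x).

Definition Yspace (A B : 'rV[R]_3 * 'rV[R]_3) : set (curve R) :=
  [set u | [/\ smooth01 u, D1 u 0 = A, D1 u 1 = B &
    forall s, unit_itv R s -> enorm (deriv01 u s) = 1]].

Definition Yspace_curv (A B : 'rV[R]_3 * 'rV[R]_3) (km : R) : set (curve R) :=
  [set u | Yspace A B u /\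
    forall s, unit_itv R s -> km <= enorm (deriv01 (deriv01 u) s)].

End ClassicalDerivatives.

Section Sobolev.
Context {R : realType}.
Local Notation mu := (@lebesgue_measure R).
Local Notation I := (unit_itv R).
Implicit Types (f g phi : R -> R) (u v : curve R) (p : R).

Definition test_function phi : Prop :=
  (forall n x, derivable (derive1n n phi) x 1) /\
  exists K : set R, [/\ compact K, K `<=` I & forall x, ~ K x -> phi x = 0].

Definition is_weak_derivative (j : nat) f g : Prop :=
  [/\ locally_integrable I f, locally_integrable I g &
    forall phi, test_function phi ->
      \int[mu]_(x in I) (f x * derive1n j phi x) =
      (-1) ^+ j * \int[mu]_(x in I) (g x * phi x)].

(* The [j]-th weak derivative, which is unique up to a.e. equality on [I]: some
   representative is chosen.  Junk value (zero) when there is none. *)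
Definition wderiv (j : nat) f : R -> R :=
  xget (fun=> 0) [set g | is_weak_derivative j f g].

Definition LpI p f : Prop := f \_ I \in Lfun mu p%:E.

Definition sobolev (k : nat) p f : Prop :=
  LpI p f /\
  forall j, (j <= k)%N -> exists g, is_weak_derivative j f g /\ LpI p g.

Definition coord u (i : 'I_3) : R -> R := fun x => u x 0 i.

Definition W3p p : set (curve R) :=
  [set u | forall i : 'I_3, sobolev 3 p (coord u i)].

Definition wD (j : nat) u : curve R :=
  fun x => \row_(i < 3) wderiv j (coord u i) x.

Definition W3p_norm p u : \bar R :=
  (\sum_(j < 4) 'N[mu]_(p%:E)[EFin \o ((enorm \o wD j u) \_ I)])%E.

Definition Xspace (A B : 'rV[R]_3 * 'rV[R]_3) (km p : R) : set (curve R) :=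
  [set u | W3p p u /\ forall e : R, 0 < e ->
    exists2 v, Yspace_curv A B km v & (W3p_norm p (u - v)%R < e%:E)%E].

(* Elements of the dual of W^{3,p}.  Boundedness forces [L] to take equal values
   on curves that agree a.e. on [I], so [L] descends to classes. *)
Definition W3p_dual p (L : curve R -> R) : Prop :=
  (forall (a : R) u v, W3p p u -> W3p p v -> L (a *: u + v) = a * L u + L v) /\
  exists C : R, forall u, W3p p u -> (`|L u|%:E <= C%:E * W3p_norm p u)%E.

Definition weak_cvg p (us : nat -> curve R) u : Prop :=
  forall L, W3p_dual p L -> L (us k) @[k --> \oo] --> L u.

(* Applied to constant sequences, this condition implies that [G] takes equal
   values on curves that agree a.e. on [I]. *)
Definition weakly_seq_lsc p (X : set (curve R)) (G : curve R -> R) : Prop :=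
  forall (us : nat -> curve R) u, (forall k, X (us k)) -> X u ->
    weak_cvg p us u -> ((G u)%:E <= limn_einf (fun k => (G (us k))%:E))%E.

End Sobolev.

Section Functionals.
Context {R : realType}.
Local Notation mu := (@lebesgue_measure R).
Local Notation I := (unit_itv R).
Implicit Types u : curve R.

Definition kappa u : R -> R := fun s => enorm (wD 2 u s).

Definition eta u : R -> R := fun s =>
  dotp (wD 1 u s) (crossp (wD 2 u s) (wD 3 u s)) / enorm (wD 2 u s) ^+ 3.

Definition sadowsky u : \bar R :=
  (\int[mu]_(s in I) (kappa u s ^+ 2 * (1 + eta u s ^+ 2) ^+ 2)%:E)%E.

Definition gfun (x : R) : \bar R :=
  if x == 0 then 1%E
  else if `|x| < 2 then (x^-1 * ln ((2 + x) / (2 - x)))%:E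
  else +oo%E.

Definition sadowsky_eps (eps : R) u : \bar R :=
  if `[< sobolev 1 1 (eta u) >] then
    (\int[mu]_(s in I) ((kappa u s ^+ 2 * (1 + eta u s ^+ 2) ^+ 2)%:E *
                        gfun (eps * wderiv 1 (eta u) s)))%E
  else +oo%E.

End Functionals.

Definition is_Gamma_limit (R : realType) (T : Type) (X : set T)
    (conv : (nat -> T) -> T -> Prop) (Feps : R -> T -> \bar R)
    (F : T -> \bar R) : Prop :=
  forall eps : nat -> R, (forall j, 0 < eps j) -> eps j @[j --> \oo] --> (0 : R) ->
  forall u, X u ->
    (forall us : nat -> T, (forall j, X (us j)) -> conv us u ->
       (F u <= limn_einf (fun j => Feps (eps j) (us j)))%E) /\
    (exists us : nat -> T, [/\ forall j, X (us j), conv us u &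
       (limn_esup (fun j => Feps (eps j) (us j)) <= F u)%E]).

(* Main.v *)
(* Write q = N' for the derivative of the unit normal N = u'' / |u''|.  The Frenet
   equations give |q|^2 = kappa^2 (1 + eta^2), hence F(u) = int |q|^4 / kappa^2,
   a convex function of (q, kappa).  The evaluations u |-> u''(x) are bounded
   functionals on W^{3,p}, so weak convergence in X makes kappa converge pointwise
   and the integral of q over ]s, t[, which is N(t) - N(s), converge as well.
   Supporting hyperplanes of |q|^4 / kappa^2 then bound the limits of the averages
   of the density over shrinking intervals from below, and Fatou's lemma gives the
   weak lower semicontinuity of F.  The liminf inequality follows from g >= 1.
   Conversely, since p >= 4 the density is dominated by a multiple of
   1 + |u''|^4 + |u'''|^4, so F is continuous along strongly convergent sequences;
   approximating u by smooth curves, on which F_eps tends to F because eta' is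
   bounded, yields both the first claim and, by a diagonal argument, the recovery
   sequence. *)
Require Import Defs.
From mathcomp Require Import all_boot all_order all_algebra.
From mathcomp Require Import all_classical all_reals all_analysis.
From mathcomp Require Import measurable_realfun ring lra.

Import Order.TTheory GRing.Theory Num.Theory.
Import numFieldNormedType.Exports.

Local Open Scope classical_set_scope.
Local Open Scope ring_scope.

Set Implicit Arguments.
Unset Strict Implicit.
Unset Printing Implicit Defensive.

(** Three obstacles shape the development. Weak derivatives are chosen representatives, so
    identities between them hold only almost everywhere; their uniqueness rests on the fundamental
    lemma of the calculus of variations, for which smooth bumps are built explicitly. Members of [X]
    are only limits: the arc-length relations and the integrated form of [N' = q] are proved on [Y]
    and carried over along approximations with errors [2^-(k+3)], small enough for a.e. convergence
    of the whole sequence and for an integrable majorant. Finally, under weak convergence [q] is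
    controlled only through its integrals over fixed intervals and [kappa] only pointwise, with no
    majorant at hand. The hyperplane touching the density at a Lebesgue point [x] is therefore
    frozen on a window to the right of [x], and [j] tends to infinity before the window shrinks.
    Tonelli's theorem then compares averaged densities with the densities themselves: averaging over
    windows does not increase the integral of a nonnegative function. *)

Section DeriveReal.
Context {R : realType}.
Implicit Types (f g : R -> R) (x a b : R).

Lemma is_derive1D f g x a b : is_derive x (1 : R) f a -> is_derive x (1 : R) g b ->
  is_derive x (1 : R) (fun y => f y + g y) (a + b).
Proof. exact: is_deriveD. Qed.

Lemma is_derive1M f g x a b : is_derive x (1 : R) f a -> is_derive x (1 : R) g b ->
  is_derive x (1 : R) (fun y => f y * g y) (a * g x + f x * b).
Proof.
move=> df dg; have h := is_deriveM df dg.
by apply: is_derive_eq h _; rewrite addrC /GRing.scale /= [g x * a]mulrC.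
Qed.

Lemma is_derive1_affine (m n x : R) : is_derive x (1 : R) (fun y => m + n * y) n.
Proof.
have h := is_deriveD (is_derive_cst m x (1 : R)) (is_deriveZ n (is_derive_id x (1 : R))).
by apply: is_derive_eq h _; rewrite add0r [_ *: 1]mulr1.
Qed.

Lemma near_eq_is_derive1 f g x a : (\near x, f x = g x) ->
  is_derive x (1 : R) f a -> is_derive x (1 : R) g a.
Proof. exact: near_eq_is_derive. Qed.

Lemma is_derive1_continuous f x a : is_derive x (1 : R) f a -> {for x, continuous f}.
Proof. by move=> [h _]; apply/differentiable_continuous/derivable1_diffP. Qed.

End DeriveReal.

(** * Smooth bump functions *)

Section Bump.
Context {R : realType}.
Local Notation mu := (@lebesgue_measure R).
Local Notation I := (unit_itv R).
Implicit Types (f g phi : R -> R).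

(** The factor [y^-k] makes the family stable: the derivative of a member is a linear combination of
    two others, so smoothness of [exp(-1/y)] extended by zero follows by induction. *)
Definition flat_exp (k : nat) (y : R) : R :=
  if 0 < y then y ^- k * expR (- y^-1) else 0.

(** One term of the exponential series at [1/y], the one of degree [k + 2], already beats [y^-k] by
    a factor [y^2]. A quadratic bound is what forces derivative 0 at the origin. *)
Lemma flat_exp_le k (y : R) : 0 < y -> flat_exp k y <= k.+2`!%:R * y ^+ 2.
Proof.
move=> y0; rewrite /flat_exp y0.
have yi0 : 0 <= y^-1 by rewrite invr_ge0 ltW.
have h := expR_ge1Dxn k.+1 yi0.
rewrite expRN ler_pdivrMr ?expR_gt0//.
have h2 : y^-1 ^+ k.+2 / k.+2`!%:R <= expR y^-1.
  by apply: le_trans h; rewrite lerDr.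
have fp : 0 < k.+2`!%:R :> R by rewrite ltr0n fact_gt0.
rewrite ler_pdivrMr// in h2.
have e : y ^- k = y ^+ 2 * y^-1 ^+ k.+2.
  have yn : y != 0 by rewrite gt_eqF.
  by rewrite exprVn -[k.+2]addn2 exprD invfM mulrCA mulfV ?mulr1// expf_neq0.
rewrite e.
have -> : k.+2`!%:R * y ^+ 2 * expR y^-1 = y ^+ 2 * (expR y^-1 * k.+2`!%:R) by ring.
by rewrite ler_wpM2l// exprn_ge0// ltW.
Qed.

Lemma flat_exp_ge0 k (y : R) : 0 <= flat_exp k y.
Proof.
rewrite /flat_exp; case: ifPn => // y0.
by rewrite mulr_ge0 ?expR_ge0// invr_ge0 exprn_ge0// ltW.
Qed.

Lemma is_derive_flat_exp k (y : R) :
  is_derive y 1 (flat_exp k) (flat_exp k.+2 y - k%:R * flat_exp k.+1 y).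
Proof.
case: (ltgtP 0 y) => [y0|y0|<-].
- apply: (@near_eq_is_derive1 _ (fun z => z^-1 ^+ k * expR (- z^-1))).
    near=> z; rewrite /flat_exp ifT ?exprVn//.
    by near: z; exact: lt_nbhsr.
  have yn : y != 0 by rewrite gt_eqF.
  have dV : is_derive y (1 : R) (fun z : R => z^-1) (- y ^- 2).
    have h := @is_deriveV _ id y 1 1 yn (is_derive_id _ _).
    by apply: is_derive_eq h _; rewrite /GRing.scale /= mulr1.
  have dX : is_derive y (1 : R) (fun z : R => z^-1 ^+ k) (k%:R * y^-1 ^+ k.-1 * - y ^- 2).
    have h := is_deriveX k dV.
    rewrite [X in is_derive _ _ X _](_ : _ = (fun z : R => z^-1) ^+ k); first exact: h.
    by apply/funext => z; elim: (k) => // n ih; rewrite !exprS /= ih.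
  have dE : is_derive y (1 : R) (fun z : R => expR (- z^-1)) (expR (- y^-1) * y ^- 2).
    have h := @is_derive1_comp _ expR (fun z : R => - z^-1) y _ _ (is_derive_expR _)
       (is_deriveN dV).
    by apply: is_derive_eq h _; rewrite opprK.
  have h := is_derive1M dX dE; apply: is_derive_eq h _.
  rewrite /flat_exp y0 -!exprVn.
  by case: (k) => [|n]; rewrite /= !exprS; ring.
- apply: (@near_eq_is_derive1 _ (cst 0)).
    near=> z; rewrite /flat_exp ifF//.
    by apply/negbTE; rewrite -leNgt ltW//; near: z; exact: lt_nbhsl.
  rewrite /flat_exp ifF ?ifF ?mulr0 ?subr0; [exact: is_derive_cst| |];
  by apply/negbTE; rewrite -leNgt ltW.
(* At the origin the difference quotient vanishes on the left and is at most [C * |h|] on the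
   right. *)
- rewrite /flat_exp ltxx mulr0 subr0.
  suff h : (fun h => h^-1 *: (flat_exp k (h *: (1:R) + 0) - flat_exp k 0)) @ 0^' --> (0 : R).
    by apply: DeriveDef; [apply/cvg_ex; exists 0|apply: cvg_lim].
  apply/cvgr0Pnorm_lt => /= e e0.
  set C : R := k.+2`!%:R.
  have C0 : 0 < C by rewrite ltr0n fact_gt0.
  near=> h.
  have hn0 : h != 0 by near: h; exact: nbhs_dnbhs_neq.
  rewrite addr0 {2}/flat_exp ltxx subr0 [h *: _]mulr1 [_ *: _]mulrC normrM normfV.
  rewrite ltr_pdivrMr ?normr_gt0// ger0_norm ?flat_exp_ge0//.
  have eh : 0 < e * `|h| by rewrite mulr_gt0 ?normr_gt0.
  have [h0|h0|h0] := ltgtP 0 h; last by rewrite h0 eqxx in hn0.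
    apply: (le_lt_trans (flat_exp_le _ _)) => //.
    rewrite gtr0_norm// expr2 mulrA ltr_pM2r// mulrC -ltr_pdivlMr//.
    rewrite -[ltLHS]gtr0_norm//; near: h; apply: dnbhs0_lt.
    by rewrite divr_gt0.
  by rewrite /flat_exp ifF//; apply/negbTE; rewrite -leNgt ltW.
Unshelve. all: by end_near. Qed.

(* Closed under differentiation by construction, hence made of smooth
   functions, all supported in [[a, b]]. *)
Inductive bumplike (c a b : R) : (R -> R) -> Prop :=
| bumplike_base k : bumplike c a b (fun x => flat_exp k (c * ((x - a) * (b - x))))
| bumplike_add f g : bumplike c a b f -> bumplike c a b g ->
    bumplike c a b (fun x => f x + g x)
| bumplike_aff (m n : R) f : bumplike c a b f ->
    bumplike c a b (fun x => (m + n * x) * f x).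

Lemma bumplike_derive c a b f : bumplike c a b f ->
  exists2 g, bumplike c a b g & forall x : R, is_derive x (1 : R) f (g x).
Proof.
elim => [k|f1 f2 _ [g1 b1 d1] _ [g2 b2 d2]|m n f1 bf1 [g1 b1 d1]].
- pose q (x : R) := c * ((x - a) * (b - x)).
  exists (fun x => (c * (a + b) + (-2 * c) * x) *
     (flat_exp k.+2 (q x) + (- k%:R + 0 * x) * flat_exp k.+1 (q x))).
    apply: bumplike_aff; apply: bumplike_add; first exact: bumplike_base.
    apply: bumplike_aff; exact: bumplike_base.
  move=> x.
  have dq : is_derive x (1 : R) q (c * (a + b) + (-2 * c) * x).
    have h1 := is_derive1_affine (- a) 1 x.
    have h2 := is_derive1_affine b (- 1) x.
    have h := is_derive1M (is_derive1_affine c 0 x) (is_derive1M h1 h2).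
    rewrite [q](_ : _ = (fun x => (c + 0 * x) * ((- a + 1 * x) * (b + -1 * x)))).
      by apply: is_derive_eq h _; ring.
    by apply/funext => y; rewrite /q; ring.
  have h := @is_derive1_comp _ (flat_exp k) q x _ _ (is_derive_flat_exp _ _) dq.
  by apply: is_derive_eq h _; ring.
- exists (fun x => g1 x + g2 x) => [|x]; [exact: bumplike_add|exact: is_derive1D].
- exists (fun x => (m + n * x) * g1 x + (n + 0 * x) * f1 x).
    by apply: bumplike_add; exact: bumplike_aff.
  move=> x; have h := is_derive1M (is_derive1_affine m n x) (d1 x).
  by apply: is_derive_eq h _; ring.
Qed.

Lemma bumplike_derivable c a b f : bumplike c a b f ->
  forall n (x : R), derivable (derive1n n f) x 1.
Proof.
move=> bf n; suff : bumplike c a b (derive1n n f).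
  by move=> /bumplike_derive[g _ d] x; case: (d x).
elim: n => // n /bumplike_derive[g bg d].
suff -> : derive1n n.+1 f = g by [].
by apply/funext => x; rewrite derive1nS derive1E; case: (d x).
Qed.

(** Equals [exp(-1/((n+1)(x-a)(b-x)))] on []a, b[] and 0 elsewhere; for growing [n] these functions
    tend to the indicator of []a, b[]. *)
Definition bump_fun (a b : R) (n : nat) (x : R) : R :=
  flat_exp 0 (n.+1%:R * ((x - a) * (b - x))).

Lemma bump_out a b n x : a < b -> ~ (`]a, b[%classic x) -> bump_fun a b n x = 0.
Proof.
move=> ab /=; rewrite in_itv /= => /negP; rewrite negb_and -!leNgt => xab.
rewrite /bump_fun /flat_exp ifF//; apply/negbTE; rewrite -leNgt.
rewrite pmulr_rle0 ?ltr0n//.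
case/orP: xab => h.
  by rewrite mulr_le0_ge0 ?subr_le0 ?subr_ge0// ltW// (le_lt_trans h).
by rewrite mulr_ge0_le0 ?subr_le0 ?subr_ge0// ltW// (lt_le_trans ab).
Qed.

Lemma test_function_bump a b n : 0 < a -> a < b -> b < 1 ->
  test_function (bump_fun a b n).
Proof.
move=> a0 ab b1; split.
  by move=> m x; apply: (@bumplike_derivable n.+1%:R a b); exact: bumplike_base.
exists `[a, b]%classic; split.
- exact: segment_compact.
- move=> x; rewrite /unit_itv /= !in_itv /= => /andP[ax xb].
  by rewrite (lt_le_trans a0 ax) (le_lt_trans xb b1).
- move=> x xab; apply: bump_out => // xab'; apply: xab.
  exact: subset_itv_oo_cc.
Qed.

Lemma bump_le1 a b n x : `|bump_fun a b n x| <= 1.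
Proof.
rewrite /bump_fun ger0_norm ?flat_exp_ge0// /flat_exp; case: ifPn => // y0.
by rewrite expr0 invr1 mul1r expR_le1 oppr_le0 invr_ge0 ltW.
Qed.

Lemma cvg_bump (a b x : R) : `]a, b[%classic x -> bump_fun a b n x @[n --> \oo] --> (1 : R).
Proof.
rewrite /= in_itv /= => /andP[ax xb].
set q := (x - a) * (b - x).
have q0 : 0 < q by rewrite mulr_gt0 ?subr_gt0.
have -> : (fun n => bump_fun a b n x) = (fun n => expR (- (n.+1%:R^-1 * q^-1))).
  apply/funext => n; rewrite /bump_fun /flat_exp -/q mulr_gt0 ?ltr0n//.
  by rewrite expr0 invr1 mul1r invfM.
rewrite -[X in _ --> X]expR0; apply: (@continuous_cvg _ _ _ _ _ _ expR); first exact: continuous_expR.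
rewrite -oppr0; apply: cvgN; rewrite -[X in _ --> X](mul0r q^-1).
apply: cvgM; [exact: cvg_harmonic|exact: cvg_cst].
Qed.

Lemma continuous_bump a b n : continuous (bump_fun a b n).
Proof.
move=> x; apply/differentiable_continuous/derivable1_diffP.
exact: (@bumplike_derivable n.+1%:R a b _ (bumplike_base _ _ _ _) 0).
Qed.

End Bump.

(** * Lebesgue measure on the unit interval and the fundamental lemma *)

Section Lebesgue01.
Context {R : realType}.
Local Notation mu := (@lebesgue_measure R).
Local Notation I := (unit_itv R).
Implicit Types (f g phi : R -> R).

Lemma measurable_unit_itv : measurable I.
Proof. exact: measurable_itv. Qed.
Hint Resolve measurable_unit_itv : core.

Lemma mu_unit_itv : mu I = 1%E.
Proof. by rewrite /unit_itv lebesgue_measure_itv /= lte_fin ltr01 sube0. Qed.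

Lemma unit_itvP (x : R) : I x <-> 0 < x < 1.
Proof. by rewrite /unit_itv /= in_itv. Qed.

Lemma open_unit_itv : open I.
Proof. exact: itv_open. Qed.

Lemma aeS (P Q : R -> Prop) : {ae mu, forall x, P x} -> (forall x, P x -> Q x) ->
  {ae mu, forall x, Q x}.
Proof.
by move=> h PQ; apply: (@filterS _ _ (ae_filter_ringOfSetsType mu) _ _ _ h) => x /PQ.
Qed.

Lemma aeI (P Q : R -> Prop) : {ae mu, forall x, P x} -> {ae mu, forall x, Q x} ->
  {ae mu, forall x, P x /\ Q x}.
Proof. exact: (@filterI _ _ (ae_filter_ringOfSetsType mu)). Qed.

Lemma Rdominated_convergence (D : set R) (f_ : nat -> R -> R) f g :
  measurable D -> (forall n, measurable_fun D (f_ n)) -> measurable_fun D f ->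
  {ae mu, forall x, D x -> f_ n x @[n --> \oo] --> f x} ->
  mu.-integrable D (EFin \o g) ->
  {ae mu, forall x, D x -> forall n, `|f_ n x| <= g x} ->
  mu.-integrable D (EFin \o f) /\
  (\int[mu]_(x in D) f_ n x)%R @[n --> \oo] --> (\int[mu]_(x in D) f x)%R.
Proof.
move=> mD mf_ mf cvf ig fg.
have cvf' : {ae mu, forall x, D x -> (fun n => (f_ n x)%:E) @ \oo --> (f x)%:E}.
  by apply: (aeS cvf) => x h Dx; apply: cvg_EFin; [near=> n|exact: h].
have fg' : {ae mu, forall x (n : nat), D x -> (`|(f_ n x)%:E| <= (g x)%:E)%E}.
  by apply: (aeS fg) => x h n Dx; rewrite abse_EFin lee_fin h.
have mf_' n : measurable_fun D (EFin \o f_ n) by apply/measurable_EFinP.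
have mf' : measurable_fun D (EFin \o f) by apply/measurable_EFinP.
have [h1 _ h3] := @dominated_convergence _ _ _ mu D mD
  (fun n => EFin \o f_ n) (EFin \o f) (EFin \o g) mf_' mf' cvf' ig fg'.
split => //; apply: fine_cvg => /=.
by rewrite fineK; [exact: h3|exact: integrable_fin_num].
Unshelve. all: by end_near. Qed.

Lemma integrable_le (D : set R) f g : measurable D -> measurable_fun D f ->
  mu.-integrable D (EFin \o g) -> (forall x, D x -> `|f x| <= g x) ->
  mu.-integrable D (EFin \o f).
Proof.
move=> mD mf ig fg; apply: le_integrable ig => //; first exact/measurable_EFinP.
by move=> x Dx; rewrite !abse_EFin lee_fin (le_trans (fg _ Dx))// ler_norm.
Qed.

Lemma integrable_sub (D E : set R) f : measurable D -> measurable E -> E `<=` D ->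
  mu.-integrable D (EFin \o f) -> mu.-integrable E (EFin \o f).
Proof. by move=> mD mE ED; exact: integrableS. Qed.

Lemma integrable_normr (D : set R) f : measurable D ->
  mu.-integrable D (EFin \o f) -> mu.-integrable D (EFin \o (fun x => `|f x|)).
Proof. by move=> mD h; have := integrable_norm h. Qed.

Lemma integrable_patch (D E : set R) f : measurable D -> measurable E ->
  mu.-integrable D (EFin \o f) -> mu.-integrable E (EFin \o (f \_ D)).
Proof.
move=> mD mE h; have -> : EFin \o (f \_ D) = (EFin \o f) \_ D by rewrite restrict_EFin.
apply/integrable_restrict => //; apply: (integrable_sub mD) => //.
exact: measurableI.
Qed.

(** The bumps approach the indicator of []a, b[] and are bounded by 1, so dominated convergence with
    majorant [|f|] applies; local integrability gives integrability since [[a, b]] is compact in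
    [I]. *)
Lemma integral_bump_lim f (a b : R) : 0 < a -> a < b -> b < 1 ->
  locally_integrable I f ->
  (forall phi, test_function phi -> \int[mu]_(x in I) (f x * phi x) = 0) ->
  \int[mu]_(x in `]a, b[) f x = 0.
Proof.
move=> a0 ab b1 [mf oI fI] h.
have abI : `[a, b]%classic `<=` I.
  move=> x; rewrite /unit_itv /= !in_itv /= => /andP[ax xb].
  by rewrite (lt_le_trans a0 ax) (le_lt_trans xb b1).
have oabI : `]a, b[%classic `<=` I by apply: subset_trans abI; exact: subset_itv_oo_cc.
have mfab : measurable_fun `]a, b[%classic f by apply: measurable_funS mf.
have fab : mu.-integrable `]a, b[ (EFin \o f).
  apply: (@integrableS _ _ _ mu `[a, b]%classic) => //; first exact: subset_itv_oo_cc.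
  apply/integrableP; split; first by apply/measurable_EFinP; apply: measurable_funS mf.
  exact: (fI _ abI (@segment_compact _ _ _)).
have [_ c] : mu.-integrable `]a, b[ (EFin \o f) /\
   (\int[mu]_(x in `]a, b[) (f x * bump_fun a b n x))%R @[n --> \oo] -->
   (\int[mu]_(x in `]a, b[) f x)%R.
  apply: (@Rdominated_convergence _ _ _ (fun x => `|f x|)) => //.
  - move=> n; apply: measurable_funM => //.
    by apply: measurable_funTS; apply: continuous_measurable_fun; exact: continuous_bump.
  - apply: aeW => x abx; rewrite -[X in _ --> X]mulr1.
    by apply: cvgM; [exact: cvg_cst|exact: cvg_bump].
  - exact: integrable_normr.
  - apply: aeW => x abx n; rewrite normrM ler_piMr ?normr_ge0//; exact: bump_le1.
suff e n : (\int[mu]_(x in `]a, b[) (f x * bump_fun a b n x))%R = 0.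
  have : (\int[mu]_(x in `]a, b[) (f x * bump_fun a b n x))%R @[n --> \oo] --> (0 : R).
    by under eq_fun do rewrite e; exact: cvg_cst.
  by move=> c0; exact: (cvg_unique _ c c0).
rewrite -[RHS](h _ (test_function_bump n a0 ab b1)).
have -> : `]a, b[%classic = I `&` `]a, b[%classic by rewrite setIidr.
rewrite Rintegral_mkcondr; apply: eq_Rintegral => x _.
rewrite patchE; case: ifPn => //; rewrite notin_setE => xab.
by rewrite bump_out ?mulr0.
Qed.

(** The windows used for every Lebesgue differentiation below, both in the fundamental lemma and in
    the lower semicontinuity proof. *)
Definition rshrink (x : R) (n : nat) : set R := `]x, x + n.+1%:R^-1[%classic.

Lemma mu_rshrink x n : mu (rshrink x n) = (n.+1%:R^-1)%:E.
Proof.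
rewrite /rshrink lebesgue_measure_itv /= lte_fin ltrDl invr_gt0 ltr0n ltn0Sn.
by rewrite -EFinB addrAC subrr add0r.
Qed.

Lemma rshrink_nicely x : nicely_shrinking x (rshrink x).
Proof.
split; first by move=> n; exact: measurable_itv.
have p n : 0 < (n.+1%:R^-1 : R) by rewrite invr_gt0 ltr0n.
(* The ball of radius [1/(n+1)] about [x] contains the window and has twice its measure. *)
exists (2, fun n => PosNum (p n)); split => //=.
- exact: cvg_harmonic.
- move=> n y; rewrite /rshrink /ball /= in_itv /= => /andP[xy yx].
  by rewrite ltr0_norm ?subr_lt0// opprB ltrBlDl.
- move=> n; rewrite mu_rshrink lebesgue_measure_ball; last exact: ltW.
  by rewrite -EFinM lee_fin /= mulr_natl.
Qed.

Lemma rshrink_sub (a b x : R) : a <= x -> x < b ->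
  \forall n \near \oo, rshrink x n `<=` `]a, b[%classic.
Proof.
move=> ax xb; near=> n => y; rewrite /rshrink /= !in_itv /= => /andP[xy yx].
rewrite (le_lt_trans ax xy) (lt_trans yx)// -ltrBrDl.
rewrite -[ltLHS]ger0_norm ?invr_ge0// -[_^-1]subr0 distrC.
near: n; have : 0 < b - x by rewrite subr_gt0.
by move: (b - x); apply/cvgrPdist_lt; exact: cvg_harmonic.
Unshelve. all: by end_near. Qed.

Lemma ae_right_average f : mu.-integrable I (EFin \o f) ->
  {ae mu, forall x, I x ->
    n.+1%:R * \int[mu]_(y in rshrink x n `&` I) f y @[n --> \oo] --> f x}.
Proof.
move=> intf.
have lf := integrable_locally_restrict measurable_unit_itv intf.
apply: (aeS (lebesgue_differentiation lf)) => x lx Ix.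
have := nice_lebesgue_differentiation rshrink_nicely lf lx.
rewrite patchE mem_set// => /fine_cvg /=.
apply: cvg_trans; apply: near_eq_cvg; near=> n => /=.
rewrite mu_rshrink inver gt_eqF ?invr_gt0// invrK fineM//.
  by rewrite Rintegral_mkcondr /Rintegral.
apply: integrable_fin_num.
  exact: measurable_itv.
by apply: integrable_patch => //; exact: measurable_itv.
Unshelve. all: by end_near. Qed.

(** All integrals of [f] over intervals inside [I] vanish, hence so do the averages whose limit is
    [f x] at almost every [x]. As [f] is only locally integrable, differentiation is applied to its
    truncations to compact intervals exhausting [I]. *)
Lemma fundamental_lemma f : locally_integrable I f ->
  (forall phi, test_function phi -> \int[mu]_(x in I) (f x * phi x) = 0) ->
  {ae mu, forall x, I x -> f x = 0}.
Proof.
move=> lf h.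
(* The shift by 3 keeps [a m] below [1/2], so no interval of the exhaustion is degenerate. *)
pose a (m : nat) : R := m.+3%:R^-1; pose b m := 1 - a m.
have a0 m : 0 < a m by rewrite invr_gt0 ltr0n.
have ab m : a m < b m.
  have : a m < 2^-1 by rewrite ltf_pV2 ?posrE ?ltr0n// ltr_nat.
  rewrite /b; lra.
have b1 m : b m < 1 by rewrite ltrBlDr ltrDl.
have abI m : `[a m, b m]%classic `<=` I.
  move=> x; rewrite /unit_itv /= !in_itv /= => /andP[ax xb].
  by rewrite (lt_le_trans (a0 m) ax) (le_lt_trans xb (b1 m)).
pose g m := f \_ `[a m, b m].
have ig m : mu.-integrable I (EFin \o g m).
  have -> : EFin \o g m = (EFin \o f) \_ `[a m, b m].
    by rewrite restrict_EFin.
  apply/integrable_restrict => //; rewrite setIidr//.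
  case: lf => mf _ fI; apply/integrableP; split.
    by apply/measurable_EFinP; apply: measurable_funS mf.
  exact: (fI _ (abI m) (@segment_compact _ _ _)).
have : {ae mu, forall x (m : nat), I x ->
    n.+1%:R * \int[mu]_(y in rshrink x n `&` I) g m y @[n --> \oo] --> g m x}.
  by apply/ae_foralln => m; apply: ae_right_average.
move=> /aeS; apply => x hx Ix.
have [m xab] : exists m, `]a m, b m[%classic x.
  move: Ix => /unit_itvP /andP[x0 x1].
  have c : (fun m => a m) @ \oo --> (0 : R).
    have := @cvg_harmonic R; rewrite -(cvg_shiftn 2); apply: cvg_trans.
    by apply: near_eq_cvg; near=> n; rewrite /a /= addn2.
  have e0 : 0 < Num.min x (1 - x) by rewrite lt_min x0 subr_gt0.
  have /cvgrPdist_lt/(_ _ e0)[m _ hm] := c; exists m.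
  have := hm m (leqnn m); rewrite sub0r normrN gtr0_norm// lt_min => /andP[h1 h2].
  by rewrite /= in_itv /= h1 /b; lra.
have := hx m Ix.
rewrite /g patchE mem_set; last exact: subset_itv_oo_cc.
move=> c.
suff c0 : n.+1%:R * \int[mu]_(y in rshrink x n `&` I) (f \_ `[a m, b m]) y
    @[n --> \oo] --> (0 : R) by exact: (cvg_unique _ c c0).
apply: cvg_near_cst.
have [axm xbm] : a m < x /\ x < b m by move: xab; rewrite /= in_itv /= => /andP.
near=> n.
have sh : rshrink x n `<=` `]a m, b m[%classic by near: n; apply: rshrink_sub => //; exact: ltW.
have xn : x + n.+1%:R^-1 <= b m.
  rewrite leNgt; apply/negP => bx.
  have : `]a m, b m[%classic (b m) by apply: sh; rewrite /rshrink /= in_itv /= xbm.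
  by rewrite /= in_itv /= ltxx andbF.
have -> : rshrink x n `&` I = rshrink x n.
  by apply: setIidl => y /sh yab; apply: (abI m); exact: subset_itv_oo_cc.
rewrite (_ : Rintegral _ _ _ = 0) ?mulr0//.
rewrite -[RHS](@integral_bump_lim f x (x + n.+1%:R^-1)) //.
- apply: eq_Rintegral => y; rewrite inE => /sh yab.
  by rewrite patchE mem_set//; exact: subset_itv_oo_cc.
- by apply: lt_trans (axm); exact: a0.
- by rewrite ltrDl invr_gt0 ltr0n.
- by apply: (le_lt_trans xn); exact: b1.
Unshelve. all: by end_near. Qed.

End Lebesgue01.

(** * Test functions, weak derivatives and integration by parts *)

Section WeakDerivatives.
Context {R : realType}.
Local Notation mu := (@lebesgue_measure R).
Local Notation I := (unit_itv R).
Implicit Types (f g h phi : R -> R) (a b c s t x y M N : R).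
Hint Resolve measurable_unit_itv : core.

Lemma measurable_funE (D : set R) f : measurable_fun D f ->
  measurable_fun D (fun x => (f x)%:E).
Proof. by move=> mf; apply/measurable_EFinP. Qed.

Lemma measurable_fun_normr (D : set R) f : measurable_fun D f ->
  measurable_fun D (fun x => `|f x|).
Proof. by move=> mf; apply: measurableT_comp. Qed.

Lemma integral01D f g : mu.-integrable I (EFin \o f) -> mu.-integrable I (EFin \o g) ->
  \int[mu]_(x in I) (f x + g x) = \int[mu]_(x in I) f x + \int[mu]_(x in I) g x.
Proof. by move=> fi gi; apply: RintegralD => //; exact: measurable_unit_itv. Qed.

Lemma integral01B f g : mu.-integrable I (EFin \o f) -> mu.-integrable I (EFin \o g) ->
  \int[mu]_(x in I) (f x - g x) = \int[mu]_(x in I) f x - \int[mu]_(x in I) g x.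
Proof. by move=> fi gi; apply: RintegralB => //; exact: measurable_unit_itv. Qed.

Lemma integral01Z c f : mu.-integrable I (EFin \o f) ->
  \int[mu]_(x in I) (c * f x) = c * \int[mu]_(x in I) f x.
Proof. by move=> fi; apply: RintegralZl => //; exact: measurable_unit_itv. Qed.

Lemma measurable_fun_sub (D E : set R) f : measurable D -> E `<=` D ->
  measurable_fun D f -> measurable_fun E f.
Proof. by move=> mD ED; exact: measurable_funS. Qed.

Lemma unit_itv_sub (a b : R) : 0 < a -> b < 1 -> `[a, b]%classic `<=` I.
Proof.
move=> a0 b1 x; rewrite /unit_itv /= !in_itv /= => /andP[ax xb].
by rewrite (lt_le_trans a0 ax) (le_lt_trans xb b1).
Qed.

Lemma derive1n_eq0 (K : set R) phi : closed K -> (forall x, ~ K x -> phi x = 0) ->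
  forall n x, ~ K x -> derive1n n phi x = 0.
Proof.
move=> cK h; elim=> [|n ih] x xK; first exact: h.
rewrite derive1nS derive1E.
have d : is_derive x (1 : R) (derive1n n phi) 0.
  have d0 : is_derive x (1 : R) (cst (0 : R)) 0 by exact: is_derive_cst.
  apply: near_eq_is_derive1 d0.
  have : nbhs x (~` K) by apply: open_nbhs_nbhs; split => //; exact: closed_openC.
  by apply: filterS => y /ih ->.
by case: d.
Qed.

Lemma test_function_derive1n phi n : test_function phi -> test_function (derive1n n phi).
Proof.
move=> [d [K [cK KI h]]]; split.
- move=> m x; rewrite /derive1n -iterD; exact: d.
- exists K; split => //; move=> x.
  have clK : closed K by apply: compact_closed cK; exact: Rhausdorff.
  exact: (derive1n_eq0 clK h).
Qed.

(** The support is compact in [I], hence misses neighbourhoods of 0 and 1. Having one interval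
    outside which all derivatives vanish turns integrals against [phi] into integrals over an
    interval away from the ends of [I]. *)
Lemma test_function_support phi : test_function phi ->
  exists a b : R, [/\ 0 < a, a < b, b < 1 &
    forall n x, ~ (`]a, b[%classic x) -> derive1n n phi x = 0].
Proof.
move=> [d [K [cK KI h]]].
have clK : closed K by apply: compact_closed cK; exact: Rhausdorff.
have z n := derive1n_eq0 clK h n.
have opK : open (~` K) by exact: closed_openC.
have n0 : nbhs (0 : R) (~` K).
  apply: open_nbhs_nbhs; split => // /KI; rewrite /unit_itv /= in_itv /= ltxx //.
have n1 : nbhs (1 : R) (~` K).
  by apply: open_nbhs_nbhs; split => // /KI; rewrite /unit_itv /= in_itv /= ltxx andbF.
have [e0 /= e00 he0] := n0; have [e1 /= e10 he1] := n1.
(* The 1 in the minimum gives [e <= 1/4], hence [e < 1 - e]. *)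
pose e : R := Num.min (Num.min e0 e1) 1 / 4.
have m0 : 0 < Num.min (Num.min e0 e1) 1 by rewrite !lt_min e00 e10 ltr01.
have me0 : Num.min (Num.min e0 e1) 1 <= e0 by rewrite !ge_min lexx.
have me1 : Num.min (Num.min e0 e1) 1 <= e1 by rewrite !ge_min lexx orbT.
have mo : Num.min (Num.min e0 e1) 1 <= 1 by rewrite ge_min lexx orbT.
exists e, (1 - e); split; rewrite ?/e; try lra.
move=> n x; rewrite /= in_itv /= => /negP; rewrite negb_and -!leNgt => xe.
apply: z => Kx.
have := KI _ Kx; rewrite /unit_itv /= in_itv /= => /andP[x0 x1].
case/orP: xe => xe.
- apply: (he0 x) => //; rewrite /ball /= sub0r normrN gtr0_norm//; lra.
- apply: (he1 x) => //; rewrite /ball /= gtr0_norm ?subr_gt0//; lra.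
Qed.

Lemma test_function_continuous phi : test_function phi -> continuous phi.
Proof.
move=> [d _] x; apply/differentiable_continuous/derivable1_diffP; exact: (d 0).
Qed.

Lemma test_function_bounded phi : test_function phi ->
  exists M : R, forall x, `|phi x| <= M.
Proof.
move=> tphi; have [a [b [a0 ab b1 z]]] := test_function_support tphi.
have cphi : {within `[a, b], continuous (fun x => `|phi x|)}.
  apply: continuous_subspaceT => x; apply: cvg_norm; exact: test_function_continuous.
have [c _ hc] := EVT_max (ltW ab) cphi.
exists `|phi c| => x.
have [xab|xab] := pselect (`]a, b[%classic x).
  by apply: hc; apply: subset_itv_oo_cc.
by rewrite [phi x](z 0 x xab) normr0.
Qed.

Lemma test_function_measurable phi : test_function phi -> measurable_fun [set: R] phi.
Proof. by move=> t; apply: continuous_measurable_fun; exact: test_function_continuous. Qed.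

Lemma integrable_loc_test f phi : locally_integrable I f -> test_function phi ->
  mu.-integrable I (EFin \o (fun x => f x * phi x)).
Proof.
move=> [mf oI fI] tphi.
have [a [b [a0 ab b1 z]]] := test_function_support tphi.
have [M hM] := test_function_bounded tphi.
have fab : mu.-integrable `[a, b] (EFin \o f).
  apply/integrableP; split.
    by apply/measurable_EFinP; apply: (measurable_fun_sub _ _ mf) => //; exact: unit_itv_sub.
  by apply: fI; [exact: unit_itv_sub|exact: segment_compact].
have h : mu.-integrable `[a, b] (EFin \o (fun x => f x * phi x)).
  apply: (@integrable_le _ _ _ (fun x => `|f x| * M)) => //.
  - apply: measurable_funM; first by apply: (measurable_fun_sub _ _ mf) => //; exact: unit_itv_sub.
    by apply: measurable_funTS; exact: test_function_measurable.
  - have := integrableZr _ M (integrable_normr _ fab); apply => //.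
  - by move=> x _; rewrite normrM ler_wpM2l.
have := integrable_patch _ measurable_unit_itv h.
rewrite (_ : (_ \_ _) = (fun x => f x * phi x)); first by apply.
apply/funext => x; rewrite patchE; case: ifPn => //; rewrite notin_setE => xab.
rewrite [phi x](z 0 x) ?mulr0// => xab'; apply: xab; exact: subset_itv_oo_cc.
Qed.

(** The difference [g - h] annihilates all test functions. This makes the arbitrary choice in
    [wderiv] harmless. *)
Lemma is_weak_derivative_uniq j f g h : is_weak_derivative j f g ->
  is_weak_derivative j f h -> {ae mu, forall x, I x -> g x = h x}.
Proof.
move=> [lf lg eg] [_ lh eh].
have : {ae mu, forall x, I x -> g x - h x = 0}.
  apply: fundamental_lemma; first exact: locally_integrableB.
  move=> phi tphi.
  under eq_Rintegral do rewrite mulrBl.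
  rewrite integral01B; [|exact: integrable_loc_test|exact: integrable_loc_test].
  have := eg _ tphi; rewrite (eh _ tphi) => e.
  by apply/eqP; rewrite subr_eq0; apply/eqP/esym; move: e; apply: mulfI; rewrite signr_eq0.
by move=> /aeS; apply => x hx /hx /eqP; rewrite subr_eq0 => /eqP.
Qed.

(** A working class of functions paired with their derivatives: differentiability is asked only
    inside [I], while boundedness of both gives integrability up to the endpoints. It is stable
    under sums, products and, away from zero, inverse square roots, which covers all quantities
    built from a curve of [Y]. *)
Definition C1b f g : Prop := [/\ forall x, I x -> is_derive x (1 : R) f (g x),
  forall x, I x -> {for x, continuous g} &
  exists M : R, forall x, I x -> `|f x| <= M /\ `|g x| <= M].

Lemma continuous_measurable_unit_itv f : (forall x, I x -> {for x, continuous f}) ->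
  measurable_fun I f.
Proof.
move=> cf; apply: subspace_continuous_measurable_fun => //.
apply: continuous_in_subspaceT => x; rewrite inE; exact: cf.
Qed.

Lemma bounded_integrable f M : measurable_fun I f -> (forall x, I x -> `|f x| <= M) ->
  mu.-integrable I (EFin \o f).
Proof.
move=> mf fM; apply: measurable_bounded_integrable.
- exact: measurable_unit_itv.
- by rewrite [X in (X < _)%E](@mu_unit_itv R) ltry.
- exact: mf.
exists M; split; rewrite ?num_real// => N MN x Ix.
by rewrite /= (le_trans (fM _ Ix))// ltW.
Qed.

Lemma C1b_continuous f g : C1b f g -> forall x, I x -> {for x, continuous f}.
Proof. by move=> [d _ _] x /d; exact: is_derive1_continuous. Qed.

Lemma C1b_measurable f g : C1b f g -> measurable_fun I f.
Proof. by move=> h; apply: continuous_measurable_unit_itv; exact: C1b_continuous h. Qed.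

Lemma C1b_measurable' f g : C1b f g -> measurable_fun I g.
Proof. by case=> _ h _; apply: continuous_measurable_unit_itv. Qed.

Lemma C1b_integrable f g : C1b f g -> mu.-integrable I (EFin \o f).
Proof.
move=> h; case: (h) => _ _ [M hM]; apply: (@bounded_integrable _ M).
  exact: C1b_measurable h.
by move=> x /hM[].
Qed.

Lemma C1b_integrable' f g : C1b f g -> mu.-integrable I (EFin \o g).
Proof.
move=> h; case: (h) => _ _ [M hM]; apply: (@bounded_integrable _ M).
  exact: C1b_measurable' h.
by move=> x /hM[].
Qed.

Lemma C1b_FTC f g s t : C1b f g -> 0 < s -> s < t -> t < 1 ->
  \int[mu]_(x in `]s, t[) g x = f t - f s.
Proof.
move=> h s0 st t1; case: (h) => d c _.
have stI := unit_itv_sub s0 t1.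
have Is : I s by apply: stI; rewrite /= in_itv /= lexx ltW.
have It : I t by apply: stI; rewrite /= in_itv /= lexx ltW.
have cI x : I x -> f @ x --> f x by exact: C1b_continuous h x.
have := @continuous_FTC2 _ g f s t st.
have -> : (\int[mu]_(x in `[s, t]) (g x)%:E)%E = (\int[mu]_(x in `]s, t[) (g x)%:E)%E.
  rewrite integral_itv_bndoo//; apply/measurable_EFinP.
  apply: (measurable_fun_sub _ _ (C1b_measurable' h)) => //; apply: subset_trans stI; exact: subset_itv_oo_cc.
rewrite /Rintegral => -> //.
- by apply: continuous_in_subspaceT => x; rewrite inE => /stI; exact: c.
- split.
  + by move=> x xst; case: (d x) => //; apply: stI; apply: subset_itv_oo_cc.
  + by apply: cvg_at_right_filter; exact: cI.
  + by apply: cvg_at_left_filter; exact: cI.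
- move=> x xst; rewrite derive1E; case: (d x) => //; apply: stI; exact: subset_itv_oo_cc.
Qed.

Lemma C1bM f g f' g' : C1b f f' -> C1b g g' ->
  C1b (fun x => f x * g x) (fun x => f' x * g x + f x * g' x).
Proof.
move=> hf hg; case: (hf) => df cf [M hM]; case: (hg) => dg cg [N hN].
split.
- by move=> x Ix; apply: is_derive1M; [exact: df|exact: dg].
- move=> x Ix; apply: cvgD; apply: cvgM.
  + exact: cf. + exact: C1b_continuous hg x Ix.
  + exact: C1b_continuous hf x Ix. + exact: cg.
- exists (M * N + M * N) => x Ix.
  have [a1 a2] := hM _ Ix; have [b1 b2] := hN _ Ix.
  have l1 := ler_pM (normr_ge0 _) (normr_ge0 _) a1 b1.
  have l2 := ler_pM (normr_ge0 _) (normr_ge0 _) a2 b1.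
  have l3 := ler_pM (normr_ge0 _) (normr_ge0 _) a1 b2.
  have l0 : 0 <= M * N by apply: le_trans l1; rewrite mulr_ge0.
  split; first by rewrite normrM (le_trans l1)// lerDl.
  by rewrite (le_trans (ler_normD _ _))// !normrM lerD.
Qed.

Lemma C1bD f g f' g' : C1b f f' -> C1b g g' ->
  C1b (fun x => f x + g x) (fun x => f' x + g' x).
Proof.
move=> hf hg; case: (hf) => df cf [M hM]; case: (hg) => dg cg [N hN].
split.
- by move=> x Ix; apply: is_derive1D; [exact: df|exact: dg].
- by move=> x Ix; apply: cvgD; [exact: cf|exact: cg].
- exists (M + N) => x Ix.
  have [a1 a2] := hM _ Ix; have [b1 b2] := hN _ Ix.
  by split; rewrite (le_trans (ler_normD _ _))// lerD.
Qed.

Lemma C1b_cst (c : R) : C1b (cst c) (cst 0).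
Proof.
split; [by move=> x _; exact: is_derive_cst|by move=> x _; exact: cvg_cst|].
by exists `|c| => x _; rewrite /= normr0.
Qed.

Lemma test_function_C1b phi : test_function phi -> C1b phi (derive1n 1 phi).
Proof.
move=> t; have t1 := test_function_derive1n 1 t; split.
- move=> x _; rewrite derive1n1 derive1E; apply/derivableP.
  by case: t => d _; exact: (d 0).
- by move=> x _; exact: test_function_continuous.
- have [M hM] := test_function_bounded t; have [N hN] := test_function_bounded t1.
  exists (Num.max M N) => x _; split; rewrite le_max ?hM ?hN ?orbT//.
Qed.

(** The product [f * phi] has zero boundary values on an interval supporting [phi], so the integral
    of its derivative vanishes. *)
Lemma C1b_by_parts f g phi : C1b f g -> test_function phi ->
  \int[mu]_(x in I) (f x * derive1n 1 phi x) = - \int[mu]_(x in I) (g x * phi x).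
Proof.
move=> h tphi; have hp := test_function_C1b tphi.
have hm := C1bM h hp.
have [a [b [a0 ab b1 z]]] := test_function_support tphi.
have i1 : mu.-integrable I (EFin \o (fun x => f x * derive1n 1 phi x)).
  apply: integrable_loc_test (test_function_derive1n 1 tphi).
  by apply: open_integrable_locally; [exact: open_unit_itv|exact: C1b_integrable h].
have i2 : mu.-integrable I (EFin \o (fun x => g x * phi x)).
  apply: integrable_loc_test (tphi).
  by apply: open_integrable_locally; [exact: open_unit_itv|exact: C1b_integrable' h].
suff : \int[mu]_(x in I) (g x * phi x) + \int[mu]_(x in I) (f x * derive1n 1 phi x) = 0.
  by move/eqP; rewrite addrC addr_eq0 => /eqP.
rewrite -integral01D//.
have abI : `]a, b[%classic `<=` I.
  by apply: subset_trans (unit_itv_sub a0 b1); exact: subset_itv_oo_cc.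
transitivity (\int[mu]_(x in I `&` `]a, b[%classic) (g x * phi x + f x * derive1n 1 phi x)).
  rewrite Rintegral_mkcondr; apply: eq_Rintegral => x _.
  rewrite patchE; case: ifPn => //; rewrite notin_setE => xab.
  by rewrite (z 1 x)// [phi x](z 0 x)// !mulr0 addr0.
rewrite setIidr// (C1b_FTC hm)// [phi a](z 0) ?[phi b](z 0) ?mulr0 ?subrr//= in_itv /= ltxx ?andbF//.
Qed.

Lemma C1b_locally_integrable f g : C1b f g -> locally_integrable I f.
Proof.
by move=> h; apply: open_integrable_locally; [exact: open_unit_itv|exact: C1b_integrable h].
Qed.

Lemma C1b_locally_integrable' f g : C1b f g -> locally_integrable I g.
Proof.
by move=> h; apply: open_integrable_locally; [exact: open_unit_itv|exact: C1b_integrable' h].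
Qed.

Lemma is_weak_derivative0 f : locally_integrable I f -> is_weak_derivative 0 f f.
Proof. by move=> lf; split => // phi _; rewrite expr0 mul1r. Qed.

Lemma is_weak_derivativeS j f g g' : is_weak_derivative j f g -> C1b g g' ->
  is_weak_derivative j.+1 f g'.
Proof.
move=> [lf lg e] h; split => //; first exact: C1b_locally_integrable' h.
move=> phi tphi.
have t1 := test_function_derive1n 1 tphi.
have -> : derive1n j.+1 phi = derive1n j (derive1n 1 phi) by rewrite derive1Sn derive1n1.
by rewrite e// (C1b_by_parts h tphi) exprS mulrN mulN1r mulNr.
Qed.

End WeakDerivatives.

(** * Coordinates of products in three-space *)

Section VectorAlgebra.
Context {R : realType}.
Implicit Types (a b : 'rV[R]_3).

Lemma dotpE a b : dotp a b = a 0 0 * b 0 0 + a 0 1 * b 0 1 + a 0 2 * b 0 2.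
Proof.
rewrite /dotp !big_ord_recl big_ord0 addr0 addrA.
by congr (a 0 _ * b 0 _ + a 0 _ * b 0 _ + a 0 _ * b 0 _); apply/val_inj.
Qed.

Lemma crosspE0 a b : crossp a b 0 0 = a 0 1 * b 0 2 - a 0 2 * b 0 1.
Proof. by rewrite mxE; congr (a 0 _ * b 0 _ - a 0 _ * b 0 _); apply/val_inj. Qed.

Lemma crosspE1 a b : crossp a b 0 1 = a 0 2 * b 0 0 - a 0 0 * b 0 2.
Proof. by rewrite mxE; congr (a 0 _ * b 0 _ - a 0 _ * b 0 _); apply/val_inj. Qed.

Lemma crosspE2 a b : crossp a b 0 2 = a 0 0 * b 0 1 - a 0 1 * b 0 0.
Proof. by rewrite mxE; congr (a 0 _ * b 0 _ - a 0 _ * b 0 _); apply/val_inj. Qed.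

Lemma ord3P (P : 'I_3 -> Prop) : P 0 -> P 1 -> P 2 -> forall i, P i.
Proof.
move=> P0 P1 P2 [[|[|[|//]]] h].
- by rewrite (_ : Ordinal h = 0)//; apply/val_inj.
- by rewrite (_ : Ordinal h = 1)//; apply/val_inj.
- by rewrite (_ : Ordinal h = 2)//; apply/val_inj.
Qed.

Lemma dotp_ge0 a : 0 <= dotp a a.
Proof. by rewrite dotpE -!expr2; do !apply: addr_ge0; rewrite ?sqr_ge0. Qed.

Lemma enorm_ge0 a : 0 <= enorm a. Proof. exact: sqrtr_ge0. Qed.

Lemma sqr_enorm a : enorm a ^+ 2 = dotp a a.
Proof. by rewrite sqr_sqrtr// dotp_ge0. Qed.

Lemma coord_le_enorm a i : `|a 0 i| <= enorm a.
Proof.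
rewrite -sqrtr_sqr ler_wsqrtr// dotpE -!expr2.
by elim/ord3P: i; have := sqr_ge0 (a 0 0); have := sqr_ge0 (a 0 1);
  have := sqr_ge0 (a 0 2); lra.
Qed.

Lemma enorm0 : enorm (0 : 'rV[R]_3) = 0.
Proof. by rewrite /enorm dotpE !mxE !mulr0 !addr0 sqrtr0. Qed.

End VectorAlgebra.

(** * Lebesgue spaces on the unit interval *)

Section LpSpaces.
Context {R : realType}.
Local Notation mu := (@lebesgue_measure R).
Local Notation I := (unit_itv R).
Implicit Types (f g h : R -> R) (u v : curve R) (p : R).
Hint Resolve measurable_unit_itv : core.

Lemma le_powR_add1 (q : nat) p (x : R) : q%:R <= p -> 0 <= x -> x ^+ q <= 1 + x `^ p.
Proof.
move=> qp x0; have [x1|x1] := leP x 1.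
  by rewrite (le_trans (exprn_ile1 _ x0 x1))// lerDl powR_ge0.
by rewrite -powR_mulrn// ler_wpDl// ler_powR// ltW.
Qed.

Lemma integrable01D f g : mu.-integrable I (EFin \o f) -> mu.-integrable I (EFin \o g) ->
  mu.-integrable I (EFin \o (fun x => f x + g x)).
Proof.
by move=> fi gi; have := @integrableD _ _ _ mu I (@measurable_unit_itv R) _ _ fi gi.
Qed.

Lemma integrable01Z (c : R) f : mu.-integrable I (EFin \o f) ->
  mu.-integrable I (EFin \o (fun x => c * f x)).
Proof.
by move=> fi; have := @integrableZl _ _ _ mu I (@measurable_unit_itv R) c _ fi.
Qed.

Lemma measurable_patchT f : measurable_fun I f <-> measurable_fun [set: R] (f \_ I).
Proof. by have := measurable_restrictT f (@measurable_unit_itv R). Qed.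

Lemma measurable_powR_norm p f : measurable_fun I f ->
  measurable_fun I (fun x => `|f x| `^ p).
Proof.
move=> mf; apply: (@measurableT_comp _ _ _ _ _ _ (@powR R ^~ p)) => //.
exact: measurable_fun_normr.
Qed.

Lemma integrable_cst_unit_itv (c : R) : mu.-integrable I (EFin \o cst c).
Proof. by apply: (@bounded_integrable _ _ `|c|) => // x _ /=. Qed.

Lemma integrable_ae_eq f g : measurable_fun I g -> mu.-integrable I (EFin \o f) ->
  {ae mu, forall x, I x -> f x = g x} -> mu.-integrable I (EFin \o g).
Proof.
move=> mg fi fg; have mf : measurable_fun I f by apply/measurable_EFinP; exact: measurable_int fi.
apply/integrableP; split; first exact: measurable_funE.
case/integrableP: fi => _; apply: le_lt_trans.
rewrite (_ : (\int[mu]_(x in I) `|(EFin \o g) x|)%E = (\int[mu]_(x in I) `|(EFin \o f) x|)%E)//.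
apply: ae_eq_integral.
- exact: measurable_unit_itv.
- by apply: measurableT_comp => //; exact: measurable_funE.
- by apply: measurableT_comp => //; exact: measurable_funE.
- by apply: (aeS fg) => x h Ix /=; rewrite h.
Qed.

Lemma LpIP p f : 1 <= p -> LpI p f <->
  measurable_fun I f /\ mu.-integrable I (EFin \o (fun x => `|f x| `^ p)).
Proof.
move=> p1; split.
- move=> h; have mf : measurable_fun I f.
    by apply/measurable_patchT; have := sub_Lfun_mfun h; rewrite inE.
  split => //; have := Lfun_integrable p1 h.
  move=> /(integrable_sub measurableT measurable_unit_itv (@subsetT _ _)).
  move=> /(@integrable_ae_eq _ (fun x => `|f x| `^ p)); apply.
    exact: measurable_powR_norm.
  by apply: aeW => x Ix; rewrite patchE mem_set.
- move=> [mf fi]; rewrite /LpI; apply/andP; split; rewrite inE.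
    exact/measurable_patchT.
  rewrite /= /finite_norm unlock /Lnorm; apply: poweR_lty.
  case/integrableP: fi => _; apply: le_lt_trans.
  rewrite le_eqVlt; apply/orP; left; apply/eqP.
  apply: eq_trans (esym (integral_mkcond _ _)); apply: eq_integral => x _.
  rewrite /= !patchE; case: ifPn => //= _.
    by rewrite [in RHS]ger0_norm ?powR_ge0.
  by rewrite normr0 powR0// gt_eqF// (lt_le_trans ltr01).
Qed.

Lemma LpI_measurable p f : 1 <= p -> LpI p f -> measurable_fun I f.
Proof. by move=> p1 /(LpIP _ p1)[]. Qed.

Lemma LpI_ae_eq p f g : 1 <= p -> LpI p f -> measurable_fun I g ->
  {ae mu, forall x, I x -> f x = g x} -> LpI p g.
Proof.
move=> p1 /(LpIP _ p1)[mf fi] mg fg; apply/(LpIP _ p1); split => //.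
apply: integrable_ae_eq fi _; first exact: measurable_powR_norm.
by apply: (aeS fg) => x h Ix; rewrite h.
Qed.

Lemma LpI_lin p (c : R) f g : 1 <= p -> LpI p f -> LpI p g ->
  LpI p (fun x => c * f x + g x).
Proof.
move=> p1 hf hg; have p1' : (1 <= p%:E)%E by rewrite lee_fin.
have [_ h] := @Lfun_submod_closed _ _ _ mu _ p1'.
have e := h c _ _ hf hg; rewrite /LpI.
suff -> : (fun x => c * f x + g x) \_ I = c *: (f \_ I) + (g \_ I) by exact: e.
apply/funext => x; rewrite !patchE /=.
rewrite [RHS](_ : _ = c * (f \_ I) x + (g \_ I) x)// !patchE.
by case: ifPn => // _; rewrite mulr0 addr0.
Qed.

Lemma LpI_exprn_integrable (q : nat) p f : 1 <= p -> q%:R <= p -> LpI p f ->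
  mu.-integrable I (EFin \o (fun x => `|f x| ^+ q)).
Proof.
move=> p1 qp /(LpIP _ p1)[mf fi].
apply: (@integrable_le _ _ _ (fun x => 1 + `|f x| `^ p)) => //.
- by apply: measurable_funX; exact: measurable_fun_normr.
- exact: (integrable01D (integrable_cst_unit_itv 1) fi).
- by move=> x _; rewrite ger0_norm ?exprn_ge0// le_powR_add1.
Qed.

Lemma LpI_integrable p f : 1 <= p -> LpI p f -> mu.-integrable I (EFin \o f).
Proof.
move=> p1 hf; apply: (@integrable_le _ _ _ (fun x => `|f x| ^+ 1)) => //.
- exact: LpI_measurable hf.
- exact: LpI_exprn_integrable hf.
Qed.

Lemma LpI_locally_integrable p f : 1 <= p -> LpI p f -> locally_integrable I f.
Proof.
move=> p1 hf; apply: open_integrable_locally; first exact: open_unit_itv.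
exact: LpI_integrable hf.
Qed.

Lemma bounded_LpI p f M : 1 <= p -> measurable_fun I f ->
  (forall x, I x -> `|f x| <= M) -> LpI p f.
Proof.
move=> p1 mf fM; apply/LpIP => //; split => //.
apply: (@bounded_integrable _ _ (M `^ p)); first exact: measurable_powR_norm.
move=> x Ix; rewrite ger0_norm ?powR_ge0// ge0_ler_powR ?nnegrE//.
- by rewrite (le_trans _ p1).
- by rewrite (le_trans _ (fM _ Ix)).
- exact: fM.
Qed.

(** The norm is taken over the whole line; the extension by zero contributes nothing because
    [0^p = 0] for [p > 0]. *)
Lemma Lnorm_unit_itvE p h : 0 < p ->
  ('N[mu]_(p%:E)[EFin \o (h \_ I)] `^ p = \int[mu]_(x in I) (`|h x| `^ p)%:E)%E.
Proof.
move=> p0; have pn0 : p != 0 by rewrite gt_eqF.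
have -> := powR_Lnorm mu (EFin \o (h \_ I)) pn0.
apply: eq_trans (esym (integral_mkcond _ _)); apply: eq_integral => x _.
rewrite /= !patchE; case: ifPn => //= _.
by rewrite normr0 powR0.
Qed.

(** Hölder's inequality against the indicator of [I], whose conjugate norm is 1 since [I] has
    measure 1. *)
Lemma integral_le_Lnorm p h : 1 < p -> measurable_fun I h ->
  (\int[mu]_(x in I) `|h x|%:E <= 'N[mu]_(p%:E)[EFin \o (h \_ I)])%E.
Proof.
move=> p1 mh; have p0 : 0 < p by apply: lt_trans p1.
pose q := (1 - p^-1)^-1.
have q0 : 0 < q by rewrite invr_gt0 subr_gt0 invf_lt1.
have pq : p^-1 + q^-1 = 1 by rewrite /q invrK addrC subrK.
have mh' : measurable_fun [set: R] (h \_ I) by apply/measurable_patchT.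
have m1 : measurable_fun [set: R] (((fun=> 1) : R -> R) \_ I) by apply/measurable_patchT.
have := @hoelder _ _ _ mu (h \_ I) (((fun=> 1) : R -> R) \_ I) p q mh' m1 p0 q0 pq.
have -> : ('N[mu]_(q%:E)[EFin \o (((fun=> 1%R) : R -> R) \_ I)] = 1)%E.
  rewrite unlock /Lnorm (_ : (\int[mu]_x _)%E = 1%E) ?poweR1r//.
  apply: (@eq_trans _ _ (\int[mu]_(x in I) cst 1%E x)%E).
    apply: eq_trans (esym (integral_mkcond _ _)); apply: eq_integral => x _.
    rewrite /= !patchE; case: ifPn => //= _; first by rewrite normr1 powR1.
    by rewrite normr0 powR0// gt_eqF.
  by rewrite integral_cst; [rewrite [X in (_ * X)%E](@mu_unit_itv R) mule1|exact: measurable_unit_itv].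
rewrite mule1; apply: le_trans.
rewrite Lnorm1 le_eqVlt; apply/orP; left; apply/eqP.
apply: eq_trans (integral_mkcond _ _) _; apply: eq_integral => x _; rewrite /= !patchE; case: ifPn => //= _.
  by rewrite mulr1.
by rewrite mul0r normr0.
Qed.

End LpSpaces.

(** * Smooth curves as Sobolev curves *)

Section SmoothCurves.
Context {R : realType}.
Local Notation mu := (@lebesgue_measure R).
Local Notation I := (unit_itv R).
Local Notation coord := Defs.coord.
Implicit Types (f g h : R -> R) (u v w : curve R) (p : R).

(** The filter limit relative to [[0, 1]] is unfolded to an epsilon-delta statement for one
    coordinate; it yields two-sided derivatives inside [I] as well as continuity up to the
    endpoints. *)
Lemma quot01_coord w (x : R) i : derivable01 w x -> forall e : R, 0 < e ->
  exists2 d : R, 0 < d & forall y : R, `|y - x| < d -> y != x -> 0 <= y <= 1 ->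
    `|(y - x)^-1 * (coord w i y - coord w i x) - coord (deriv01 w) i x| < e.
Proof.
move=> dw e e0.
have c : (quot01 w x y) @[y --> within `[0, 1] x^'] --> deriv01 w x by [].
have ci : (quot01 w x y 0 i) @[y --> within `[0, 1] x^'] --> deriv01 w x 0 i.
  have cc : {for deriv01 w x, continuous (fun a : 'rV[R]_3 => a 0 i)}.
    exact: coord_continuous.
  exact: (cvg_comp _ _ c cc).
move/cvgrPdist_lt: ci => /(_ e e0) [d /= d0 hd]; exists d => // y yd yx y01.
have := hd y; rewrite /quot01 /coord !mxE distrC; apply => //.
by rewrite /ball /= distrC.
Qed.

Lemma is_derive_coord w (x : R) i : derivable01 w x -> I x ->
  is_derive x (1 : R) (coord w i) (coord (deriv01 w) i x).
Proof.
move=> dw /unit_itvP /andP[x0 x1].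
suff ? : (fun h : R => h^-1 *: (coord w i (h *: (1 : R) + x) - coord w i x)) @ 0^'
    --> coord (deriv01 w) i x.
  by apply: DeriveDef; [apply/cvg_ex; exists (coord (deriv01 w) i x)|apply: cvg_lim].
apply/cvgrPdist_lt => e e0.
have [d d0 hd] := quot01_coord i dw e0.
near=> h.
have hn0 : h != 0 by near: h; exact: nbhs_dnbhs_neq.
have hd' : `|h| < d by near: h; apply: dnbhs0_lt.
have hx : `|h| < x by near: h; apply: dnbhs0_lt.
have hx' : `|h| < 1 - x by near: h; apply: dnbhs0_lt; rewrite subr_gt0.
have := hd (h + x); rewrite addrK distrC [h *: 1]mulr1 [_ *: _]/(_ * _); apply => //.
- by rewrite -subr_eq0 addrK.
- by move: hx hx'; rewrite !ltr_norml => /andP[? ?] /andP[? ?]; apply/andP; split; lra.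
Unshelve. all: by end_near. Qed.

Lemma within_continuous_coord w i : (forall x : R, x \in `[0, 1] -> derivable01 w x) ->
  {within `[0, 1], continuous (coord w i)}.
Proof.
move=> dw; apply/subspace_continuousP => x x01.
have dx : derivable01 w x by apply: dw; rewrite inE in x01 *.
have [d d0 hd] := quot01_coord i dx ltr01.
set l := coord (deriv01 w) i x in hd.
apply/cvgrPdist_lt => e e0.
have M0 : 0 < `|l| + 1 by rewrite ltr_wpDl.
(* Within distance [d] the difference quotient stays below [|l| + 1], so an increment over less than
   [e / (|l| + 1)] is smaller than [e]. *)
pose r := Num.min d (e / (`|l| + 1)).
have r0 : 0 < r by rewrite lt_min d0 divr_gt0.
exists r => //= y; rewrite /ball /= => xy y01.
have [->|yx] := eqVneq y x; first by rewrite subrr normr0.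
have yr : `|y - x| < r by rewrite distrC.
have [yd ye] : `|y - x| < d /\ `|y - x| < e / (`|l| + 1).
  by move: yr; rewrite lt_min => /andP.
have y01' : 0 <= y <= 1 by move: y01; rewrite /= in_itv.
have h := hd y yd yx y01'.
have yx0 : y - x != 0 by rewrite subr_eq0.
have -> : coord w i x - coord w i y =
    - ((y - x) * ((y - x)^-1 * (coord w i y - coord w i x))).
  by rewrite mulrA mulfV// mul1r opprB.
rewrite normrN normrM.
have q : `|(y - x)^-1 * (coord w i y - coord w i x)| < `|l| + 1.
  have := ler_normD ((y - x)^-1 * (coord w i y - coord w i x) - l) l.
  by rewrite subrK => /le_lt_trans; apply; rewrite addrC ltrD2l.
apply: (@le_lt_trans _ _ (`|y - x| * (`|l| + 1))).
  by rewrite ler_wpM2l// ltW.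
by rewrite -ltr_pdivlMr.
Qed.

(** Differentiability at the endpoints, one-sided, gives continuity on the compact interval; this is
    the source of the bounds that [C1b] asks for. *)
Lemma bounded_coord w i : (forall x : R, x \in `[0, 1] -> derivable01 w x) ->
  exists M : R, forall x, I x -> `|coord w i x| <= M.
Proof.
move=> dw; have cw := within_continuous_coord (i := i) dw.
have cn : {within `[0, 1], continuous (fun x => `|coord w i x|)}.
  by move=> x; apply: cvg_norm; exact: cw.
have [c _ hc] := EVT_max ler01 cn.
exists `|coord w i c| => x Ix; apply: hc; exact: subset_itv_oo_cc Ix.
Qed.

Lemma smooth01_C1b u n i : smooth01 u ->
  C1b (coord (iter n deriv01 u) i) (coord (iter n.+1 deriv01 u) i).
Proof.
move=> su; have d m x : I x -> derivable01 (iter m deriv01 u) x.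
  by move=> Ix; apply: su; apply: subset_itv_oo_cc Ix.
split.
- by move=> x Ix; apply: is_derive_coord => //; exact: d.
- move=> x Ix; have := is_derive_coord i (d n.+1 x Ix) Ix.
  exact: is_derive1_continuous.
- have [M hM] := bounded_coord i (fun x xx => su n x xx).
  have [N hN] := bounded_coord i (fun x xx => su n.+1 x xx).
  exists (Num.max M N) => x Ix.
  by rewrite !le_max (hM x Ix) (hN x Ix) orbT.
Qed.

Lemma smooth01_weak u j i : smooth01 u ->
  is_weak_derivative j (coord u i) (coord (iter j deriv01 u) i).
Proof.
move=> su; elim: j => [|j ih].
  apply: is_weak_derivative0; exact: C1b_locally_integrable (smooth01_C1b 0 i su).
exact: is_weak_derivativeS ih (smooth01_C1b j i su).
Qed.

Lemma C1b_LpI p f g : 1 <= p -> C1b f g -> LpI p f.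
Proof.
move=> p1 h; case: (h) => _ _ [M hM]; apply: (@bounded_LpI _ p f M) => //.
  exact: C1b_measurable h.
by move=> x /hM[].
Qed.

Lemma C1b_LpI' p f g : 1 <= p -> C1b f g -> LpI p g.
Proof.
move=> p1 h; case: (h) => _ _ [M hM]; apply: (@bounded_LpI _ p g M) => //.
  exact: C1b_measurable' h.
by move=> x /hM[].
Qed.

Lemma smooth01_W3p p u : 1 <= p -> smooth01 u -> W3p p u.
Proof.
move=> p1 su i; split; first exact: C1b_LpI p1 (smooth01_C1b 0 i su).
move=> j _; exists (coord (iter j deriv01 u) i); split; first exact: smooth01_weak.
exact: C1b_LpI p1 (smooth01_C1b j i su).
Qed.

Lemma wderivP j f g : is_weak_derivative j f g -> is_weak_derivative j f (wderiv j f).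
Proof. by move=> h; apply: (@xgetPex _ _ [set g | is_weak_derivative j f g]); exists g. Qed.

Lemma wderiv_ae j f g : is_weak_derivative j f g ->
  {ae mu, forall x, I x -> wderiv j f x = g x}.
Proof. by move=> h; exact: is_weak_derivative_uniq (wderivP h) h. Qed.

Lemma W3p_wderiv p u j i : 1 <= p -> W3p p u -> (j <= 3)%N ->
  is_weak_derivative j (coord u i) (wderiv j (coord u i)) /\
  LpI p (wderiv j (coord u i)).
Proof.
move=> p1 hu j3; have [_ /(_ j j3)[g [hg Lg]]] := hu i.
have hw := wderivP hg; split => //.
apply: (LpI_ae_eq p1 Lg); first by case: hw => _ [].
exact: is_weak_derivative_uniq hg hw.
Qed.

Lemma ord3_ae (P : 'I_3 -> R -> Prop) : (forall i, {ae mu, forall x, P i x}) ->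
  {ae mu, forall x, forall i, P i x}.
Proof.
move=> h; apply: (aeS (aeI (h 0) (aeI (h 1) (h 2)))) => x [h0 [h1 h2]].
exact: ord3P.
Qed.

Lemma smooth01_wD u j : smooth01 u ->
  {ae mu, forall x, I x -> wD j u x = iter j deriv01 u x}.
Proof.
move=> su; have : {ae mu, forall x, forall i,
    I x -> wderiv j (coord u i) x = coord (iter j deriv01 u) i x}.
  by apply: ord3_ae => i; apply: wderiv_ae; exact: smooth01_weak.
by move=> /aeS; apply => x h Ix; apply/rowP => i; rewrite mxE h.
Qed.

Lemma is_weak_derivative_lin j (c : R) f1 f2 g1 g2 :
  is_weak_derivative j f1 g1 -> is_weak_derivative j f2 g2 ->
  locally_integrable I (fun x => c * f1 x + f2 x) ->
  locally_integrable I (fun x => c * g1 x + g2 x) ->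
  is_weak_derivative j (fun x => c * f1 x + f2 x) (fun x => c * g1 x + g2 x).
Proof.
move=> [lf1 lg1 e1] [lf2 lg2 e2] lf lg; split => // phi tphi.
have tj := test_function_derive1n j tphi.
have E k1 k2 psi : locally_integrable I k1 -> locally_integrable I k2 -> test_function psi ->
    \int[mu]_(x in I) ((c * k1 x + k2 x) * psi x) =
    c * \int[mu]_(x in I) (k1 x * psi x) + \int[mu]_(x in I) (k2 x * psi x).
  move=> l1 l2 tpsi; under eq_Rintegral do rewrite mulrDl -mulrA.
  rewrite integral01D.
  - by rewrite integral01Z//; exact: integrable_loc_test.
  - by apply: integrable01Z; exact: integrable_loc_test.
  - exact: integrable_loc_test.
by rewrite !E// e1// e2//; ring.
Qed.

Lemma coord_lin (c : R) u v i : coord (c *: u + v) i = (fun x => c * coord u i x + coord v i x).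
Proof. by apply/funext => x; rewrite /coord !mxE. Qed.

(** [wderiv] chooses its value for each function separately, so linearity is recovered only almost
    everywhere, from uniqueness. *)
Lemma W3p_lin p (c : R) u v : 1 <= p -> W3p p u -> W3p p v ->
  W3p p (c *: u + v) /\ (forall j, (j <= 3)%N ->
    {ae mu, forall x, I x -> wD j (c *: u + v) x = c *: wD j u x + wD j v x}).
Proof.
move=> p1 hu hv.
have wk j i : (j <= 3)%N -> is_weak_derivative j (coord (c *: u + v) i)
    (fun x => c * wderiv j (coord u i) x + wderiv j (coord v i) x) /\
    LpI p (fun x => c * wderiv j (coord u i) x + wderiv j (coord v i) x).
  move=> j3; rewrite coord_lin.
  have [wu Lu] := W3p_wderiv i p1 hu j3; have [wv Lv] := W3p_wderiv i p1 hv j3.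
  have Ll := LpI_lin c p1 Lu Lv; split => //.
  apply: is_weak_derivative_lin => //.
    have [Lu0 _] := hu i; have [Lv0 _] := hv i.
    exact: LpI_locally_integrable p1 (LpI_lin c p1 Lu0 Lv0).
  exact: LpI_locally_integrable p1 Ll.
split.
  move=> i; split.
    by rewrite coord_lin; apply: LpI_lin => //; [case: (hu i)|case: (hv i)].
  move=> j j3; have [h1 h2] := wk j i j3; by exists (fun x => c * wderiv j (coord u i) x + wderiv j (coord v i) x).
move=> j j3; have : {ae mu, forall x, forall i, I x -> wderiv j (coord (c *: u + v) i) x =
    c * wderiv j (coord u i) x + wderiv j (coord v i) x}.
  by apply: ord3_ae => i; apply: wderiv_ae; case: (wk j i j3).
by move=> /aeS; apply => x h Ix; apply/rowP => i; rewrite !mxE h.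
Qed.

Lemma W3p_sub p u v : 1 <= p -> W3p p u -> W3p p v ->
  W3p p (u - v) /\ (forall j, (j <= 3)%N ->
    {ae mu, forall x, I x -> wD j (u - v) x = wD j u x - wD j v x}).
Proof.
move=> p1 hu hv; have -> : u - v = (-1) *: v + u.
  by apply/funext => x; exact: (etrans (addrC _ _) (congr1 (fun z => z + u x) (esym (scaleN1r (v x))))).
have [h1 h2] := W3p_lin (-1) p1 hv hu; split => // j j3.
by apply: (aeS (h2 j j3)) => x h Ix; rewrite h// scaleN1r addrC.
Qed.

Lemma measurable_sqrt_fun f : measurable_fun I f -> measurable_fun I (fun x => Num.sqrt (f x)).
Proof.
move=> mf; apply: (@measurableT_comp _ _ _ _ _ _ (@Num.sqrt R)) => //.
by apply: continuous_measurable_fun; exact: sqrt_continuous.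
Qed.

Lemma measurable_enorm (w : curve R) : (forall i, measurable_fun I (coord w i)) ->
  measurable_fun I (fun x => enorm (w x)).
Proof.
move=> mw; rewrite /enorm; apply: measurable_sqrt_fun.
rewrite (_ : (fun x => dotp (w x) (w x)) = (fun x => coord w 0 x * coord w 0 x +
  coord w 1 x * coord w 1 x + coord w 2 x * coord w 2 x)).
  by apply: measurable_funD; [apply: measurable_funD|]; apply: measurable_funM.
by apply/funext => x; rewrite dotpE.
Qed.

Lemma coord_wD j u i : coord (wD j u) i = wderiv j (coord u i).
Proof. by apply/funext => x; rewrite /coord mxE. Qed.

Lemma W3p_measurable p u j i : 1 <= p -> W3p p u -> (j <= 3)%N ->
  measurable_fun I (coord (wD j u) i).
Proof.
move=> p1 hu j3; rewrite coord_wD; have [_] := W3p_wderiv i p1 hu j3.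
exact: LpI_measurable.
Qed.

Lemma Lnorm_le_W3p_norm p u j : (j <= 3)%N ->
  ('N[mu]_(p%:E)[EFin \o ((enorm \o wD j u) \_ I)] <= W3p_norm p u)%E.
Proof.
move=> j3; rewrite /W3p_norm; have j4 : (j < 4)%N by [].
rewrite (bigD1 (Ordinal j4)) //=; apply: leeDl; apply: sume_ge0 => i _; exact: Lnorm_ge0.
Qed.

Lemma W3p_norm_ge0 p u : (0 <= W3p_norm p u)%E.
Proof. by rewrite /W3p_norm; apply: sume_ge0 => i _; exact: Lnorm_ge0. Qed.

Lemma integral_wD_le p u j i : 1 < p -> W3p p u -> (j <= 3)%N ->
  (\int[mu]_(x in I) `|coord (wD j u) i x|%:E <= W3p_norm p u)%E.
Proof.
move=> p1 hu j3; have p1' := ltW p1.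
have me : measurable_fun I (enorm \o wD j u).
  by apply: measurable_enorm => k; exact: W3p_measurable hu j3.
apply: le_trans (Lnorm_le_W3p_norm p u j3); apply: le_trans (integral_le_Lnorm p1 me).
apply: ge0_le_integral.
- exact: measurable_unit_itv.
- by move=> x _; rewrite lee_fin.
- by apply: measurable_funE; apply: measurable_fun_normr; exact: W3p_measurable hu j3.
- exact: measurable_funE (measurable_fun_normr me).
- move=> x _; rewrite lee_fin /= [leRHS]ger0_norm ?enorm_ge0//; exact: coord_le_enorm.
Qed.

Lemma integral_powR_wD_le p u j : 1 < p -> (j <= 3)%N ->
  (\int[mu]_(x in I) (enorm (wD j u x) `^ p)%:E <= W3p_norm p u `^ p)%E.
Proof.
move=> p1 j3; have p0 : 0 < p by apply: lt_trans p1.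
have := Lnorm_unit_itvE (enorm \o wD j u) p0.
under eq_integral do rewrite ger0_norm ?enorm_ge0//.
move=> <-; apply: gt0_ler_poweR; first exact: ltW.
- by rewrite in_itv /= Lnorm_ge0 leey.
- by rewrite in_itv /= W3p_norm_ge0 leey.
- exact: Lnorm_le_W3p_norm.
Qed.

(** Serves to place [Y] inside [X], each smooth curve approximating itself. The derivatives of
    [u - u] are chosen representatives, zero only almost everywhere. *)
Lemma W3p_norm_sub p u : 1 < p -> W3p p u -> W3p_norm p (u - u) = 0%E.
Proof.
move=> p1 hu; have p1' := ltW p1; rewrite /W3p_norm big1// => j _.
have p0 : 0 < p by apply: lt_trans p1.
have j3 : (j <= 3)%N by rewrite -ltnS.
have [_ h] := W3p_sub p1' hu hu.
have [hs _] := W3p_sub p1' hu hu.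
rewrite unlock /Lnorm (_ : (\int[mu]_x _)%E = 0%E) ?poweR0r ?invr_eq0 ?gt_eqF//.
apply: (@eq_trans _ _ (\int[mu]_(x in I) (enorm (wD j (u - u) x) `^ p)%:E)%E).
  apply: eq_trans (esym (integral_mkcond _ _)); apply: eq_integral => x _.
  rewrite /= !patchE; case: ifPn => //= _; first by rewrite ger0_norm ?enorm_ge0.
  by rewrite normr0 powR0// gt_eqF.
apply: (@eq_trans _ _ (\int[mu]_(x in I) cst 0%E x)%E); last exact: integral0.
apply: ae_eq_integral.
- exact: measurable_unit_itv.
- apply: measurable_funE.
  have me : measurable_fun I (enorm \o wD j (u - u)).
    by apply: measurable_enorm => k; exact: W3p_measurable hs j3.
  by apply: (@measurableT_comp _ _ _ _ _ _ (@powR R ^~ p)).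
- exact: measurable_cst.
- apply: (aeS (h j j3)) => x hx Ix; rewrite hx// subrr enorm0 powR0// gt_eqF//.
Qed.

End SmoothCurves.

(** * Almost everywhere convergence from summable integrals *)

Section FastConvergence.
Context {R : realType}.
Local Notation mu := (@lebesgue_measure R).
Local Notation I := (unit_itv R).

(* The majorant is the sum of the series. *)
Lemma fast_L1_cvg (F : nat -> R -> R) : (forall k, measurable_fun I (F k)) ->
  (forall k x, 0 <= F k x) ->
  (forall k, (\int[mu]_(x in I) (F k x)%:E <= (1 / (2 ^ (k + 1))%:R)%:E)%E) ->
  exists g : R -> R, mu.-integrable I (EFin \o g) /\
    {ae mu, forall x, I x -> (forall k, F k x <= g x) /\ F k x @[k --> \oo] --> (0 : R)}.
Proof.
move=> mF F0 iF.
pose S x := (\sum_(k <oo) (F k x)%:E)%E.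
have F0' k x : (0 <= (F k x)%:E)%E by rewrite lee_fin.
have mS : measurable_fun I S.
  by apply: ge0_emeasurable_sum => [k x _ _|k _]; [exact: F0'|exact: measurable_funE].
have S0 x : (0 <= S x)%E by apply: nneseries_ge0 => k _ _; exact: F0'.
have iS : mu.-integrable I S.
  apply/integrableP; split => //.
  under eq_integral do rewrite gee0_abs//.
  rewrite integral_nneseries//=.
  - apply: (@le_lt_trans _ _ (\sum_(k <oo) (1 / (2 ^ (k + 1))%:R)%:E)%E).
      by apply: lee_nneseries => [k _ _|k _]; [apply: integral_ge0 => x _; exact: F0'|exact: iF].
    have := @cvg_geometric_eseries_half R 1 0.
    by move=> /(@cvg_lim _ _ _) -> //; rewrite ltry.
  - exact: measurable_unit_itv.
  - by move=> k; exact: measurable_funE.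
exists (fine \o S); split.
  apply: (@le_integrable _ _ _ mu I (@measurable_unit_itv R) _ S) iS.
    by apply: measurable_funE; apply: measurableT_comp mS.
  by move=> x _ /=; case: (S x) => [r| |] //=; rewrite normr0 leey.
have fS := @integrable_ae _ _ _ mu I (@measurable_unit_itv R) _ iS.
apply: (aeS fS) => x h Ix; have fx := h Ix.
have le n : (series (F ^~ x) n <= fine (S x))%R.
  rewrite -lee_fin fineK// /series /= -sumEFin; exact: nneseries_lim_ge.
have nd : nondecreasing_seq (series (F ^~ x)).
  by apply/nondecreasing_seqP => n; rewrite /series /= big_nat_recr//= lerDl.
split.
  move=> k; apply: le_trans (le k.+1).
  by rewrite /series /= big_nat_recr//= lerDr sumr_ge0.
apply: cvg_series_cvg_0; apply: nondecreasing_is_cvgn => //.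
by exists (fine (S x)) => _ [n _ <-].
Qed.

End FastConvergence.

(** * Pointwise algebra of the Frenet relations and of the density *)

Section FrenetAlgebra.
Context {R : realType}.
Implicit Types (a b t : 'rV[R]_3).

Lemma dotpC a b : dotp a b = dotp b a.
Proof. by rewrite !dotpE; ring. Qed.

Lemma dotp_lagrange a b :
  dotp a b ^+ 2 + dotp (crossp a b) (crossp a b) = dotp a a * dotp b b.
Proof. by rewrite !dotpE crosspE0 crosspE1 crosspE2; ring. Qed.

Lemma dotp_cauchy a b : dotp a b ^+ 2 <= dotp a a * dotp b b.
Proof. by rewrite -dotp_lagrange lerDl dotp_ge0. Qed.

Lemma triple_le t a b : dotp t (crossp a b) ^+ 2 <= dotp t t * (dotp a a * dotp b b).
Proof.
apply: le_trans (dotp_cauchy _ _) _; rewrite ler_wpM2l ?dotp_ge0//.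
by rewrite -dotp_lagrange lerDr sqr_ge0.
Qed.

(** The ratio of torsion to curvature as a function of the first three derivatives; at the weak
    derivatives of [u] it is [eta u]. *)
Definition curvature_torsion t a b : R := dotp t (crossp a b) / enorm a ^+ 3.

Definition sadowsky_density t a b : R :=
  enorm a ^+ 2 * (1 + curvature_torsion t a b ^+ 2) ^+ 2.

Lemma sadowsky_density_ge0 t a b : 0 <= sadowsky_density t a b.
Proof. by rewrite /sadowsky_density mulr_ge0// sqr_ge0. Qed.

(* The relations satisfied by [t = u'], [a = u''], [b = u'''] for a curve [u]
   parametrized by arc length. *)
Definition frenet (km : R) t a b : Prop :=
  [/\ dotp t t = 1, dotp t a = 0, dotp a a + dotp t b = 0 & km <= enorm a].

Lemma sqr_torsion_le km t a b : 0 < km -> frenet km t a b ->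
  curvature_torsion t a b ^+ 2 <= dotp b b / enorm a ^+ 4.
Proof.
move=> km0 [tt _ _ ka]; have a0 : 0 < enorm a by apply: lt_le_trans ka.
rewrite /curvature_torsion expr_div_n ler_pdivrMr ?exprn_gt0// mulrAC.
rewrite ler_pdivlMr ?exprn_gt0// -exprM.
have := triple_le t a b; rewrite tt mul1r -sqr_enorm => h.
have -> : dotp b b * enorm a ^+ (3 * 2) = enorm a ^+ 2 * dotp b b * enorm a ^+ 4 by ring.
by rewrite ler_wpM2r// exprn_ge0// ltW.
Qed.

Lemma sqr_add1_le (x : R) : (1 + x) ^+ 2 <= 2 + 2 * x ^+ 2.
Proof. by rewrite -subr_ge0 (_ : _ - _ = (1 - x) ^+ 2) ?sqr_ge0//; ring. Qed.

Lemma le_add1_sqr (x : R) : x <= 1 + x ^+ 2.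
Proof.
rewrite -subr_ge0 (_ : _ - _ = (x - 2^-1) ^+ 2 + 3 / 4); last by field.
by rewrite addr_ge0 ?sqr_ge0// divr_ge0.
Qed.

Lemma sqr_sum3_le (x y z M : R) : x ^+ 2 <= M -> y ^+ 2 <= M -> z ^+ 2 <= M ->
  (x + y + z) ^+ 2 <= 9 * M.
Proof.
move=> hx hy hz; rewrite -subr_ge0 (_ : _ - _ = 3 * (M - x ^+ 2) + 3 * (M - y ^+ 2) +
  3 * (M - z ^+ 2) + (x - y) ^+ 2 + (y - z) ^+ 2 + (x - z) ^+ 2); last by ring.
by do !apply: addr_ge0; rewrite ?sqr_ge0// mulr_ge0// subr_ge0.
Qed.

(** The density is at most [2 |a|^2 + 2 |a|^2 eta^4], and [eta^2 <= |b|^2 / |a|^4] turns the last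
    term into [2 |b|^4 / |a|^6], which the lower bound on the curvature controls. The factor 9 comes
    from squaring a sum of three terms. *)
Lemma sadowsky_density_le km t a b (M : R) : 0 < km -> frenet km t a b ->
  (forall i, `|a 0 i| ^+ 4 <= M) -> (forall i, `|b 0 i| ^+ 4 <= M) ->
  sadowsky_density t a b <= 2 * (1 + 9 * M) + 2 * (9 * M) / km ^+ 6.
Proof.
move=> km0 fr aM bM.
have a0 : 0 < enorm a by case: fr => _ _ _ ka; apply: lt_le_trans ka.
have s4 (c : 'rV[R]_3) : (forall i, `|c 0 i| ^+ 4 <= M) -> dotp c c ^+ 2 <= 9 * M.
  move=> cM; have e i : `|c 0 i| ^+ 4 = (c 0 i ^+ 2) ^+ 2.
    by rewrite -[(c 0 i ^+ 2)]real_normK ?num_real// -exprM.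
  have := cM 0; have := cM 1; have := cM 2; rewrite !e dotpE -!expr2.
  exact: (fun h3 h2 h1 => sqr_sum3_le h1 h2 h3).
have ts := sqr_torsion_le km0 fr.
set s := curvature_torsion t a b in ts *.
have s2 := sqr_add1_le (s ^+ 2).
have k2 : enorm a ^+ 2 <= 1 + 9 * M.
  by apply: le_trans (le_add1_sqr _) _; rewrite lerD2l sqr_enorm s4.
have k6 : enorm a ^+ 2 * (s ^+ 2) ^+ 2 <= 9 * M / km ^+ 6.
  have b4 := s4 b bM.
  have h1 : (s ^+ 2) ^+ 2 <= (dotp b b / enorm a ^+ 4) ^+ 2.
    by rewrite lerXn2r ?nnegrE ?sqr_ge0// (le_trans _ ts)// sqr_ge0.
  apply: (@le_trans _ _ (enorm a ^+ 2 * (dotp b b / enorm a ^+ 4) ^+ 2)).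
    by rewrite ler_wpM2l// sqr_ge0.
  have -> : enorm a ^+ 2 * (dotp b b / enorm a ^+ 4) ^+ 2 = dotp b b ^+ 2 / enorm a ^+ 6.
    by field; rewrite gt_eqF.
  have kk : km ^+ 6 <= enorm a ^+ 6.
    by case: fr => _ _ _ ka; apply: lerXn2r => //; rewrite nnegrE; apply: ltW.
  apply: ler_pM => //; first exact: sqr_ge0.
    by rewrite invr_ge0 exprn_ge0// ltW.
  by rewrite lef_pV2 ?posrE ?exprn_gt0.
rewrite /sadowsky_density -/s.
apply: (@le_trans _ _ (enorm a ^+ 2 * (2 + 2 * (s ^+ 2) ^+ 2))).
  by rewrite ler_wpM2l// sqr_ge0.
have -> : 2 * (9 * M) / km ^+ 6 = 2 * (9 * M / km ^+ 6) by ring.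
by rewrite mulrDr [_ * (2 * _)]mulrCA lerD// ?ler_pM2l// mulrC ler_pM2l.
Qed.

Lemma cvg_dotp (u v : nat -> 'rV[R]_3) a b :
  (forall i, u k 0 i @[k --> \oo] --> a 0 i) -> (forall i, v k 0 i @[k --> \oo] --> b 0 i) ->
  dotp (u k) (v k) @[k --> \oo] --> dotp a b.
Proof.
move=> ua vb; rewrite dotpE; under eq_fun do rewrite dotpE.
by apply: cvgD; [apply: cvgD|]; apply: cvgM.
Qed.

Lemma cvg_crossp (u v : nat -> 'rV[R]_3) a b :
  (forall i, u k 0 i @[k --> \oo] --> a 0 i) -> (forall i, v k 0 i @[k --> \oo] --> b 0 i) ->
  forall i, crossp (u k) (v k) 0 i @[k --> \oo] --> crossp a b 0 i.
Proof.
move=> ua vb; apply: ord3P.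
- by rewrite crosspE0; under eq_fun do rewrite crosspE0; apply: cvgB; apply: cvgM.
- by rewrite crosspE1; under eq_fun do rewrite crosspE1; apply: cvgB; apply: cvgM.
- by rewrite crosspE2; under eq_fun do rewrite crosspE2; apply: cvgB; apply: cvgM.
Qed.

Lemma cvg_enorm (u : nat -> 'rV[R]_3) a :
  (forall i, u k 0 i @[k --> \oo] --> a 0 i) -> enorm (u k) @[k --> \oo] --> enorm a.
Proof.
move=> ua; apply: (@continuous_cvg _ _ _ _ _ _ (@Num.sqrt R)); first exact: sqrt_continuous.
exact: cvg_dotp.
Qed.

Lemma cvg_exprn (u : nat -> R) (l : R) n : u k @[k --> \oo] --> l -> u k ^+ n @[k --> \oo] --> l ^+ n.
Proof.
move=> ul; apply: (@continuous_cvg _ _ _ _ _ _ (fun x : R => x ^+ n)) => //.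
exact: exprn_continuous.
Qed.

Lemma cvg_torsion (t a b : nat -> 'rV[R]_3) t0 a0 b0 : enorm a0 != 0 ->
  (forall i, t k 0 i @[k --> \oo] --> t0 0 i) -> (forall i, a k 0 i @[k --> \oo] --> a0 0 i) ->
  (forall i, b k 0 i @[k --> \oo] --> b0 0 i) ->
  curvature_torsion (t k) (a k) (b k) @[k --> \oo] --> curvature_torsion t0 a0 b0.
Proof.
move=> an tt aa bb; apply: cvgM; first by apply: cvg_dotp => //; exact: cvg_crossp.
by apply: cvgV; [rewrite expf_neq0|apply: cvg_exprn; exact: cvg_enorm].
Qed.

Lemma cvg_sadowsky_density (t a b : nat -> 'rV[R]_3) t0 a0 b0 : enorm a0 != 0 ->
  (forall i, t k 0 i @[k --> \oo] --> t0 0 i) -> (forall i, a k 0 i @[k --> \oo] --> a0 0 i) ->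
  (forall i, b k 0 i @[k --> \oo] --> b0 0 i) ->
  sadowsky_density (t k) (a k) (b k) @[k --> \oo] --> sadowsky_density t0 a0 b0.
Proof.
move=> an tt aa bb; apply: cvgM; first by apply: cvg_exprn; exact: cvg_enorm.
apply: cvg_exprn; apply: cvgD; first exact: cvg_cst.
by apply: cvg_exprn; exact: cvg_torsion.
Qed.

Lemma cvg_frenet km (t a b : nat -> 'rV[R]_3) t0 a0 b0 :
  (forall i, t k 0 i @[k --> \oo] --> t0 0 i) -> (forall i, a k 0 i @[k --> \oo] --> a0 0 i) ->
  (forall i, b k 0 i @[k --> \oo] --> b0 0 i) -> (forall k, frenet km (t k) (a k) (b k)) ->
  frenet km t0 a0 b0.
Proof.
move=> tt aa bb fr; have cst_lim (f : nat -> R) (l c : R) :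
    f k @[k --> \oo] --> l -> (forall k, f k = c) -> l = c.
  move=> fl fc; have : f k @[k --> \oo] --> c.
    by rewrite (_ : f = fun=> c); [exact: cvg_cst|exact/funext].
  by move=> h; exact: (cvg_unique _ fl h).
split.
- by apply: cst_lim (cvg_dotp tt tt) _ => k; case: (fr k).
- by apply: cst_lim (cvg_dotp tt aa) _ => k; case: (fr k).
- by apply: cst_lim (cvgD (cvg_dotp aa aa) (cvg_dotp tt bb)) _ => k; case: (fr k).
- by apply: (cvgr_to_ge (cvg_enorm aa)); near=> k; case: (fr k).
Unshelve. all: by end_near. Qed.

End FrenetAlgebra.

(** * Approximation of curves in [X] by smooth curves *)

Section Approximation.
Context {R : realType}.
Local Notation mu := (@lebesgue_measure R).
Local Notation I := (unit_itv R).
Local Notation coord := Defs.coord.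
Implicit Types (f g h : R -> R) (u v w : curve R) (p km : R).

Lemma C1bZ (c : R) f f' : C1b f f' -> C1b (fun x => c * f x) (fun x => c * f' x).
Proof.
move=> hf; have h := C1bM (C1b_cst c) hf.
rewrite (_ : (fun x => c * f' x) = (fun x => cst 0 x * f x + cst c x * f' x)) //.
by apply/funext => x /=; rewrite mul0r add0r.
Qed.

Lemma C1bB f g f' g' : C1b f f' -> C1b g g' ->
  C1b (fun x => f x - g x) (fun x => f' x - g' x).
Proof.
move=> hf hg; have h := C1bD hf (C1bZ (-1) hg).
rewrite (_ : (fun x => f x - g x) = (fun x => f x + -1 * g x)); last first.
  by apply/funext => x; rewrite mulN1r.
rewrite (_ : (fun x => f' x - g' x) = (fun x => f' x + -1 * g' x)) //.
by apply/funext => x; rewrite mulN1r.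
Qed.

Definition C1v w w' := forall i, C1b (coord w i) (coord w' i).

Lemma C1b_dotp w w' z z' : C1v w w' -> C1v z z' ->
  C1b (fun x => dotp (w x) (z x)) (fun x => dotp (w' x) (z x) + dotp (w x) (z' x)).
Proof.
move=> hw hz; have h := C1bD (C1bD (C1bM (hw 0) (hz 0)) (C1bM (hw 1) (hz 1))) (C1bM (hw 2) (hz 2)).
rewrite (_ : (fun x => dotp (w x) (z x)) = (fun x => coord w 0 x * coord z 0 x +
  coord w 1 x * coord z 1 x + coord w 2 x * coord z 2 x)); last first.
  by apply/funext => x; rewrite dotpE.
rewrite (_ : (fun x => dotp (w' x) _ + _) = (fun x =>
  coord w' 0 x * coord z 0 x + coord w 0 x * coord z' 0 x +
  (coord w' 1 x * coord z 1 x + coord w 1 x * coord z' 1 x) +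
  (coord w' 2 x * coord z 2 x + coord w 2 x * coord z' 2 x))) //.
by apply/funext => x; rewrite !dotpE /Defs.coord; ring.
Qed.

Lemma C1v_crossp w w' z z' : C1v w w' -> C1v z z' ->
  C1v (fun x => crossp (w x) (z x)) (fun x => crossp (w' x) (z x) + crossp (w x) (z' x)).
Proof.
move=> hw hz.
have E (i j k : 'I_3) : (forall a b : 'rV[R]_3, crossp a b 0 i = a 0 j * b 0 k - a 0 k * b 0 j) ->
    C1b (coord (fun x => crossp (w x) (z x)) i)
      (coord (fun x => crossp (w' x) (z x) + crossp (w x) (z' x)) i).
  move=> e; have h := C1bB (C1bM (hw j) (hz k)) (C1bM (hw k) (hz j)).
  rewrite (_ : coord (fun x => crossp (w x) (z x)) i =
    (fun x => coord w j x * coord z k x - coord w k x * coord z j x)); last first.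
    by apply/funext => x; rewrite /Defs.coord e.
  rewrite (_ : coord _ i = (fun x => coord w' j x * coord z k x + coord w j x * coord z' k x -
    (coord w' k x * coord z j x + coord w k x * coord z' j x))) //.
  by apply/funext => x; rewrite /Defs.coord [LHS]mxE !e; ring.
apply: ord3P; apply: E => a b; [exact: crosspE0|exact: crosspE1|exact: crosspE2].
Qed.

Lemma C1b_constant f g (c : R) : C1b f g -> (forall x, I x -> f x = c) ->
  forall x, I x -> g x = 0.
Proof.
move=> [d _ _] fc x Ix; have [_ <-] := d x Ix.
have d0 : is_derive x (1 : R) (cst c) 0 by exact: is_derive_cst.
have [_ //] : is_derive x (1 : R) f 0.
apply: near_eq_is_derive1 d0.
have : nbhs x I by apply: open_nbhs_nbhs; split => //; exact: open_unit_itv.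
by apply: filterS => y /fc ->.
Qed.

Definition smooth_frenet km v x :=
  frenet km (iter 1 deriv01 v x) (iter 2 deriv01 v x) (iter 3 deriv01 v x).

(** Differentiating [|u'|^2 = 1] gives the orthogonality of [u'] and [u'']; differentiating that
    gives the third relation. *)
Lemma Yspace_frenet A B km v : Yspace_curv A B km v ->
  forall x, I x -> smooth_frenet km v x.
Proof.
move=> [[sv _ _ v1] vk].
have c n : C1v (iter n deriv01 v) (iter n.+1 deriv01 v) by move=> i; exact: smooth01_C1b.
have tt x : I x -> dotp (iter 1 deriv01 v x) (iter 1 deriv01 v x) = 1.
  by move=> Ix; rewrite -sqr_enorm [enorm _](v1 x Ix) expr1n.
have ta x : I x -> dotp (iter 1 deriv01 v x) (iter 2 deriv01 v x) = 0.
  move=> Ix; have := C1b_constant (C1b_dotp (c 1%N) (c 1%N)) tt Ix.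
  rewrite dotpC; lra.
move=> x Ix; split; [exact: tt|exact: ta| |exact: vk].
exact: (C1b_constant (C1b_dotp (c 1%N) (c 2%N)) ta Ix).
Qed.

Lemma Yspace_X A B km p : 1 < p -> Yspace_curv A B km `<=` Xspace A B km p.
Proof.
move=> p1 v Yv; have p1' := ltW p1.
have Wv : W3p p v by apply: smooth01_W3p => //; case: Yv => -[].
by split => // e e0; exists v => //; rewrite W3p_norm_sub// lte_fin.
Qed.

Lemma pow4B_le (x y : R) : `|x - y| ^+ 4 <= 8 * (`|x| ^+ 4 + `|y| ^+ 4).
Proof.
have e (z : R) : `|z| ^+ 4 = (z ^+ 2) ^+ 2 by rewrite -[z ^+ 2]real_normK ?num_real// -exprM.
rewrite !e; set a := x ^+ 2; set b := y ^+ 2.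
have a0 : 0 <= a by exact: sqr_ge0.
have b0 : 0 <= b by exact: sqr_ge0.
have h1 : (x - y) ^+ 2 <= 2 * (a + b).
  by rewrite -subr_ge0 (_ : _ - _ = (x + y) ^+ 2) ?sqr_ge0// /a /b; ring.
apply: (@le_trans _ _ ((2 * (a + b)) ^+ 2)).
  by rewrite lerXn2r// nnegrE ?sqr_ge0// mulr_ge0// addr_ge0.
have -> : 8 * (a ^+ 2 + b ^+ 2) = (2 * (a + b)) ^+ 2 + 4 * (a - b) ^+ 2 by ring.
by rewrite lerDl mulr_ge0// sqr_ge0.
Qed.

(** Everything used at a single point [x] about an approximating sequence, bundled so that one
    exceptional null set suffices. Fourth powers are dominated because the density has quartic
    growth. *)
Definition approximates (u : curve R) (v : nat -> curve R) (G : R -> R) (x : R) :=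
  [/\ forall j i, (j <= 3)%N -> coord (wD j (v k)) i x @[k --> \oo] --> coord (wD j u) i x,
  forall k j i, (j <= 3)%N -> `|coord (wD j (v k)) i x| ^+ 4 <= G x &
  forall k j, wD j (v k) x = iter j deriv01 (v k) x].

(** The distances to [u] are prescribed to decay geometrically, so the sums over [k] of the [p]-th
    powers are integrable: the sequence itself converges a.e., together with its derivatives, under
    one integrable majorant. *)
Lemma Xspace_approximation A B km p u : 4 <= p -> Xspace A B km p u ->
  exists (v : nat -> curve R) (G : R -> R), [/\ forall k, Yspace_curv A B km (v k),
    forall k, (W3p_norm p (u - v k)%R < ((2 ^ (k + 3))%:R^-1)%:E)%E,
    mu.-integrable I (EFin \o G) &
    {ae mu, forall x, I x -> approximates u v G x}].
Proof.
move=> p4 [Wu hu].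
have p1 : 1 < p by apply: lt_le_trans p4; rewrite ltr1n.
have p1' := ltW p1; have p0 : 0 < p by apply: lt_trans p1.
(* Four orders of derivatives contribute at most [e k] each, because [r^p <= r] for [0 <= r <= 1];
   the total [4 * 2^-(k+3) = 2^-(k+1)] is the bound that [fast_L1_cvg] expects. *)
pose e (k : nat) : R := (2 ^ (k + 3))%:R^-1.
have e0 k : 0 < e k by rewrite invr_gt0 ltr0n expn_gt0.
have e1 k : e k <= 1 by rewrite invf_le1 ?ltr0n ?expn_gt0// ler1n expn_gt0.
have /choice[v hv] : forall k, exists v, Yspace_curv A B km v /\ (W3p_norm p (u - v)%R < (e k)%:E)%E.
  by move=> k; have [v Yv hv] := hu _ (e0 k); exists v.
have sv k : smooth01 (v k) by case: (hv k) => -[[]].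
have Wv k : W3p p (v k) by exact: smooth01_W3p.
have Wd k := W3p_sub p1' Wu (Wv k).
pose F k x := \sum_(j < 4) enorm (wD j (u - v k) x) `^ p.
have mFj k (j : 'I_4) : measurable_fun I (fun x => enorm (wD j (u - v k) x) `^ p).
  have me : measurable_fun I (enorm \o wD j (u - v k)).
    apply: measurable_enorm => i; apply: (W3p_measurable i p1' (Wd k).1).
    by rewrite -ltnS.
  by apply: (@measurableT_comp _ _ _ _ _ _ (@powR R ^~ p)).
have [g [ig hg]] : exists g : R -> R, mu.-integrable I (EFin \o g) /\
    {ae mu, forall x, I x -> (forall k, F k x <= g x) /\ F k x @[k --> \oo] --> (0 : R)}.
  apply: fast_L1_cvg.
  - move=> k; rewrite /F; apply: measurable_sum => j; exact: mFj.
  - by move=> k x; apply: sumr_ge0 => j _; exact: powR_ge0.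
  - move=> k; under eq_integral do rewrite /F -sumEFin.
    rewrite ge0_integral_sum//; [|exact: measurable_unit_itv| |]; first last.
    + by move=> j x _; rewrite lee_fin powR_ge0.
    + by move=> j; apply: measurable_funE; exact: mFj.
    apply: (@le_trans _ _ (\sum_(j < 4) (e k)%:E)%E).
      apply: lee_sum => j _; apply: (le_trans (integral_powR_wD_le _ p1 _)); first by rewrite -ltnS.
      have := (hv k).2; have := W3p_norm_ge0 p (u - v k).
      case: (W3p_norm p (u - v k)) => [r| |]//; rewrite lee_fin lte_fin => r0 re.
      rewrite poweR_EFin lee_fin; apply: le_trans (ltW re).
      move: r0; rewrite le_eqVlt => /predU1P[<-|r0]; first by rewrite powR0// gt_eqF.
      by rewrite ge1r_powR// r0 (le_trans (ltW re)).
    rewrite sumEFin lee_fin sumr_const card_ord -[X in X <= _]mulr_natl /e.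
    have -> : (2 ^ (k + 3) = 4 * 2 ^ (k + 1))%N by rewrite addnS expnS addnS expnS mulnA.
    by rewrite natrM invfM mulVKf ?pnatr_eq0// mul1r.
pose Gu x := \sum_(j < 4) \sum_(i < 3) `|coord (wD j u) i x| ^+ 4.
have iGu : mu.-integrable I (EFin \o Gu).
  have -> : EFin \o Gu = (fun x => \sum_(j < 4) \sum_(i < 3) (`|coord (wD j u) i x| ^+ 4)%:E)%E.
    by apply/funext => x /=; rewrite -sumEFin; apply: eq_bigr => j _; rewrite sumEFin.
  apply: (@integrable_sum _ _ _ mu I (@measurable_unit_itv R)) => j _.
  apply: (@integrable_sum _ _ _ mu I (@measurable_unit_itv R)) => i _.
  rewrite coord_wD; have [|_ Lj] := @W3p_wderiv R p u j i p1' Wu; first by rewrite -ltnS.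
  by have := LpI_exprn_integrable p1' p4 Lj.
(* Writing [v k = u - (u - v k)], the 8 is the constant of [pow4B_le], [Gu] bounds the fourth powers
   for [u], and [1 + g] those for [u - v k], since [y^4 <= 1 + y^p] for [p >= 4]. *)
exists v, (fun x => 8 * (Gu x + (1 + g x))); split.
- by move=> k; case: (hv k).
- by move=> k; case: (hv k).
- apply: integrable01Z; apply: integrable01D => //; apply: integrable01D => //.
  exact: integrable_cst_unit_itv.
have hwD : {ae mu, forall x k, forall j, (j <= 3)%N -> I x ->
    wD j (u - v k)%R x = wD j u x - wD j (v k) x}.
  apply/ae_foralln => k; apply/ae_foralln => j.
  have [j3|j3] := leqP j 3; last by apply: aeW.
  by apply: (aeS ((Wd k).2 j j3)) => x h _.
have hsm : {ae mu, forall x k, forall j, I x -> wD j (v k) x = iter j deriv01 (v k) x}.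
  by apply/ae_foralln => k; apply/ae_foralln => j; exact: smooth01_wD.
apply: (aeS (aeI hg (aeI hwD hsm))) => x [h1 [h2 h3]] Ix.
have [Fg F0] := h1 Ix.
have Dle k j i : (j <= 3)%N -> `|coord (wD j u) i x - coord (wD j (v k)) i x| `^ p <= F k x.
  move=> j3; have j4 : (j < 4)%N by [].
  apply: (@le_trans _ _ (enorm (wD j (u - v k) x) `^ p)).
    apply: ge0_ler_powR; rewrite ?nnegrE ?enorm_ge0 ?(ltW p0)//.
    have := coord_le_enorm (wD j (u - v k) x) i.
    by rewrite h2// !mxE /Defs.coord !mxE.
  rewrite /F (bigD1 (Ordinal j4)) //= lerDl; apply: sumr_ge0 => ? _; exact: powR_ge0.
split.
- move=> j i j3; apply/cvgrPdist_lt => eps eps0.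
  have ep : 0 < eps `^ p by exact: powR_gt0.
  have /cvgrPdist_lt/(_ _ ep) := F0; apply: filterS => k.
  rewrite sub0r normrN => Fk; rewrite ltNge; apply/negP => h.
  have : eps `^ p <= F k x.
    by apply: le_trans (Dle k j i j3); rewrite ge0_ler_powR ?nnegrE// ltW.
  by rewrite leNgt (le_lt_trans (ler_norm _) Fk).
- move=> k j i j3.
  set cu := coord (wD j u) i x; set cv := coord (wD j (v k)) i x.
  have -> : cv = cu - (cu - cv) by rewrite opprB addrC subrK.
  apply: (le_trans (pow4B_le _ _)); rewrite ler_pM2l//; apply: lerD.
    have j4 : (j < 4)%N by [].
    rewrite /Gu (bigD1 (Ordinal j4)) //= (bigD1 i)//= -addrA lerDl addr_ge0 ?sumr_ge0// => ? _.
    by apply: sumr_ge0.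
  apply: (le_trans (le_powR_add1 p4 (normr_ge0 _))); rewrite lerD2l.
  exact: le_trans (Dle k j i j3) (Fg k).
- by move=> k j; exact: h3.
Qed.

Lemma approximates_frenet A B km u (v : nat -> curve R) G x : (forall k, Yspace_curv A B km (v k)) ->
  I x -> approximates u v G x -> frenet km (wD 1 u x) (wD 2 u x) (wD 3 u x).
Proof.
move=> Yv Ix [c _ e].
apply: (@cvg_frenet _ km (fun k => wD 1 (v k) x) (fun k => wD 2 (v k) x) (fun k => wD 3 (v k) x)).
- by move=> i; exact: c.
- by move=> i; exact: c.
- by move=> i; exact: c.
- by move=> k; rewrite !e; exact: Yspace_frenet (Yv k) _ Ix.
Qed.

Lemma Xspace_frenet A B km p u : 4 <= p -> Xspace A B km p u ->
  {ae mu, forall x, I x -> frenet km (wD 1 u x) (wD 2 u x) (wD 3 u x)}.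
Proof.
move=> p4 /(Xspace_approximation p4)[v [G [Yv _ _ h]]].
by apply: (aeS h) => x hx Ix; exact: approximates_frenet Yv Ix (hx Ix).
Qed.

Definition wdensity u x := sadowsky_density (wD 1 u x) (wD 2 u x) (wD 3 u x).

Lemma sadowskyE u : sadowsky u = (\int[mu]_(s in I) (wdensity u s)%:E)%E.
Proof. by []. Qed.

Lemma wdensity_ge0 u x : 0 <= wdensity u x.
Proof. exact: sadowsky_density_ge0. Qed.

Definition measurable_curve w := forall i, measurable_fun I (coord w i).

Lemma measurable_dotp w z : measurable_curve w -> measurable_curve z ->
  measurable_fun I (fun x => dotp (w x) (z x)).
Proof.
move=> mw mz; rewrite (_ : (fun x => dotp (w x) (z x)) = (fun x => coord w 0 x * coord z 0 x +
  coord w 1 x * coord z 1 x + coord w 2 x * coord z 2 x)).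
  by apply: measurable_funD; [apply: measurable_funD|]; apply: measurable_funM.
by apply/funext => x; rewrite dotpE.
Qed.

Lemma measurable_crossp w z : measurable_curve w -> measurable_curve z ->
  measurable_curve (fun x => crossp (w x) (z x)).
Proof.
move=> mw mz.
have E (i j k : 'I_3) : (forall a b : 'rV[R]_3, crossp a b 0 i = a 0 j * b 0 k - a 0 k * b 0 j) ->
    measurable_fun I (coord (fun x => crossp (w x) (z x)) i).
  move=> e; rewrite (_ : coord _ i =
    (fun x => coord w j x * coord z k x - coord w k x * coord z j x)).
    by apply: measurable_funB; apply: measurable_funM.
  by apply/funext => x; rewrite /Defs.coord e.
apply: ord3P; apply: E => a b; [exact: crosspE0|exact: crosspE1|exact: crosspE2].
Qed.

Lemma measurable_funV_ge0 f : (forall x, 0 <= f x) -> measurable_fun I f ->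
  measurable_fun I (fun x => (f x)^-1).
Proof.
move=> f0 mf; rewrite (_ : (fun x => (f x)^-1) = (fun x => f x `^ (-1))).
  by apply: (@measurableT_comp _ _ _ _ _ _ (@powR R ^~ (-1))).
by apply/funext => x; rewrite powR_inv1.
Qed.

Lemma measurable_torsion t a b : measurable_curve t -> measurable_curve a ->
  measurable_curve b -> measurable_fun I (fun x => curvature_torsion (t x) (a x) (b x)).
Proof.
move=> mt ma mb; apply: measurable_funM.
  by apply: measurable_dotp => //; exact: measurable_crossp.
apply: measurable_funV_ge0; first by move=> x; rewrite exprn_ge0// enorm_ge0.
by apply: measurable_funX; exact: measurable_enorm.
Qed.

Lemma measurable_sadowsky_density t a b : measurable_curve t -> measurable_curve a ->
  measurable_curve b -> measurable_fun I (fun x => sadowsky_density (t x) (a x) (b x)).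
Proof.
move=> mt ma mb; apply: measurable_funM.
  by apply: measurable_funX; exact: measurable_enorm.
apply: measurable_funX; apply: measurable_funD => //.
by apply: measurable_funX; exact: measurable_torsion.
Qed.

Lemma measurable_wdensity p u : 1 <= p -> W3p p u -> measurable_fun I (wdensity u).
Proof.
move=> p1 Wu; apply: measurable_sadowsky_density => i; exact: W3p_measurable Wu _.
Qed.

(** Dominated convergence: [sadowsky_density_le] with [M = G x] supplies a majorant, and the limit
    has curvature at least [km > 0], where the density is continuous in the three derivatives. *)
Lemma approximates_sadowsky A B km p u (v : nat -> curve R) G : 0 < km -> 4 <= p -> Xspace A B km p u ->
  (forall k, Yspace_curv A B km (v k)) -> mu.-integrable I (EFin \o G) ->
  {ae mu, forall x, I x -> approximates u v G x} ->
  mu.-integrable I (EFin \o wdensity u) /\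
  \int[mu]_(x in I) wdensity (v k) x @[k --> \oo] --> \int[mu]_(x in I) wdensity u x.
Proof.
move=> km0 p4 [Wu _] Yv iG h.
have p1 : 1 <= p by apply: le_trans p4; rewrite ler1n.
have Wv k : W3p p (v k) by apply: smooth01_W3p => //; case: (Yv k) => -[].
apply: (@Rdominated_convergence _ _ _ _ (fun x => 2 * (1 + 9 * G x) + 2 * (9 * G x) / km ^+ 6)).
- exact: measurable_unit_itv.
- by move=> k; exact: measurable_wdensity (Wv k).
- exact: measurable_wdensity Wu.
- apply: (aeS h) => x hx Ix; have [c _ _] := hx Ix.
  have [_ _ _ ka] := approximates_frenet Yv Ix (hx Ix).
  apply: cvg_sadowsky_density.
  + by rewrite gt_eqF// (lt_le_trans km0).
  + by move=> i; exact: (c 1%N i).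
  + by move=> i; exact: (c 2%N i).
  + by move=> i; exact: (c 3%N i).
- apply: integrable01D.
    apply: integrable01Z; apply: integrable01D; first exact: integrable_cst_unit_itv.
    exact: integrable01Z.
  under eq_fun do rewrite mulrC mulrA.
  exact: (integrable01Z _ (integrable01Z (2 * 9) iG)).
- apply: (aeS h) => x hx Ix k; have [_ b e] := hx Ix.
  rewrite ger0_norm ?wdensity_ge0//; apply: sadowsky_density_le => //.
  + by rewrite !e; exact: Yspace_frenet (Yv k) _ Ix.
  + by move=> i; exact: (b k 2%N i).
  + by move=> i; exact: (b k 3%N i).
Qed.

End Approximation.

(** * The penalization function [g] *)

Section Penalization.
Context {R : realType}.
Implicit Types x y r : R.

Lemma gfunN x : gfun (- x) = gfun x.
Proof.
rewrite /gfun oppr_eq0 normrN; case: ifPn => // x0; case: ifPn => // x2.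
have [h1 h2] : 0 < 2 + x /\ 0 < 2 - x.
  by move: x2; rewrite ltr_norml => /andP[? ?]; split; lra.
rewrite opprK !ln_div ?posrE//.
by congr EFin; rewrite invrN mulNr -mulrN opprB.
Qed.

Lemma gfun_norm x : gfun `|x| = gfun x.
Proof. by case: (ger0P x) => _ //; exact: gfunN. Qed.

(** The right-hand side vanishes at 0 and has derivative [4 / (4 - t^2)], which is at least 1 on
    [[0, 2[]; the mean value theorem concludes. *)
Lemma ln_quotient_ge x : 0 < x -> x < 2 -> x <= ln ((2 + x) / (2 - x)).
Proof.
move=> x0 x2; have h1 : 0 < 2 + x by rewrite addr_gt0.
have h2 : 0 < 2 - x by rewrite subr_gt0.
pose f (t : R) := ln (2 + 1 * t) + (- 1) * ln (2 + -1 * t).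
pose df (t : R) := (2 + 1 * t)^-1 * 1 + (- 1) * ((2 + -1 * t)^-1 * -1).
have d (t : R) : 0 <= t -> t < 2 -> is_derive t (1 : R) f (df t).
  move=> t0 t2.
  have p1 : 0 < 2 + 1 * t by rewrite mul1r ltr_wpDr.
  have p2 : 0 < 2 + -1 * t by rewrite mulN1r subr_gt0.
  have d1 := @is_derive1_comp R (@ln R) (fun s => 2 + 1 * s) t _ _
    (is_derive1_ln p1) (is_derive1_affine 2 1 t).
  have d2 := @is_derive1_comp R (@ln R) (fun s => 2 + -1 * s) t _ _
    (is_derive1_ln p2) (is_derive1_affine 2 (-1) t).
  have := is_derive1D d1 (is_derive1M (is_derive_cst (-1 : R) t (1 : R)) d2).
  move=> h; apply: is_derive_eq h _; rewrite /df /=; ring.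
have cf : {within `[0, x], continuous f}.
  apply: continuous_in_subspaceT => t; rewrite inE /= in_itv /= => /andP[t0 tx].
  exact: is_derive1_continuous (d t t0 (le_lt_trans tx x2)).
have [|c] := MVT x0 _ cf (df := df).
  by move=> t; rewrite in_itv /= => /andP[t0 tx]; apply: d; [exact: ltW|exact: lt_trans tx x2].
rewrite in_itv /= => /andP[c0 cx] e.
have e0 : f 0 = 0 by rewrite /f !mulr0 addr0 mulN1r subrr.
have ex : f x = ln ((2 + x) / (2 - x)).
  by rewrite /f ln_div ?posrE// mul1r !mulN1r.
rewrite -ex -[f x]subr0 -e0 e subr0 -[leLHS]mul1r ler_pM2r//.
have p1 : 0 < 2 + c by rewrite addr_gt0.
have p2 : 0 < 2 - c by rewrite subr_gt0 (lt_trans cx).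
have -> : df c = 4 / ((2 + c) * (2 - c)).
  by rewrite /df mul1r mulN1r; field; rewrite !gt_eqF.
rewrite ler_pdivlMr ?mulr_gt0// mul1r -subr_ge0 (_ : _ - _ = c ^+ 2) ?sqr_ge0//.
by ring.
Qed.

Lemma gfun_ge1 x : (1 <= gfun x)%E.
Proof.
rewrite -gfun_norm; set y : R := `|x|; have : 0 <= y by exact: normr_ge0.
move: y => {x} y y0.
rewrite /gfun; case: ifPn => // yn0; case: ifPn => y2; last exact: leey.
have yp : 0 < y by rewrite lt_neqAle eq_sym yn0.
rewrite ger0_norm// in y2.
by rewrite lee_fin -[leLHS](mulVf yn0); apply: ler_wpM2l; [rewrite invr_ge0|exact: ln_quotient_ge].
Qed.

(** From [ln (1 + z) <= z] with [z = 2 y / (2 - y)]. The bound tends to 1 with [r], which makes the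
    penalization disappear on curves with bounded [eta']. *)
Lemma gfun_le x r : `|x| <= r -> r < 2 -> (gfun x <= (2 / (2 - r))%:E)%E.
Proof.
rewrite -gfun_norm; have := normr_ge0 x; move: `|x| => y y0 yr r2.
have r0 : 0 <= r by apply: le_trans yr.
have p2 : 0 < 2 - r by rewrite subr_gt0.
rewrite /gfun; case: ifPn => yn0.
  by rewrite lee_fin ler_pdivlMr// mul1r gerBl.
have yp : 0 < y by rewrite lt_neqAle eq_sym yn0.
rewrite ger0_norm// (le_lt_trans yr r2) lee_fin.
have p3 : 0 < 2 - y by rewrite subr_gt0 (le_lt_trans yr).
have -> : (2 + y) / (2 - y) = 1 + 2 * y / (2 - y) by field; rewrite gt_eqF.
apply: (@le_trans _ _ (y^-1 * (2 * y / (2 - y)))).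
  rewrite ler_pM2l ?invr_gt0//; apply: le_ln1Dx.
  by apply: lt_le_trans (_ : 0 <= _); [rewrite ltrN10|rewrite divr_ge0// ?mulr_ge0// ltW].
have -> : y^-1 * (2 * y / (2 - y)) = 2 / (2 - y) by field; rewrite yn0 gt_eqF.
by rewrite ler_pM2l// lef_pV2 ?posrE// lerD2l lerN2.
Qed.

(** Written as [x * (x^2)^-1], whose second factor is a real power of a nonnegative base; both sides
    are 0 at 0. *)
Lemma measurable_fun_invr : measurable_fun [set: R] (fun x : R => x^-1).
Proof.
have e : (fun x : R => x^-1) = (fun x => x * (x ^+ 2) `^ (-1)).
  apply/funext => x; rewrite powR_inv1 ?sqr_ge0//.
  have [->|x0] := eqVneq x 0; first by rewrite invr0 mul0r.
  by rewrite expr2 invfM mulrA mulfV// mul1r.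
rewrite e; apply: measurable_funM => //.
by apply: (@measurableT_comp _ _ _ _ _ _ (@powR R ^~ (-1))) => //; exact: measurable_funX.
Qed.

Lemma measurable_gfun : measurable_fun [set: R] (@gfun R).
Proof.
apply: measurable_fun_ifT; [exact: measurable_fun_eqr|exact: measurable_cst|].
apply: measurable_fun_ifT; last exact: measurable_cst.
  by apply: measurable_fun_ltr => //; exact: measurableT_comp.
apply/measurable_EFinP; apply: measurable_funM; first exact: measurable_fun_invr.
apply: (@measurableT_comp _ _ _ _ _ _ (@ln R)) => //.
apply: measurable_funM; first exact: measurable_funD.
by apply: (measurableT_comp measurable_fun_invr); exact: measurable_funB.
Qed.

End Penalization.

(** * Lower and upper limits of extended real sequences *)

Section LimInf.
Context {R : realType}.
Implicit Types u v : (\bar R)^nat.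
Local Open Scope ereal_scope.

Lemma limn_einf_ge u l : (\forall n \near \oo, l <= u n) -> l <= limn_einf u.
Proof.
move=> [N _ h]; rewrite limn_einf_lim; apply: lime_ge; first exact: is_cvg_einfs.
exists N => // n /= Nn; apply: le_ereal_inf_tmp => _ [m /= nm <-].
by apply: h => /=; exact: leq_trans nm.
Qed.

Lemma le_limn_einf u v : (\forall n \near \oo, u n <= v n) -> limn_einf u <= limn_einf v.
Proof.
move=> [N _ h]; rewrite !limn_einf_lim; apply: lee_lim; [exact: is_cvg_einfs..|].
exists N => // n /= Nn; apply: le_ereal_inf_tmp => _ [m /= nm <-].
apply: le_trans (h m _); last exact: leq_trans nm.
by apply: ereal_inf_lbound; exists m.
Qed.

Lemma le_limn_esup u v : (\forall n \near \oo, u n <= v n) -> limn_esup u <= limn_esup v.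
Proof.
move=> h; rewrite -leeN2 -!limn_einfN; apply: le_limn_einf.
by apply: filterS h => n /= uv; rewrite leeN2.
Qed.

End LimInf.

(** * Strong approximation and the relaxation bound *)

Section StrongWeak.
Context {R : realType}.
Local Notation mu := (@lebesgue_measure R).
Local Notation I := (unit_itv R).
Implicit Types (f g h : R -> R) (u v w : curve R) (p km : R).

Lemma strong_weak_cvg p u (w : nat -> curve R) (e : nat -> R) : 1 < p ->
  W3p p u -> (forall k, W3p p (w k)) ->
  (forall k, (W3p_norm p (u - w k)%R <= (e k)%:E)%E) -> e @ \oo --> (0 : R) ->
  weak_cvg p w u.
Proof.
move=> p1 Wu Ww he e0 L [linL [C hC]]; have p1' := ltW p1.
have eL k : L (u - w k)%R = L u - L (w k).
  have -> : u - w k = (-1) *: w k + u.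
    by apply/funext => x; exact: (etrans (addrC _ _) (congr1 (fun z => z + u x) (esym (scaleN1r (w k x))))).
  by rewrite linL// mulN1r addrC.
have b k : `|L u - L (w k)| <= `|C| * e k.
  rewrite -eL -lee_fin; have Wd := (W3p_sub p1' Wu (Ww k)).1.
  apply: (le_trans (hC _ Wd)); have := he k; have := W3p_norm_ge0 p (u - w k).
  case: (W3p_norm p (u - w k)) => [r| |]//; rewrite !lee_fin => r0 re.
  by apply: (le_trans (ler_norm _)); rewrite normrM (ger0_norm r0) ler_wpM2l.
apply/cvgrPdist_le => eps eps0.
have : (fun k => `|C| * e k) @ \oo --> (0 : R).
  by rewrite -[X in _ --> X](mulr0 `|C|); apply: cvgM => //; exact: cvg_cst.
move/cvgrPdist_le => /(_ _ eps0); apply: filterS => k; rewrite sub0r normrN => h.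
exact: le_trans (b k) (le_trans (ler_norm _) h).
Qed.

Lemma cvg_pow2_inv : (fun k => (2 ^ (k + 3))%:R^-1 : R) @ \oo --> (0 : R).
Proof.
apply/cvgrPdist_le => eps eps0.
have /cvgrPdist_le/(_ _ eps0) := @cvg_harmonic R; apply: filterS => k.
rewrite !sub0r !normrN !ger0_norm ?invr_ge0//; apply: le_trans.
rewrite lef_pV2 ?posrE ?ltr0n ?expn_gt0// ler_nat.
by apply: (leq_trans (ltn_expl k (ltnSn 1))); rewrite leq_exp2l// leq_addr.
Qed.

Lemma wdensity_fin A B km p u : 0 < km -> 4 <= p -> Xspace A B km p u ->
  mu.-integrable I (EFin \o wdensity u).
Proof.
move=> km0 p4 Xu; have [v [G [Yv _ iG h]]] := Xspace_approximation p4 Xu.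
by have [] := approximates_sadowsky km0 p4 Xu Yv iG h.
Qed.

Lemma sadowskyR A B km p u : 0 < km -> 4 <= p -> Xspace A B km p u ->
  sadowsky u = (\int[mu]_(x in I) wdensity u x)%:E.
Proof.
move=> km0 p4 Xu; rewrite sadowskyE /Rintegral fineK//.
apply: integrable_fin_num; first exact: measurable_unit_itv.
exact: (wdensity_fin km0 p4 Xu).
Qed.

Lemma Xspace_recovery A B km p u : 0 < km -> 4 <= p -> Xspace A B km p u ->
  exists v : nat -> curve R, [/\ forall k, Yspace_curv A B km (v k),
    forall k, (W3p_norm p (u - v k)%R < ((2 ^ (k + 3))%:R^-1)%:E)%E &
    sadowsky (v k) @[k --> \oo] --> sadowsky u].
Proof.
move=> km0 p4 Xu; have [v [G [Yv vu iG h]]] := Xspace_approximation p4 Xu.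
have p1 : 1 < p by apply: lt_le_trans p4; rewrite ltr1n.
have [_ c] := approximates_sadowsky km0 p4 Xu Yv iG h.
exists v; split => //; rewrite (sadowskyR km0 p4 Xu).
have -> : (fun k => sadowsky (v k)) = (fun k => (\int[mu]_(x in I) wdensity (v k) x)%:E).
  by apply/funext => k; apply: (sadowskyR km0 p4 (A := A) (B := B)); exact: Yspace_X.
by apply: cvg_EFin; [near=> k|exact: c].
Unshelve. all: by end_near. Qed.

Lemma relaxation_bound A B km p (G : curve R -> R) : 0 < km -> 4 <= p ->
  weakly_seq_lsc p (Xspace A B km p) G ->
  (forall u, Yspace_curv A B km u -> ((G u)%:E <= sadowsky u)%E) ->
  forall u, Xspace A B km p u -> ((G u)%:E <= sadowsky u)%E.
Proof.
move=> km0 p4 lscG GY u Xu; have [v [Yv vu c]] := Xspace_recovery km0 p4 Xu.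
have p1 : 1 < p by apply: lt_le_trans p4; rewrite ltr1n.
have Xv k : Xspace A B km p (v k) by exact: Yspace_X.
have wv : weak_cvg p v u.
  apply: (@strong_weak_cvg p u v (fun k => (2 ^ (k + 3))%:R^-1)) => //.
  - by case: Xu.
  - by move=> k; case: (Xv k).
  - by move=> k; exact: ltW.
  - exact: cvg_pow2_inv.
apply: (le_trans (lscG v u Xv Xu wv)).
rewrite -(cvg_limn_einf_sup c).1; apply: le_limn_einf.
by near=> k; exact: GY.
Unshelve. all: by end_near. Qed.

End StrongWeak.

(** * The recovery sequence *)

Section RecoverySequence.
Context {R : realType}.
Local Notation mu := (@lebesgue_measure R).
Local Notation I := (unit_itv R).
Implicit Types (f g h : R -> R) (u v w : curve R) (p km : R).

(** Meant for [f = |u''|^2], bounded below by [km^2]: it puts [1 / |u''|] in the class [C1b], the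
    square root being evaluated away from its singularity. *)
Lemma C1b_rsqrt f f' (m : R) : 0 < m -> (forall x, I x -> m <= f x) -> C1b f f' ->
  C1b (fun x => (Num.sqrt (f x))^-1) (fun x => - 2^-1 * (Num.sqrt (f x))^-1 ^+ 3 * f' x).
Proof.
move=> m0 fm hf; case: (hf) => df cf' [M hM].
have s0 x : I x -> 0 < Num.sqrt (f x).
  by move=> Ix; rewrite sqrtr_gt0 (lt_le_trans m0)// fm.
have sm x : I x -> (Num.sqrt (f x))^-1 <= (Num.sqrt m)^-1.
  by move=> Ix; rewrite lef_pV2 ?posrE ?s0 ?sqrtr_gt0// ler_wsqrtr// fm.
have d x : I x -> is_derive x (1 : R) (fun x => (Num.sqrt (f x))^-1)
    (- 2^-1 * (Num.sqrt (f x))^-1 ^+ 3 * f' x).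
  move=> Ix; have fx0 : 0 < f x by apply: lt_le_trans (fm x Ix).
  have d1 := is_derive1_comp (is_derive1_sqrt fx0) (df x Ix).
  have sn : (Num.sqrt \o f) x != 0 by rewrite gt_eqF//= s0.
  have h := is_deriveV sn d1; apply: is_derive_eq h _.
  rewrite /GRing.scale /=; set s := Num.sqrt (f x).
  by field; rewrite gt_eqF// /s s0.
split => //.
- move=> x Ix; apply: cvgM; last exact: cf'.
  apply: cvgM; first exact: cvg_cst.
  have c : {for x, continuous (fun x => (Num.sqrt (f x))^-1)} by exact: is_derive1_continuous (d x Ix).
  by apply: (@continuous_cvg _ _ _ _ _ _ (fun x : R => x ^+ 3)) => //; exact: exprn_continuous.
- exists (Num.max (Num.sqrt m)^-1 (2^-1 * (Num.sqrt m)^-1 ^+ 3 * M)) => x Ix.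
  have r0 : 0 <= (Num.sqrt (f x))^-1 by rewrite invr_ge0 sqrtr_ge0.
  split; first by rewrite le_max ger0_norm// sm.
  rewrite le_max; apply/orP; right.
  have h2 : 0 <= 2^-1 :> R by rewrite invr_ge0.
  rewrite normrM normrM normrN (ger0_norm h2) (ger0_norm (exprn_ge0 3 r0)).
  apply: ler_pM; [exact: mulr_ge0 h2 (exprn_ge0 3 r0)|exact: normr_ge0| |by case: (hM x Ix)].
  by rewrite ler_pM2l ?invr_gt0//; apply: lerXn2r; rewrite ?nnegrE ?invr_ge0 ?sqrtr_ge0//; exact: sm.
Qed.

Lemma dotp_ge_km A B km v x : 0 < km -> Yspace_curv A B km v -> I x ->
  km ^+ 2 <= dotp (iter 2 deriv01 v x) (iter 2 deriv01 v x).
Proof.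
move=> km0 Yv Ix; have [_ _ _ k] := Yspace_frenet Yv Ix.
by rewrite -sqr_enorm; apply: lerXn2r => //; rewrite nnegrE ?enorm_ge0// ltW.
Qed.

(** The ratio is the triple product times three copies of [1 / |u''|], so the product rule of [C1b]
    applies. The formula of the derivative is left implicit: its existence and boundedness are what
    the penalization estimate uses. *)
Lemma smooth_torsion_C1b A B km v : 0 < km -> Yspace_curv A B km v ->
  exists e', C1b (fun x => curvature_torsion (iter 1 deriv01 v x) (iter 2 deriv01 v x)
    (iter 3 deriv01 v x)) e'.
Proof.
move=> km0 Yv; have sv : smooth01 v by case: Yv => -[].
have c n : C1v (iter n deriv01 v) (iter n.+1 deriv01 v) by move=> i; exact: smooth01_C1b.
have hD := C1b_dotp (c 1%N) (C1v_crossp (c 2%N) (c 3%N)).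
have hr := C1b_rsqrt (exprn_gt0 2 km0) (fun x Ix => dotp_ge_km km0 Yv Ix) (C1b_dotp (c 2%N) (c 2%N)).
have h := C1bM hD (C1bM hr (C1bM hr hr)).
suff -> : (fun x => curvature_torsion (iter 1 deriv01 v x) (iter 2 deriv01 v x)
    (iter 3 deriv01 v x)) = (fun x => dotp (iter 1 deriv01 v x)
    (crossp (iter 2 deriv01 v x) (iter 3 deriv01 v x)) *
    ((Num.sqrt (dotp (iter 2 deriv01 v x) (iter 2 deriv01 v x)))^-1 *
    ((Num.sqrt (dotp (iter 2 deriv01 v x) (iter 2 deriv01 v x)))^-1 *
     (Num.sqrt (dotp (iter 2 deriv01 v x) (iter 2 deriv01 v x)))^-1))).
  by eexists; exact: h.
by apply/funext => x; rewrite /curvature_torsion -exprVn /enorm !exprS expr0 mulr1.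
Qed.

(** [M] bounds the derivative of the torsion ratio of this curve, so [gfun_le] applies with
    [r = eps * M], uniformly in the point. *)
Lemma sadowsky_eps_smooth A B km p v : 0 < km -> 4 <= p -> Yspace_curv A B km v ->
  exists M : R, 0 <= M /\ forall eps, 0 < eps -> eps * M < 2 ->
    (sadowsky_eps eps v <= (2 / (2 - eps * M))%:E * sadowsky v)%E.
Proof.
move=> km0 p4 Yv; have sv : smooth01 v by case: Yv => -[].
have p1 : 1 < p by apply: lt_le_trans p4; rewrite ltr1n.
have Xv : Xspace A B km p v by exact: Yspace_X.
have Wv : W3p p v by case: Xv.
have [e' he] := smooth_torsion_C1b km0 Yv.
set e := (X in C1b X _) in he.
have [_ _ [M hM]] := he.
have half : I (2^-1 : R) by apply/unit_itvP; rewrite invr_gt0 ltr0n/= invf_lt1// ltr1n.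
have M0 : 0 <= M by apply: le_trans (hM _ half).1.
have meta : measurable_fun I (eta v).
  by apply: measurable_torsion => i; apply: W3p_measurable (ltW p1) Wv _.
have etae : {ae mu, forall x, I x -> e x = eta v x}.
  apply: (aeS (aeI (smooth01_wD 1 sv) (aeI (smooth01_wD 2 sv) (smooth01_wD 3 sv)))).
  by move=> x [h1 [h2 h3]] Ix; rewrite /e -h1// -h2// -h3.
have one1 : (1 : R) <= 1 by [].
have Leta : LpI 1 (eta v) by exact: LpI_ae_eq one1 (C1b_LpI one1 he) meta etae.
have leta : locally_integrable I (eta v) by exact: LpI_locally_integrable one1 Leta.
have w0 : is_weak_derivative 0 (eta v) (eta v) by exact: is_weak_derivative0.
(* [eta v] is built from chosen representatives and agrees with the classical ratio [e] only a.e.,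
   which leaves the integrals against test functions unchanged. *)
have w1 : is_weak_derivative 1 (eta v) e'.
  split => //; first exact: C1b_locally_integrable' he.
  have [_ _ h1] := is_weak_derivativeS (is_weak_derivative0 (C1b_locally_integrable he)) he.
  move=> phi tphi; rewrite -h1//; congr fine; apply: ae_eq_integral.
  - exact: measurable_unit_itv.
  - apply: measurable_funE; apply: measurable_funM => //.
    exact: measurable_funTS (test_function_measurable (test_function_derive1n 1 tphi)).
  - apply: measurable_funE; apply: measurable_funM; first exact: C1b_measurable he.
    exact: measurable_funTS (test_function_measurable (test_function_derive1n 1 tphi)).
  - by apply: (aeS etae) => x h Ix; rewrite h.
have Sob : sobolev 1 1 (eta v).
  split => // -[|[|//]] _; first by exists (eta v).
  by exists e'; split => //; exact: C1b_LpI' one1 he.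
exists M; split => // eps eps0 epsM.
rewrite /sadowsky_eps asboolT//.
have mw : measurable_fun I (wderiv 1 (eta v)) by have [_ []] := wderivP w1.
have md := measurable_wdensity (ltW p1) Wv.
have c0 : 0 <= 2 / (2 - eps * M) by rewrite divr_ge0// subr_ge0 ltW.
rewrite sadowskyE -ge0_integralZl//=; first last.
- by move=> x _; rewrite lee_fin wdensity_ge0.
- exact: measurable_funE.
- exact: measurable_unit_itv.
apply: ae_ge0_le_integral.
- exact: measurable_unit_itv.
- move=> x _; apply: mule_ge0; first by rewrite lee_fin wdensity_ge0.
  exact: le_trans (gfun_ge1 _).
- apply: emeasurable_funM; first exact: measurable_funE.
  apply: (measurableT_comp (@measurable_gfun R)).
  by apply: measurable_funM.
- by move=> x _; apply: mule_ge0; rewrite lee_fin// wdensity_ge0.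
- by apply: emeasurable_funM => //; exact: measurable_funE.
apply: (aeS (wderiv_ae w1)) => x h Ix; rewrite muleC; apply: lee_wpmul2r.
  by rewrite lee_fin wdensity_ge0.
apply: gfun_le => //; rewrite h// normrM gtr0_norm// ler_pM2l//.
by case: (hM x Ix).
Qed.

Lemma sadowsky_le_eps A B km p eps u : 4 <= p -> Xspace A B km p u ->
  (sadowsky u <= sadowsky_eps eps u)%E.
Proof.
move=> p4 [Wu _]; rewrite /sadowsky_eps; case: asboolP => [Sob|_]; last exact: leey.
have p1 : 1 <= p by apply: le_trans p4; rewrite ler1n.
have md := measurable_wdensity p1 Wu.
have [_ /(_ 1%N isT)[g [wg _]]] := Sob.
have mw : measurable_fun I (wderiv 1 (eta u)) by have [_ []] := wderivP wg.
rewrite sadowskyE; apply: ge0_le_integral.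
- exact: measurable_unit_itv.
- by move=> x _; rewrite lee_fin wdensity_ge0.
- exact: measurable_funE.
- apply: emeasurable_funM; first exact: measurable_funE.
  apply: (measurableT_comp (@measurable_gfun R)).
  by apply: measurable_funM.
- move=> x _; rewrite -[leLHS]mule1; apply: lee_wpmul2l; last exact: gfun_ge1.
  by rewrite lee_fin wdensity_ge0.
Qed.

(* A diagonal choice: [k j] is the largest [k <= j] for which [eps j] is small
   relative to the constant of the [k]-th approximating curve. *)
Lemma diagonal_index (eps M : nat -> R) : (forall j, 0 < eps j) -> eps @ \oo --> (0 : R) ->
  exists k : nat -> nat, (forall K, \forall j \near \oo, (K <= k j)%N) /\
    (\forall j \near \oo, eps j * M (k j) <= (k j).+1%:R^-1).
Proof.
move=> eps0 epsc.
pose P j k := eps j * M k <= k.+1%:R^-1.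
pose k j := \max_(i < j.+1 | P j i) i.
have near_P K : \forall j \near \oo, P j K.
  have c : (fun j => eps j * M K) @ \oo --> (0 : R).
    by rewrite -[X in _ --> X](mul0r (M K)); apply: cvgM => //; exact: cvg_cst.
  have e0 : 0 < (K.+1%:R^-1 : R) by rewrite invr_gt0 ltr0n.
  move/cvgrPdist_le: c => /(_ _ e0); apply: filterS => j; rewrite sub0r normrN.
  exact: le_trans (ler_norm _).
exists k; split.
- move=> K; near=> j.
  have Kj : (K < j.+1)%N by rewrite ltnS; near: j; exact: nbhs_infty_ge.
  have PK : P j K by near: j; exact: near_P.
  exact: (@leq_bigmax_cond _ (fun i : 'I_j.+1 => P j i) (fun i => i : nat) (Ordinal Kj) PK).
- near=> j.
  have P0 : P j 0%N by near: j; exact: near_P.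
  have : (0 < #|[pred i : 'I_j.+1 | P j i]|)%N by apply/card_gt0P; exists ord0; rewrite inE.
  by move=> /(eq_bigmax_cond (fun i : 'I_j.+1 => i : nat))[i Pi]; rewrite /k => ->; move: Pi; rewrite inE.
Unshelve. all: by end_near. Qed.

Lemma recovery_sequence A B km p (eps : nat -> R) u : 0 < km -> 4 <= p ->
  (forall j, 0 < eps j) -> eps @ \oo --> (0 : R) -> Xspace A B km p u ->
  exists us : nat -> curve R, [/\ forall j, Xspace A B km p (us j), weak_cvg p us u &
    (limn_esup (fun j => sadowsky_eps (eps j) (us j)) <= sadowsky u)%E].
Proof.
move=> km0 p4 eps0 epsc Xu; have [v [Yv vu c]] := Xspace_recovery km0 p4 Xu.
have p1 : 1 < p by apply: lt_le_trans p4; rewrite ltr1n.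
have Xv k : Xspace A B km p (v k) by exact: Yspace_X.
have /choice[M hM] := fun k => sadowsky_eps_smooth km0 p4 (Yv k).
have [k [kinf kM]] := diagonal_index M eps0 epsc.
have kc : k @ \oo --> \oo by move=> S [N _ hN]; apply: filterS (kinf N) => j; exact: hN.
exists (fun j => v (k j)); split.
- by move=> j; exact: Xv.
- apply: (@strong_weak_cvg _ p u _ (fun j => (2 ^ (k j + 3))%:R^-1)).
  + exact: p1.
  + by case: Xu.
  + by move=> j; case: (Xv (k j)).
  + by move=> j; exact: ltW (vu (k j)).
  + exact: (cvg_comp _ (fun k => (2 ^ (k + 3))%:R^-1 : R) kc (@cvg_pow2_inv R)).
(* By the choice of [k], eventually [eps j * M (k j) <= 1 / (k j + 1)]; the penalization factor is
   then bounded by one that tends to 1. The limit of the product is legitimate because [sadowsky u]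
   is finite. *)
have cb : (fun j => (2 / (2 - (k j).+1%:R^-1))%:E * sadowsky (v (k j)))%E @ \oo --> sadowsky u.
  rewrite -[X in _ --> X]mul1e; apply: cvgeM.
  - by rewrite (sadowskyR km0 p4 Xu).
  - have -> : (1 = (2 / (2 - 0))%:E :> \bar R)%E by rewrite subr0 divff.
    apply: cvg_EFin; first by near=> j.
    apply: cvgM; first exact: cvg_cst.
    apply: cvgV; first by rewrite subr0.
    apply: cvgB; first exact: cvg_cst.
    exact: (cvg_comp _ (fun k => k.+1%:R^-1 : R) kc (@cvg_harmonic R)).
  - exact: (cvg_comp _ (fun k => sadowsky (v k)) kc c).
rewrite -(cvg_limn_einf_sup cb).2; apply: le_limn_esup; near=> j => /=.
have kMj : eps j * M (k j) <= (k j).+1%:R^-1 by near: j.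
have l1 : (k j).+1%:R^-1 <= (1 : R) by rewrite invf_le1 ?ltr0n// ler1n.
have [M0 h] := hM (k j).
have lt2 : eps j * M (k j) < 2 by apply: (le_lt_trans kMj); apply: (le_lt_trans l1); rewrite ltr1n.
apply: (le_trans (h _ (eps0 j) lt2)); apply: lee_wpmul2r.
  by rewrite sadowskyE; apply: integral_ge0 => x _; rewrite lee_fin wdensity_ge0.
rewrite lee_fin ler_pM2l// lef_pV2 ?posrE ?subr_gt0//; first by rewrite lerD2l lerN2.
by apply: (le_lt_trans l1); rewrite ltr1n.
Unshelve. all: by end_near. Qed.

End RecoverySequence.

(** * The derivative of the unit normal and supporting hyperplanes *)

Section NormalRate.
Context {R : realType}.
Implicit Types (a b t : 'rV[R]_3) (km c : R).

(* The derivative of the unit normal [a / |a|] along the curve. *)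
Definition normal_rate t a b : 'rV[R]_3 :=
  \row_i (curvature_torsion t a b * crossp t a 0 i - enorm a * t 0 i).

Lemma frenet_gt0 km t a b : 0 < km -> frenet km t a b -> 0 < enorm a.
Proof. by move=> km0 [_ _ _]; apply: lt_le_trans. Qed.

(** The two terms of [normal_rate] are orthogonal, and [t x a] has length [|a|] by Lagrange's
    identity, as [t] is a unit vector orthogonal to [a]. *)
Lemma dotp_normal_rate km t a b : frenet km t a b ->
  dotp (normal_rate t a b) (normal_rate t a b) =
  enorm a ^+ 2 * (1 + curvature_torsion t a b ^+ 2).
Proof.
move=> [tt ta _ _]; set e := curvature_torsion t a b; set k := enorm a.
have -> : dotp (normal_rate t a b) (normal_rate t a b) =
    e ^+ 2 * dotp (crossp t a) (crossp t a) + k ^+ 2 * dotp t t -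
    2 * e * k * dotp t (crossp t a).
  have qE i : normal_rate t a b 0 i = e * crossp t a 0 i - k * t 0 i by rewrite mxE.
  by rewrite [in LHS]dotpE !qE !dotpE; ring.
have -> : dotp t (crossp t a) = 0 by rewrite dotpE crosspE0 crosspE1 crosspE2; ring.
have := dotp_lagrange t a; rewrite ta tt mul1r expr0n add0r => ->.
by rewrite /k sqr_enorm; ring.
Qed.

(** Expansion of [b] along [t], [a] and [t x a], multiplied by the Gram determinant of [t] and [a].
    In this form it is a polynomial identity valid for all vectors. *)
Lemma gram_expansion t a b i :
  (dotp t t * dotp a a - dotp t a ^+ 2) * b 0 i - dotp b (crossp t a) * crossp t a 0 i =
  (dotp a a * dotp t b - dotp t a * dotp a b) * t 0 i +
  (dotp t t * dotp a b - dotp t a * dotp t b) * a 0 i.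
Proof.
rewrite !dotpE; elim/ord3P: i; rewrite ?crosspE0 ?crosspE1 ?crosspE2; ring.
Qed.

(** The left side is the derivative of [a / |a|] when [b = a']. Under the Frenet relations [b] has
    component [-|a|^2] along [t], and its component along [a] cancels, since a unit vector has no
    velocity along itself. *)
Lemma normal_rateE km t a b i : 0 < km -> frenet km t a b ->
  b 0 i * (enorm a)^-1 - a 0 i * dotp a b * (enorm a)^-1 ^+ 3 = normal_rate t a b 0 i.
Proof.
move=> km0 fr; have k0 := frenet_gt0 km0 fr; case: fr => tt ta tb _.
have := gram_expansion t a b i.
rewrite tt ta mul1r expr0n subr0 mul0r subr0 mul1r mul0r subr0 => h.
have tr : dotp b (crossp t a) = dotp t (crossp a b).
  by rewrite !dotpE !crosspE0 !crosspE1 !crosspE2; ring.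
have tb' : dotp t b = - dotp a a by apply/eqP; rewrite -addr_eq0 addrC tb.
rewrite mxE /curvature_torsion; rewrite -sqr_enorm in h tb'.
rewrite tr tb' in h.
move: h k0; set k := enorm a; set D := dotp t (crossp a b); set d := dotp a b.
move=> h k0; have kn : k != 0 by rewrite gt_eqF.
have hb : b 0 i = (D * crossp t a 0 i + (k ^+ 2 * - k ^+ 2) * t 0 i + d * a 0 i) / k ^+ 2.
  apply: (mulfI (_ : k ^+ 2 != 0)); first by rewrite expf_neq0.
  rewrite [RHS]mulrC divfK ?expf_neq0//.
  by move/eqP: h; rewrite subr_eq => /eqP ->; ring.
by rewrite hb; field.
Qed.

Lemma sadowsky_density_ge_sqr t a b : enorm a ^+ 2 <= sadowsky_density t a b.
Proof.
rewrite /sadowsky_density ler_peMr ?sqr_ge0//.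
by rewrite -[leLHS](expr1n _ 2%N); apply: lerXn2r; rewrite ?nnegrE ?addr_ge0 ?sqr_ge0// lerDl sqr_ge0.
Qed.

Lemma normal_rate_sqr_le km t a b : frenet km t a b ->
  dotp (normal_rate t a b) (normal_rate t a b) <= sadowsky_density t a b.
Proof.
move=> fr; rewrite (dotp_normal_rate fr) /sadowsky_density ler_wpM2l ?sqr_ge0//.
have : 1 <= 1 + curvature_torsion t a b ^+ 2 by rewrite lerDl sqr_ge0.
by move=> h; rewrite expr2 ler_peMr// (le_trans _ h).
Qed.

Lemma normal_rate_coord_le km t a b i : frenet km t a b ->
  `|normal_rate t a b 0 i| <= 1 + sadowsky_density t a b.
Proof.
move=> fr; apply: le_trans (le_add1_sqr _) _; rewrite lerD2l.
apply: le_trans (normal_rate_sqr_le fr).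
rewrite -sqr_enorm; apply: lerXn2r; rewrite ?nnegrE ?enorm_ge0//; exact: coord_le_enorm.
Qed.

(* With [s = |q|^2 / |a|], so that the density is [s^2]:
   [s^2 >= 2 c s - c^2] and [s >= 2 w.q - |w|^2 |a|]. *)
Lemma sadowsky_density_lower km t a b c (w : 'rV[R]_3) : 0 < km -> frenet km t a b -> 0 <= c ->
  4 * c * dotp w (normal_rate t a b) - 2 * c * dotp w w * enorm a - c ^+ 2 <=
  sadowsky_density t a b.
Proof.
move=> km0 fr c0; have k0 := frenet_gt0 km0 fr.
have Q := dotp_normal_rate fr.
set q := normal_rate t a b in Q *; set k := enorm a in k0 Q *.
set e := curvature_torsion t a b in Q *.
rewrite /sadowsky_density -/k -/e.
have h1 : 0 <= dotp (q - k *: w) (q - k *: w) by exact: dotp_ge0.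
have e1 : dotp (q - k *: w) (q - k *: w) = dotp q q - 2 * k * dotp w q + k ^+ 2 * dotp w w.
  by rewrite !dotpE !mxE; ring.
rewrite e1 Q in h1.
pose s := k * (1 + e ^+ 2).
have hs : 2 * dotp w q - dotp w w * k <= s.
  rewrite -(ler_pM2l k0) -subr_ge0; apply: le_trans h1 _.
  by rewrite /s le_eqVlt; apply/orP; left; apply/eqP; ring.
apply: (@le_trans _ _ (2 * c * s - c ^+ 2)).
  rewrite lerD2r (_ : _ - _ = 2 * c * (2 * dotp w q - dotp w w * k)); last by ring.
  by rewrite ler_wpM2l// mulr_ge0.
rewrite -subr_ge0 (_ : _ - _ = (s - c) ^+ 2) ?sqr_ge0//; rewrite /s; ring.
Qed.

(** These [c] and [w] give equality in both inequalities behind [sadowsky_density_lower], namely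
    [s = c] and [q = k w]: the supporting hyperplane touches the density here. *)
Lemma sadowsky_density_tangent km t a b : 0 < km -> frenet km t a b ->
  let k := enorm a in let q := normal_rate t a b in
  let c := dotp q q / k in let w := k^-1 *: q in
  4 * c * dotp w q - 2 * c * dotp w w * k - c ^+ 2 = sadowsky_density t a b.
Proof.
move=> km0 fr k q c w; have k0 : 0 < k := frenet_gt0 km0 fr.
have kn : k != 0 by rewrite gt_eqF.
have e1 : dotp w q = dotp q q / k by rewrite /w !dotpE !mxE; ring.
have e2 : dotp w w = dotp q q / k ^+ 2 by rewrite /w !dotpE !mxE expr2 invfM; ring.
rewrite e1 e2 /c [dotp q q](dotp_normal_rate fr) /sadowsky_density -/k.
by field.
Qed.

End NormalRate.

(** * Point evaluation of the second derivative *)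

Section PointValues.
Context {R : realType}.
Local Notation mu := (@lebesgue_measure R).
Local Notation I := (unit_itv R).
Local Notation coord := Defs.coord.
Implicit Types (f g h : R -> R) (u v w : curve R) (p km x : R).

(* An average that returns [f x] when [h2 = f] and [h3 = f'], because
   [((t - x/2) f)' = f + (t - x/2) f']; it makes the continuous representative of
   [u''] at every point a bounded linear functional of [u]. *)
Definition point_value h2 h3 x : R :=
  2 / x * \int[mu]_(t in `]x / 2, x[) (h2 t + (t - x / 2) * h3 t).

Lemma Rintegral_lin (D : set R) c f g : measurable D -> mu.-integrable D (EFin \o f) ->
  mu.-integrable D (EFin \o g) ->
  \int[mu]_(t in D) (c * f t + g t) = c * \int[mu]_(t in D) f t + \int[mu]_(t in D) g t.
Proof.
move=> mD jf jg; rewrite -RintegralZl//; apply: RintegralD => //.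
by have := @integrableZl _ _ _ mu D mD c _ jf.
Qed.

Lemma half_itv_sub x : I x -> `]x / 2, x[%classic `<=` I.
Proof.
move=> /unit_itvP/andP[x0 x1] t; rewrite /unit_itv /= !in_itv /= => /andP[xt tx].
by apply/andP; split; [apply: lt_trans xt; rewrite divr_gt0|apply: lt_trans x1].
Qed.

Lemma point_value_C1b f g x : C1b f g -> I x -> point_value f g x = f x.
Proof.
move=> h Ix; have /andP[x0 x1] : 0 < x < 1 by apply/unit_itvP.
have ha : C1b (fun t : R => - (x / 2) + 1 * t) (fun=> 1).
  split; first by move=> t _; exact: is_derive1_affine.
    by move=> t _; exact: cvg_cst.
  exists 2 => t /unit_itvP/andP[t0 t1]; rewrite normr1 ler1n; split => //.
  rewrite ler_norml; apply/andP; split; lra.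
have hm := C1bM ha h.
have e : \int[mu]_(t in `]x / 2, x[) (f t + (t - x / 2) * g t) =
    \int[mu]_(t in `]x / 2, x[) (1 * f t + (- (x / 2) + 1 * t) * g t).
  by apply: eq_Rintegral => t _; ring.
rewrite /point_value e (C1b_FTC hm) ?divr_gt0//; last lra.
by field; rewrite gt_eqF.
Qed.

Lemma point_value_integrable h2 h3 x : I x -> mu.-integrable I (EFin \o h2) ->
  mu.-integrable I (EFin \o h3) ->
  mu.-integrable I (EFin \o (fun t => h2 t + (t - x / 2) * h3 t)) /\
  mu.-integrable `]x / 2, x[ (EFin \o (fun t => h2 t + (t - x / 2) * h3 t)).
Proof.
move=> Ix i2 i3; have /andP[x0 x1] : 0 < x < 1 by apply/unit_itvP.
have h : mu.-integrable I (EFin \o (fun t => h2 t + (t - x / 2) * h3 t)).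
  apply: integrable01D => //; apply: (@integrable_le _ _ _ (fun t => `|h3 t|)).
  - exact: measurable_unit_itv.
  - apply: measurable_funM; first by apply: measurable_funB.
    by apply/measurable_EFinP; exact: measurable_int i3.
  - by apply: integrable_normr => //; exact: measurable_unit_itv.
  - move=> t /unit_itvP/andP[t0 t1]; rewrite normrM ler_piMl//.
    by rewrite ler_norml; apply/andP; split; lra.
split => //; apply: (integrable_sub _ _ (half_itv_sub Ix) h) => //.
exact: measurable_unit_itv.
Qed.

Lemma point_value_ae h2 h3 h2' h3' x : I x -> mu.-integrable I (EFin \o h2) ->
  mu.-integrable I (EFin \o h3) -> mu.-integrable I (EFin \o h2') ->
  mu.-integrable I (EFin \o h3') ->
  {ae mu, forall t, I t -> h2 t = h2' t} -> {ae mu, forall t, I t -> h3 t = h3' t} ->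
  point_value h2 h3 x = point_value h2' h3' x.
Proof.
move=> Ix i2 i3 i2' i3' e2 e3; rewrite /point_value; congr (_ * fine _).
have [_ j] := point_value_integrable Ix i2 i3.
have [_ j'] := point_value_integrable Ix i2' i3'.
apply: ae_eq_integral => //.
- exact: measurable_int j.
- exact: measurable_int j'.
- apply: (aeS (aeI e2 e3)) => t [h h'] Jt; have It := half_itv_sub Ix Jt.
  by rewrite h// h'.
Qed.

Lemma point_value_lin (c : R) h2 h3 h2' h3' x : I x -> mu.-integrable I (EFin \o h2) ->
  mu.-integrable I (EFin \o h3) -> mu.-integrable I (EFin \o h2') ->
  mu.-integrable I (EFin \o h3') ->
  point_value (fun t => c * h2 t + h2' t) (fun t => c * h3 t + h3' t) x =
  c * point_value h2 h3 x + point_value h2' h3' x.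
Proof.
move=> Ix i2 i3 i2' i3'; rewrite /point_value.
have [_ j] := point_value_integrable Ix i2 i3.
have [_ j'] := point_value_integrable Ix i2' i3'.
have -> : \int[mu]_(t in `]x / 2, x[) (c * h2 t + h2' t + (t - x / 2) * (c * h3 t + h3' t)) =
    \int[mu]_(t in `]x / 2, x[) (c * (h2 t + (t - x / 2) * h3 t) + (h2' t + (t - x / 2) * h3' t)).
  by apply: eq_Rintegral => t _; ring.
have -> : \int[mu]_(t in `]x / 2, x[) (c * (h2 t + (t - x / 2) * h3 t) + (h2' t + (t - x / 2) * h3' t)) =
    c * \int[mu]_(t in `]x / 2, x[) (h2 t + (t - x / 2) * h3 t) +
    \int[mu]_(t in `]x / 2, x[) (h2' t + (t - x / 2) * h3' t).
  exact: Rintegral_lin.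
by ring.
Qed.

(** The weight [t - x / 2] is at most 1 in size, so the prefactor [2 / x] multiplies two integrals,
    each at most [N]. The constant may depend on [x], which is fixed in each functional. *)
Lemma point_value_le h2 h3 x (N : \bar R) : I x -> mu.-integrable I (EFin \o h2) ->
  mu.-integrable I (EFin \o h3) ->
  (\int[mu]_(t in I) `|h2 t|%:E <= N)%E -> (\int[mu]_(t in I) `|h3 t|%:E <= N)%E ->
  (`|point_value h2 h3 x|%:E <= (4 / x)%:E * N)%E.
Proof.
move=> Ix i2 i3 l2 l3; have /andP[x0 x1] : 0 < x < 1 by apply/unit_itvP.
have [jI j] := point_value_integrable Ix i2 i3.
have m2 : measurable_fun I h2 by apply/measurable_EFinP; exact: measurable_int i2.
have m3 : measurable_fun I h3 by apply/measurable_EFinP; exact: measurable_int i3.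
have mj : measurable_fun I (fun t => h2 t + (t - x / 2) * h3 t).
  by apply/measurable_EFinP; exact: measurable_int jI.
rewrite /point_value normrM gtr0_norm ?divr_gt0// EFinM.
have -> : 4 / x = 2 / x * 2 by field; rewrite gt_eqF.
rewrite [X in (_ <= X * _)%E]EFinM -muleA; apply: lee_wpmul2l; first by rewrite lee_fin divr_ge0// ltW.
rewrite EFin_normr_Rintegral//; apply: le_trans (le_abse_integral _ _ _) _ => //.
  exact: measurable_int j.
apply: (@le_trans _ _ (\int[mu]_(t in I) (`|h2 t|%:E + `|h3 t|%:E))%E).
  apply: (@le_trans _ _ (\int[mu]_(t in I) `|(h2 t + (t - x / 2) * h3 t)%:E|)%E).
    apply: ge0_subset_integral => //.
    - exact: measurable_unit_itv.
    - by apply: measurableT_comp => //; exact: measurable_funE.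
    - exact: half_itv_sub.
  apply: ge0_le_integral.
  - exact: measurable_unit_itv.
  - by move=> t _.
  - by apply: measurableT_comp => //; exact: measurable_funE.
  - by apply: emeasurable_funD; apply: measurable_funE; exact: measurable_fun_normr.
  - move=> t /unit_itvP/andP[t0 t1]; rewrite -EFinD abse_EFin lee_fin.
    apply: le_trans (ler_normD _ _) _; rewrite lerD2l normrM ler_piMl//.
    by rewrite ler_norml; apply/andP; split; lra.
rewrite ge0_integralD//.
- have -> : (2%:E * N = N + N)%E.
    by rewrite -[2](_ : 1 + 1 = _)// EFinD ge0_muleDl// mul1e.
  exact: leeD.
- exact: measurable_unit_itv.
- by apply: measurable_funE; exact: measurable_fun_normr.
- by apply: measurable_funE; exact: measurable_fun_normr.
Qed.

Definition second_value u i x := point_value (coord (wD 2 u) i) (coord (wD 3 u) i) x.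

Lemma W3p_integrable p u j i : 1 <= p -> W3p p u -> (j <= 3)%N ->
  mu.-integrable I (EFin \o coord (wD j u) i).
Proof.
move=> p1 Wu j3; rewrite coord_wD; have [_ L] := W3p_wderiv i p1 Wu j3.
exact: LpI_integrable L.
Qed.

(** The derivatives entering the integral are linear in [u] only almost everywhere, but the integral
    does not see null sets, so the functional is exactly linear, as [W3p_dual] demands. *)
Lemma second_value_dual p i x : 1 < p -> I x -> W3p_dual p (fun u => second_value u i x).
Proof.
move=> p1 Ix; have p1' := ltW p1; split.
  move=> c u v Wu Wv; have [Wc h] := W3p_lin c p1' Wu Wv.
  have i2 w : W3p p w -> mu.-integrable I (EFin \o coord (wD 2 w) i).
    by move=> Ww; exact: (W3p_integrable i p1' Ww).
  have i3 w : W3p p w -> mu.-integrable I (EFin \o coord (wD 3 w) i).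
    by move=> Ww; exact: (W3p_integrable i p1' Ww).
  rewrite /second_value -(point_value_lin c Ix (i2 _ Wu) (i3 _ Wu) (i2 _ Wv) (i3 _ Wv)).
  apply: (point_value_ae Ix (i2 _ Wc) (i3 _ Wc)).
  - by apply: integrable01D; [apply: integrable01Z|]; exact: i2.
  - by apply: integrable01D; [apply: integrable01Z|]; exact: i3.
  - by apply: (aeS (h 2%N isT)) => t ht It; rewrite /Defs.coord ht// !mxE.
  - by apply: (aeS (h 3%N isT)) => t ht It; rewrite /Defs.coord ht// !mxE.
exists (4 / x) => u Wu; apply: (point_value_le Ix).
- exact: (W3p_integrable i p1' Wu).
- exact: (W3p_integrable i p1' Wu).
- exact: integral_wD_le.
- exact: integral_wD_le.
Qed.

Lemma second_value_smooth p v i x : 1 <= p -> smooth01 v -> I x ->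
  second_value v i x = coord (iter 2 deriv01 v) i x.
Proof.
move=> p1 sv Ix; rewrite -(point_value_C1b (smooth01_C1b 2 i sv) Ix).
have Wv := smooth01_W3p p1 sv.
apply: point_value_ae => //; try exact: W3p_integrable Wv _.
- exact: C1b_integrable (smooth01_C1b 2 i sv).
- exact: C1b_integrable (smooth01_C1b 3 i sv).
- by apply: (aeS (smooth01_wD 2 sv)) => t ht It; rewrite /Defs.coord ht.
- by apply: (aeS (smooth01_wD 3 sv)) => t ht It; rewrite /Defs.coord ht.
Qed.

End PointValues.

(** * The unit normal along curves of [X] *)

Section UnitNormal.
Context {R : realType}.
Local Notation mu := (@lebesgue_measure R).
Local Notation I := (unit_itv R).
Local Notation coord := Defs.coord.
Implicit Types (f g h : R -> R) (u v w : curve R) (p km x : R).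

(** Built on [second_value] rather than [wD 2]: increments of the normal call for values at
    prescribed points, where an a.e. representative says nothing. *)
Definition unit_normal u i x : R :=
  second_value u i x / enorm (\row_l second_value u l x).

Definition normal_velocity u i x : R :=
  normal_rate (wD 1 u x) (wD 2 u x) (wD 3 u x) 0 i.

(** Along a smooth approximation the second derivatives converge to [second_value] at every point,
    by duality, and to [wD 2] almost everywhere. The curvature bound thus survives at every point,
    which keeps [unit_normal] away from division by zero. *)
Lemma Xspace_second_value A B km p u : 4 <= p -> Xspace A B km p u ->
  {ae mu, forall x, I x -> forall i, second_value u i x = wD 2 u x 0 i} /\
  (forall x, I x -> km <= enorm (\row_l second_value u l x)).
Proof.
move=> p4 Xu; have [v [G [Yv vu iG h]]] := Xspace_approximation p4 Xu.
have p1 : 1 < p by apply: lt_le_trans p4; rewrite ltr1n.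
have p1' := ltW p1.
have sv k : smooth01 (v k) by case: (Yv k) => -[].
have c x i : I x -> coord (iter 2 deriv01 (v k)) i x @[k --> \oo] --> second_value u i x.
  move=> Ix; have wc : weak_cvg p v u.
    apply: (@strong_weak_cvg _ p u v (fun k => (2 ^ (k + 3))%:R^-1)) => //.
    - by case: Xu.
    - by move=> k; exact: smooth01_W3p.
    - by move=> k; exact: ltW.
    - exact: cvg_pow2_inv.
  have := wc _ (second_value_dual i p1 Ix).
  rewrite (_ : (fun k => second_value (v k) i x) = fun k => coord (iter 2 deriv01 (v k)) i x)//.
  by apply/funext => k; exact: second_value_smooth p1' (sv k) Ix.
split.
  apply: (aeS h) => x hx Ix i; have [d _ e] := hx Ix.
  have d2 := d 2%N i isT; have c2 := c x i Ix.
  have E : (fun k => coord (wD 2 (v k)) i x) = fun k => coord (iter 2 deriv01 (v k)) i x.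
    by apply/funext => k; rewrite /Defs.coord e.
  by rewrite E in d2; exact: (cvg_unique _ c2 d2).
move=> x Ix.
have ce : enorm (iter 2 deriv01 (v k) x) @[k --> \oo] --> enorm (\row_l second_value u l x).
  by apply: cvg_enorm => i; rewrite mxE; exact: c.
by apply: (cvgr_to_ge ce); near=> k; have [] := Yspace_frenet (Yv k) Ix.
Unshelve. all: by end_near. Qed.

Lemma unit_normal_weak_cvg A B km p (us : nat -> curve R) u i x : 0 < km -> 4 <= p ->
  Xspace A B km p u -> weak_cvg p us u -> I x ->
  unit_normal (us j) i x @[j --> \oo] --> unit_normal u i x.
Proof.
move=> km0 p4 Xu wc Ix.
have p1 : 1 < p by apply: lt_le_trans p4; rewrite ltr1n.
have c l : second_value (us j) l x @[j --> \oo] --> second_value u l x.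
  exact: wc (second_value_dual l p1 Ix).
have E w l : (\row_l second_value w l x) 0 l = second_value w l x by rewrite mxE.
have ce : enorm (\row_l second_value (us j) l x) @[j --> \oo] --> enorm (\row_l second_value u l x).
  apply: (@cvg_enorm _ (fun j => \row_l second_value (us j) l x)) => l; rewrite [X in _ --> X]E.
  rewrite (_ : (fun k => _) = fun k => second_value (us k) l x); first exact: c.
  by apply/funext => k; exact: E.
have e0 : enorm (\row_l second_value u l x) != 0.
  by rewrite gt_eqF// (lt_le_trans km0)//; exact: (Xspace_second_value p4 Xu).2.
exact: (cvgM (c i) (cvgV e0 ce)).
Qed.

Lemma kappa_weak_cvg A B km p (us : nat -> curve R) u : 4 <= p ->
  (forall j, Xspace A B km p (us j)) -> Xspace A B km p u -> weak_cvg p us u ->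
  {ae mu, forall x, I x -> kappa (us j) x @[j --> \oo] --> kappa u x}.
Proof.
move=> p4 Xus Xu wc; have p1 : 1 < p by apply: lt_le_trans p4; rewrite ltr1n.
have hj : {ae mu, forall x, forall j, I x -> forall i, second_value (us j) i x = wD 2 (us j) x 0 i}.
  by apply: ae_foralln => j; exact: (Xspace_second_value p4 (Xus j)).1.
apply: (aeS (aeI hj (Xspace_second_value p4 Xu).1)) => x [hx hx'] Ix.
apply: cvg_enorm => i; rewrite -hx'//.
rewrite (_ : (fun k => wD 2 (us k) x 0 i) = fun k => second_value (us k) i x); last first.
  by apply/funext => k; rewrite hx.
exact: wc (second_value_dual i p1 Ix).
Qed.

Lemma unit_normal_smooth A B km p v i x : 0 < km -> 1 <= p -> Yspace_curv A B km v -> I x ->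
  unit_normal v i x =
  coord (iter 2 deriv01 v) i x * (Num.sqrt (dotp (iter 2 deriv01 v x) (iter 2 deriv01 v x)))^-1.
Proof.
move=> km0 p1 Yv Ix; have sv : smooth01 v by case: Yv => -[].
rewrite /unit_normal (second_value_smooth i p1 sv Ix) /enorm.
have -> // : \row_l second_value v l x = iter 2 deriv01 v x.
by apply/rowP => l; rewrite mxE (second_value_smooth l p1 sv Ix).
Qed.

Lemma unit_normal_FTC_smooth A B km p v i (s t : R) : 0 < km -> 1 <= p -> Yspace_curv A B km v ->
  0 < s -> s < t -> t < 1 ->
  \int[mu]_(x in `]s, t[) normal_rate (iter 1 deriv01 v x) (iter 2 deriv01 v x)
    (iter 3 deriv01 v x) 0 i = unit_normal v i t - unit_normal v i s.
Proof.
move=> km0 p1 Yv s0 st t1; have sv : smooth01 v by case: Yv => -[].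
have c n : C1v (iter n deriv01 v) (iter n.+1 deriv01 v) by move=> l; exact: smooth01_C1b.
have hr := C1b_rsqrt (exprn_gt0 2 km0) (fun x Ix => dotp_ge_km km0 Yv Ix) (C1b_dotp (c 2%N) (c 2%N)).
have h := C1bM (c 2%N i) hr.
(* Matches the left side of [normal_rateE] with the derivative produced by [C1bM] and [C1b_rsqrt],
   where [|a|^2] has derivative [2 a.b]. *)
have E (a b : 'rV[R]_3) (r : R) : b 0 i * r - a 0 i * dotp a b * r ^+ 3 =
    b 0 i * r + a 0 i * (- 2^-1 * r ^+ 3 * (dotp b a + dotp a b)).
  by rewrite (dotpC b a); field.
have Is : I s by apply/unit_itvP; rewrite s0 (lt_trans st).
have It : I t by apply/unit_itvP; rewrite t1 (lt_trans s0).
rewrite (unit_normal_smooth i km0 p1 Yv It) (unit_normal_smooth i km0 p1 Yv Is).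
rewrite -(C1b_FTC h s0 st t1); apply: eq_Rintegral => x.
rewrite inE /= in_itv /= => /andP[sx xt].
have Ix : I x by apply/unit_itvP; rewrite (lt_trans s0 sx) (lt_trans xt t1).
rewrite -(normal_rateE i km0 (Yspace_frenet Yv Ix)) /enorm /Defs.coord.
exact: E.
Qed.

Lemma measurable_normal_rate (t a b : curve R) i : measurable_curve t -> measurable_curve a ->
  measurable_curve b -> measurable_fun I (fun x => normal_rate (t x) (a x) (b x) 0 i).
Proof.
move=> mt ma mb.
rewrite (_ : (fun x => _) = fun x =>
  curvature_torsion (t x) (a x) (b x) * crossp (t x) (a x) 0 i -
  enorm (a x) * t x 0 i); last by apply/funext => x; rewrite mxE.
apply: measurable_funB; apply: measurable_funM.
- exact: measurable_torsion.
- exact: measurable_crossp.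
- exact: measurable_enorm.
- exact: mt.
Qed.

Lemma measurable_normal_velocity p u i : 1 <= p -> W3p p u ->
  measurable_fun I (normal_velocity u i).
Proof.
move=> p1 Wu; have m j : (j <= 3)%N -> measurable_curve (wD j u).
  by move=> j3 l; exact: W3p_measurable Wu j3.
by apply: measurable_normal_rate; exact: m.
Qed.

(** The fundamental theorem of calculus for smooth curves passes to the limit: the integrals by
    dominated convergence, the increments by convergence of the normals at both endpoints. *)
Lemma Xspace_normal_velocity A B km p u i : 0 < km -> 4 <= p -> Xspace A B km p u ->
  mu.-integrable I (EFin \o normal_velocity u i) /\
  (forall s t : R, 0 < s -> s < t -> t < 1 ->
   \int[mu]_(x in `]s, t[) normal_velocity u i x = unit_normal u i t - unit_normal u i s).
Proof.
move=> km0 p4 Xu; have [v [G [Yv vu iG h]]] := Xspace_approximation p4 Xu.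
have p1 : 1 < p by apply: lt_le_trans p4; rewrite ltr1n.
have p1' := ltW p1; have Wu : W3p p u by case: Xu.
have sv k : smooth01 (v k) by case: (Yv k) => -[].
have Wv k : W3p p (v k) by exact: smooth01_W3p.
(* A coordinate of [q] is at most [1 + |q|^2], hence at most 1 plus the density, for which the
   quartic majorant is available. *)
pose H x := 1 + (2 * (1 + 9 * G x) + 2 * (9 * G x) / km ^+ 6).
have iH : mu.-integrable I (EFin \o H).
  apply: integrable01D; first exact: integrable_cst_unit_itv.
  apply: integrable01D.
    apply: integrable01Z; apply: integrable01D; first exact: integrable_cst_unit_itv.
    exact: integrable01Z.
  under eq_fun do rewrite mulrC mulrA.
  exact: (integrable01Z _ (integrable01Z (2 * 9) iG)).
have cv : {ae mu, forall x, I x -> normal_velocity (v k) i x @[k --> \oo] --> normal_velocity u i x}.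
  apply: (aeS h) => x hx Ix; have [c _ _] := hx Ix.
  have [_ _ _ ka] := approximates_frenet Yv Ix (hx Ix).
  have c1 l : wD 1 (v k) x 0 l @[k --> \oo] --> wD 1 u x 0 l by exact: (c 1%N l).
  have c2 l : wD 2 (v k) x 0 l @[k --> \oo] --> wD 2 u x 0 l by exact: (c 2%N l).
  have c3 l : wD 3 (v k) x 0 l @[k --> \oo] --> wD 3 u x 0 l by exact: (c 3%N l).
  have E w : normal_velocity w i x = curvature_torsion (wD 1 w x) (wD 2 w x) (wD 3 w x) *
      crossp (wD 1 w x) (wD 2 w x) 0 i - enorm (wD 2 w x) * wD 1 w x 0 i.
    by rewrite /normal_velocity /normal_rate; exact: mxE.
  rewrite [X in _ --> X]E (_ : (fun k => _) = fun k => curvature_torsion (wD 1 (v k) x) (wD 2 (v k) x)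
      (wD 3 (v k) x) * crossp (wD 1 (v k) x) (wD 2 (v k) x) 0 i -
      enorm (wD 2 (v k) x) * wD 1 (v k) x 0 i); last by apply/funext => k; exact: E.
  apply: cvgB; apply: cvgM.
  - by apply: cvg_torsion => //; rewrite gt_eqF// (lt_le_trans km0).
  - exact: (cvg_crossp c1 c2).
  - exact: cvg_enorm.
  - exact: c1.
have bd : {ae mu, forall x, I x -> forall k, `|normal_velocity (v k) i x| <= H x}.
  apply: (aeS h) => x hx Ix k; have [_ b e] := hx Ix.
  have fr : frenet km (wD 1 (v k) x) (wD 2 (v k) x) (wD 3 (v k) x).
    by rewrite !e; exact: Yspace_frenet (Yv k) _ Ix.
  apply: le_trans (normal_rate_coord_le i fr) _; rewrite lerD2l.
  apply: sadowsky_density_le => // l; first exact: (b k 2%N l).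
  exact: (b k 3%N l).
have mv k : measurable_fun I (normal_velocity (v k) i) by exact: measurable_normal_velocity (Wv k).
have mU := measurable_normal_velocity i p1' Wu.
split.
  by have [] := Rdominated_convergence (@measurable_unit_itv R) mv mU cv iH bd.
move=> s t s0 st t1; have JI : `]s, t[%classic `<=` I.
  move=> x; rewrite /= in_itv /= => /andP[sx xt].
  by apply/unit_itvP; rewrite (lt_trans s0 sx) (lt_trans xt t1).
have mJ : measurable (`]s, t[%classic : set R) by exact: measurable_itv.
have [_ c] : mu.-integrable `]s, t[ (EFin \o normal_velocity u i) /\
    \int[mu]_(x in `]s, t[) normal_velocity (v k) i x @[k --> \oo] -->
    \int[mu]_(x in `]s, t[) normal_velocity u i x.
  apply: (@Rdominated_convergence _ _ _ _ H) => //.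
  - by move=> k; exact: (measurable_fun_sub (@measurable_unit_itv R) JI (mv k)).
  - exact: (measurable_fun_sub (@measurable_unit_itv R) JI mU).
  - by apply: (aeS cv) => x hx /JI.
  - exact: (integrable_sub (@measurable_unit_itv R) mJ JI iH).
  - by apply: (aeS bd) => x hx /JI.
have Is : I s by apply/unit_itvP; rewrite s0 (lt_trans st).
have It : I t by apply/unit_itvP; rewrite t1 (lt_trans s0).
have wc : weak_cvg p v u.
  apply: (@strong_weak_cvg _ p u v (fun k => (2 ^ (k + 3))%:R^-1)) => //.
  - by move=> k; exact: ltW.
  - exact: cvg_pow2_inv.
have E k : \int[mu]_(x in `]s, t[) normal_velocity (v k) i x =
    unit_normal (v k) i t - unit_normal (v k) i s.
  rewrite -(unit_normal_FTC_smooth i km0 p1' (Yv k) s0 st t1); congr fine.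
  apply: ae_eq_integral => //.
  - by apply: measurable_funE; exact: (measurable_fun_sub (@measurable_unit_itv R) JI (mv k)).
  - apply: measurable_funE; apply: (measurable_fun_sub (@measurable_unit_itv R) JI).
    by apply: measurable_normal_rate => l; exact: C1b_measurable (smooth01_C1b _ l (sv k)).
  - by apply: (aeS h) => x hx /JI Ix; have [_ _ e] := hx Ix; rewrite /normal_velocity !e.
rewrite (eq_cvg _ _ E) in c.
have c' : unit_normal (v k) i t - unit_normal (v k) i s @[k --> \oo] -->
    unit_normal u i t - unit_normal u i s.
  exact: (cvgB (unit_normal_weak_cvg km0 p4 Xu wc It) (unit_normal_weak_cvg km0 p4 Xu wc Is)).
exact: (cvg_unique _ c c').
Qed.

(** Each integral is an increment of the unit normal, and normals converge at the two endpoints.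
    This is the only convergence of [q] that the lower semicontinuity proof draws on. *)
Lemma normal_velocity_weak_cvg A B km p (us : nat -> curve R) u i (s t : R) : 0 < km -> 4 <= p ->
  (forall j, Xspace A B km p (us j)) -> Xspace A B km p u -> weak_cvg p us u ->
  0 < s -> s < t -> t < 1 ->
  \int[mu]_(x in `]s, t[) normal_velocity (us j) i x @[j --> \oo] -->
  \int[mu]_(x in `]s, t[) normal_velocity u i x.
Proof.
move=> km0 p4 Xus Xu wc s0 st t1.
have Is : I s by apply/unit_itvP; rewrite s0 (lt_trans st).
have It : I t by apply/unit_itvP; rewrite t1 (lt_trans s0).
rewrite ((Xspace_normal_velocity i km0 p4 Xu).2 _ _ s0 st t1).
rewrite (_ : (fun j => _) = fun j => unit_normal (us j) i t - unit_normal (us j) i s); last first.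
  by apply/funext => j; rewrite ((Xspace_normal_velocity i km0 p4 (Xus j)).2 _ _ s0 st t1).
exact: (cvgB (unit_normal_weak_cvg km0 p4 Xu wc It) (unit_normal_weak_cvg km0 p4 Xu wc Is)).
Qed.

End UnitNormal.

(** * Lower limits: eventual bounds and measurability *)

Section LimInfExtra.
Context {R : realType}.
Implicit Types u : (\bar R)^nat.
Local Open Scope ereal_scope.

Lemma lt_limn_einf_near u y : y < limn_einf u -> \forall j \near \oo, y <= u j.
Proof.
rewrite limn_einf_lim (cvg_lim _ (@cvg_einfs_sup _ u))// => /ereal_sup_gt[_ [n _ <-]] yn.
exists n => // j /= nj; apply: (le_trans (ltW yn)).
by apply: ereal_inf_lbound; exists j.
Qed.

Lemma measurable_limn_einf d (T : measurableType d) (D : set T) (f : (T -> \bar R)^nat) :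
  (forall n, measurable_fun D (f n)) -> measurable_fun D (fun x => limn_einf (f ^~ x)).
Proof.
move=> mf; have -> : (fun x => limn_einf (f ^~ x)) = (fun x => - limn_esup (fun n => - f n x)).
  apply/funext => x; rewrite -limn_einfN; congr limn_einf.
  by apply/funext => n /=; rewrite oppeK.
apply: measurableT_comp => //; apply: (@measurable_fun_limn_esup _ _ _ _ (fun n x => - f n x)) => n.
exact: measurableT_comp.
Qed.

End LimInfExtra.

(** * Asymptotic lower bounds on a fixed interval *)

Section LocalLsc.
Context {R : realType}.
Local Notation mu := (@lebesgue_measure R).
Local Notation I := (unit_itv R).
Implicit Types (f g h : R -> R) (u v : curve R) (p km x c : R) (w : 'rV[R]_3).

Lemma EFin_Rintegral (D : set R) f : measurable D -> mu.-integrable D (EFin \o f) ->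
  (\int[mu]_(x in D) f x)%:E = (\int[mu]_(x in D) (f x)%:E)%E.
Proof. by move=> mD fi; rewrite /Rintegral fineK//; exact: integrable_fin_num. Qed.

Lemma measurable_kappa p u : 1 <= p -> W3p p u -> measurable_fun I (kappa u).
Proof. by move=> p1 Wu; apply: measurable_enorm => i; exact: W3p_measurable Wu _. Qed.

Lemma kappa_integrable A B km p u : 0 < km -> 4 <= p -> Xspace A B km p u ->
  mu.-integrable I (EFin \o kappa u) /\ mu.-integrable I (EFin \o (fun x => kappa u x ^+ 2)).
Proof.
move=> km0 p4 Xu; have p1 : 1 <= p by apply: le_trans p4; rewrite ler1n.
have mk := measurable_kappa p1 Xu.1.
have fi := wdensity_fin km0 p4 Xu.
have kf x : kappa u x ^+ 2 <= wdensity u x by exact: sadowsky_density_ge_sqr.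
have i2 : mu.-integrable I (EFin \o (fun x => kappa u x ^+ 2)).
  apply: (integrable_le (@measurable_unit_itv R) _ fi) => [|x _].
    by under eq_fun do rewrite expr2; exact: measurable_funM.
  by rewrite ger0_norm ?sqr_ge0.
split => //; apply: (integrable_le (@measurable_unit_itv R) mk (integrable01D (integrable_cst_unit_itv 1) i2)).
move=> x _; rewrite ger0_norm ?enorm_ge0//; exact: le_add1_sqr.
Qed.

Definition directional_velocity w u x : R :=
  w 0 0 * normal_velocity u 0 x + (w 0 1 * normal_velocity u 1 x + w 0 2 * normal_velocity u 2 x).

Lemma directional_velocityE w u x :
  directional_velocity w u x = dotp w (normal_rate (wD 1 u x) (wD 2 u x) (wD 3 u x)).
Proof. by rewrite dotpE /directional_velocity addrA. Qed.

Lemma directional_velocity_integral A B km p u w (J : set R) : 0 < km -> 4 <= p ->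
  Xspace A B km p u -> measurable J -> J `<=` I ->
  mu.-integrable I (EFin \o directional_velocity w u) /\
  \int[mu]_(x in J) directional_velocity w u x =
  w 0 0 * \int[mu]_(x in J) normal_velocity u 0 x +
  (w 0 1 * \int[mu]_(x in J) normal_velocity u 1 x +
   w 0 2 * \int[mu]_(x in J) normal_velocity u 2 x).
Proof.
move=> km0 p4 Xu mJ JI; have iq i := (Xspace_normal_velocity i km0 p4 Xu).1.
have iJ i := integrable_sub (@measurable_unit_itv R) mJ JI (iq i).
split.
  by apply: integrable01D; [|apply: integrable01D]; exact: integrable01Z.
have i2 : mu.-integrable J (EFin \o (fun x => w 0 2 * normal_velocity u 2 x)).
  by apply: (integrable_sub (@measurable_unit_itv R) mJ JI); exact: integrable01Z.
have i12 : mu.-integrable J (EFin \o (fun x => w 0 1 * normal_velocity u 1 x +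
    w 0 2 * normal_velocity u 2 x)).
  by apply: (integrable_sub (@measurable_unit_itv R) mJ JI); apply: integrable01D; exact: integrable01Z.
rewrite (Rintegral_lin _ mJ (iJ 0) i12) (Rintegral_lin _ mJ (iJ 1) i2).
by rewrite RintegralZl//; exact: iJ.
Qed.

Lemma square_completion (delta K k : R) : 0 < delta ->
  0 <= delta * k ^+ 2 + (- K * k + K ^+ 2 / (4 * delta)).
Proof.
move=> d0; have -> : delta * k ^+ 2 + (- K * k + K ^+ 2 / (4 * delta)) =
    (2 * delta * k - K) ^+ 2 / (4 * delta) by field; rewrite gt_eqF.
by rewrite divr_ge0 ?sqr_ge0// mulr_ge0// ltW.
Qed.

(* [delta kappa^2 - K kappa + K^2 / (4 delta)] is a nonnegative function of
   [kappa], so Fatou's lemma applies to it although [kappa] enters the lower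
   bound of the density with a negative sign. *)
Lemma local_lsc_delta A B km p (us : nat -> curve R) u w c (s t delta e : R) : 0 < km -> 4 <= p ->
  (forall j, Xspace A B km p (us j)) -> Xspace A B km p u -> weak_cvg p us u ->
  0 < s -> s < t -> t < 1 -> 0 <= c -> 0 < delta -> 0 < e ->
  \forall j \near \oo,
    4 * c * (\int[mu]_(x in `]s, t[) directional_velocity w u x) -
    2 * c * dotp w w * (\int[mu]_(x in `]s, t[) kappa u x) -
    c ^+ 2 * fine (mu `]s, t[) - e <=
    (1 + delta) * \int[mu]_(x in `]s, t[) wdensity (us j) x.
Proof.
move=> km0 p4 Xus Xu wc s0 st t1 c0 d0 e0.
have p1 : 1 <= p by apply: le_trans p4; rewrite ler1n.
have JI : `]s, t[%classic `<=` I.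
  move=> x; rewrite /= in_itv /= => /andP[sx xt].
  by apply/unit_itvP; rewrite (lt_trans s0 sx) (lt_trans xt t1).
have mJ : measurable (`]s, t[%classic : set R) by exact: measurable_itv.
have sub f : mu.-integrable I (EFin \o f) -> mu.-integrable `]s, t[ (EFin \o f).
  exact: (integrable_sub (@measurable_unit_itv R) mJ JI).
(* [K] is the coefficient of [kappa] in [sadowsky_density_lower], and [L] completes the square. With
   [P] and [Q] as below, [P <= Q] is that bound added to [delta kappa^2 <= delta] times the
   density. *)
pose K := 2 * c * dotp w w; pose L := K ^+ 2 / (4 * delta).
pose P v x := delta * kappa v x ^+ 2 + (- K * kappa v x + L).
pose Q v x := (1 + delta) * wdensity v x + (- (4 * c) * directional_velocity w v x + (c ^+ 2 + L)).
have P0 v x : 0 <= P v x by exact: square_completion.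
have iP v : Xspace A B km p v -> mu.-integrable I (EFin \o P v) /\
    \int[mu]_(x in `]s, t[) P v x = delta * \int[mu]_(x in `]s, t[) (kappa v x ^+ 2) +
      (- K * \int[mu]_(x in `]s, t[) kappa v x + L * fine (mu `]s, t[)).
  move=> Xv; have [i1 i2] := kappa_integrable km0 p4 Xv.
  have i3 := integrable01D (integrable01Z (- K) i1) (integrable_cst_unit_itv L).
  split; first exact: (integrable01D (integrable01Z delta i2) i3).
  rewrite (Rintegral_lin _ mJ (sub _ i2) (sub _ i3)).
  by rewrite (Rintegral_lin _ mJ (sub _ i1) (sub _ (integrable_cst_unit_itv L))) Rintegral_cst.
have iQ v : Xspace A B km p v -> mu.-integrable I (EFin \o Q v) /\
    \int[mu]_(x in `]s, t[) Q v x = (1 + delta) * \int[mu]_(x in `]s, t[) wdensity v x +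
      (- (4 * c) * \int[mu]_(x in `]s, t[) directional_velocity w v x +
       (c ^+ 2 + L) * fine (mu `]s, t[)).
  move=> Xv; have i2 := wdensity_fin km0 p4 Xv.
  have [i1 _] := directional_velocity_integral w km0 p4 Xv mJ JI.
  have i3 := integrable01D (integrable01Z (- (4 * c)) i1) (integrable_cst_unit_itv (c ^+ 2 + L)).
  split; first exact: (integrable01D (integrable01Z (1 + delta) i2) i3).
  rewrite (Rintegral_lin _ mJ (sub _ i2) (sub _ i3)).
  by rewrite (Rintegral_lin _ mJ (sub _ i1) (sub _ (integrable_cst_unit_itv _))) Rintegral_cst.
have mEP v : Xspace A B km p v -> measurable_fun `]s, t[ (EFin \o P v).
  by move=> Xv; exact: measurable_int (sub _ (iP v Xv).1).
have mEQ v : Xspace A B km p v -> measurable_fun `]s, t[ (EFin \o Q v).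
  by move=> Xv; exact: measurable_int (sub _ (iQ v Xv).1).
have PQ v : Xspace A B km p v -> \int[mu]_(x in `]s, t[) P v x <= \int[mu]_(x in `]s, t[) Q v x.
  move=> Xv; have PQae : {ae mu, forall x, `]s, t[%classic x -> P v x <= Q v x}.
    apply: (aeS (Xspace_frenet p4 Xv)) => x fr /JI Ix.
    have low := sadowsky_density_lower w km0 (fr Ix) c0.
    have sq := sadowsky_density_ge_sqr (wD 1 v x) (wD 2 v x) (wD 3 v x).
    rewrite -directional_velocityE -/(wdensity v x) -/(kappa v x) in low.
    rewrite -/(wdensity v x) -/(kappa v x) in sq.
    have sq' := ler_wpM2l (ltW d0) sq.
    rewrite -subr_ge0 (_ : Q v x - P v x = (delta * wdensity v x - delta * kappa v x ^+ 2) +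
      (wdensity v x - (4 * c * directional_velocity w v x - 2 * c * dotp w w * kappa v x - c ^+ 2))).
      by rewrite addr_ge0// subr_ge0.
    by rewrite /P /Q /K; ring.
  rewrite -lee_fin (EFin_Rintegral mJ (sub _ (iP v Xv).1)) (EFin_Rintegral mJ (sub _ (iQ v Xv).1)).
  (* [Q] is nonnegative only almost everywhere, being above [P] there; its absolute value allows a
     comparison of integrals of nonnegative functions. *)
  have mA : measurable_fun `]s, t[ (EFin \o (fun x => `|Q v x|)).
    by apply: measurable_funE; apply: measurable_fun_normr; apply/measurable_EFinP; exact: mEQ.
  have -> : (\int[mu]_(x in `]s, t[) (Q v x)%:E = \int[mu]_(x in `]s, t[) `|Q v x|%:E)%E.
    apply: ae_eq_integral => //; first exact: mEQ.
    by apply: (aeS PQae) => x h Jx; rewrite /= ger0_norm// (le_trans _ (h Jx)).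
  apply: ae_ge0_le_integral => //.
  - by move=> x _; rewrite lee_fin.
  - exact: mEP.
  - by apply: (aeS PQae) => x h Jx; rewrite lee_fin (le_trans (h Jx))// ler_norm.
have F : ((\int[mu]_(x in `]s, t[) P u x)%:E <=
    limn_einf (fun j => (\int[mu]_(x in `]s, t[) P (us j) x)%:E))%E.
  have mPj j : measurable_fun `]s, t[ (EFin \o P (us j)) by exact: (mEP _ (Xus j)).
  have E : (\int[mu]_(x in `]s, t[) limn_einf (fun j => (P (us j) x)%:E) =
      \int[mu]_(x in `]s, t[) (P u x)%:E)%E.
    apply: ae_eq_integral => //.
    - exact: (@measurable_limn_einf _ _ _ _ (fun j x => (P (us j) x)%:E)).
    - exact: (mEP _ Xu).
    - apply: (aeS (kappa_weak_cvg p4 Xus Xu wc)) => x hk /JI Ix.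
      have ck := hk Ix; apply: (cvg_limn_einf_sup _).1; apply: cvg_EFin; first by near=> j.
      apply: cvgD; first by apply: cvgM; [exact: cvg_cst|exact: cvg_exprn].
      by apply: cvgD; [apply: cvgM => //; exact: cvg_cst|exact: cvg_cst].
  have eq_lee (y z : \bar R) : y = z -> (y <= z)%E by move=> ->.
  apply: (le_trans (eq_lee _ _ (etrans (EFin_Rintegral mJ (sub _ (iP u Xu).1)) (esym E)))).
  apply: (le_trans (@fatou _ _ _ mu _ mJ (fun j x => (P (us j) x)%:E) mPj (fun j x _ => P0 (us j) x))).
  apply: le_limn_einf; near=> j.
  exact: eq_lee _ _ (esym (EFin_Rintegral mJ (sub _ (iP _ (Xus j)).1))).
have e20 : 0 < e / 2 by rewrite divr_gt0.
have h1 : \forall j \near \oo, \int[mu]_(x in `]s, t[) P u x - e / 2 <=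
    \int[mu]_(x in `]s, t[) P (us j) x.
  have : ((\int[mu]_(x in `]s, t[) P u x - e / 2)%:E <
    limn_einf (fun j => (\int[mu]_(x in `]s, t[) P (us j) x)%:E))%E.
    by apply: lt_le_trans F; rewrite lte_fin ltrBlDr ltrDl.
  by move/lt_limn_einf_near; apply: filterS => j; rewrite lee_fin.
have h2 : 4 * c * \int[mu]_(x in `]s, t[) directional_velocity w (us j) x @[j --> \oo] -->
    4 * c * \int[mu]_(x in `]s, t[) directional_velocity w u x.
  apply: cvgM; first exact: cvg_cst.
  rewrite (directional_velocity_integral w km0 p4 Xu mJ JI).2.
  under eq_fun do rewrite (directional_velocity_integral w km0 p4 (Xus _) mJ JI).2.
  have cq i := @normal_velocity_weak_cvg _ A B km p us u i s t km0 p4 Xus Xu wc s0 st t1.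
  apply: cvgD; first by apply: cvgM (cq 0); exact: cvg_cst.
  by apply: cvgD; [apply: cvgM (cq 1); exact: cvg_cst|apply: cvgM (cq 2); exact: cvg_cst].
move/cvgrPdist_le : h2 => /(_ _ e20) h2.
(* The quadratic term of the limit curve only helps and is dropped in the final inequality. *)
have k20 : 0 <= delta * \int[mu]_(x in `]s, t[) (kappa u x ^+ 2).
  by apply: mulr_ge0; [exact: ltW|apply: Rintegral_ge0 => x _; exact: sqr_ge0].
near=> j.
have a1 : \int[mu]_(x in `]s, t[) P u x - e / 2 <= \int[mu]_(x in `]s, t[) P (us j) x by near: j.
have a2 : `|4 * c * \int[mu]_(x in `]s, t[) directional_velocity w u x -
  4 * c * \int[mu]_(x in `]s, t[) directional_velocity w (us j) x| <= e / 2 by near: j.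
have a3 := le_trans a1 (PQ _ (Xus j)).
rewrite (iP u Xu).2 (iQ _ (Xus j)).2 in a3.
have a4 := le_trans (ler_norm _) a2.
move: a3 a4 k20; rewrite /K.
move: (\int[mu]_(x in _) directional_velocity w (us j) x) (\int[mu]_(x in _) directional_velocity w u x)
  (\int[mu]_(x in _) wdensity (us j) x) (\int[mu]_(x in _) (kappa u x ^+ 2))
  (\int[mu]_(x in _) kappa u x) (fine _) => q1 q2 F1 k2 k1 m a3 a4 k20.
rewrite -subr_ge0 (_ : _ - _ = ((1 + delta) * F1 + (- (4 * c) * q1 + (c ^+ 2 + L) * m) -
  (delta * k2 + (- (2 * c * dotp w w) * k1 + L * m) - e / 2)) +
  (e / 2 - (4 * c * q2 - 4 * c * q1)) + delta * k2); last by field.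
by apply: addr_ge0 => //; apply: addr_ge0; rewrite subr_ge0.
Unshelve. all: by end_near. Qed.

(** Removes the factor [1 + delta]. For an index [j] whose integral is at least [Z] the claim is
    immediate; otherwise that integral is below [|Z| + 1] and [delta] times it is at most
    [e / 2]. *)
Lemma local_lsc A B km p (us : nat -> curve R) u w c (s t e : R) : 0 < km -> 4 <= p ->
  (forall j, Xspace A B km p (us j)) -> Xspace A B km p u -> weak_cvg p us u ->
  0 < s -> s < t -> t < 1 -> 0 <= c -> 0 < e ->
  \forall j \near \oo,
    4 * c * (\int[mu]_(x in `]s, t[) directional_velocity w u x) -
    2 * c * dotp w w * (\int[mu]_(x in `]s, t[) kappa u x) -
    c ^+ 2 * fine (mu `]s, t[) - e <= \int[mu]_(x in `]s, t[) wdensity (us j) x.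
Proof.
move=> km0 p4 Xus Xu wc s0 st t1 c0 e0.
set Z := 4 * c * _ - _ - _.
pose delta := e / 2 / (`|Z| + 1).
have Z1 : 0 < `|Z| + 1 by rewrite ltr_wpDl.
have d0 : 0 < delta by rewrite !divr_gt0.
have e20 : 0 < e / 2 by rewrite divr_gt0.
apply: filterS (local_lsc_delta w km0 p4 Xus Xu wc s0 st t1 c0 d0 e20) => j.
rewrite -/Z; move: (\int[mu]_(x in _) wdensity _ x) => F h.
have [ZF|/ltW FZ] := leP Z F; first by apply: le_trans ZF; rewrite lerBlDr lerDl ltW.
have h1 : delta * F <= e / 2.
  apply: (@le_trans _ _ (delta * (`|Z| + 1))); last by rewrite divfK ?gt_eqF.
  by rewrite ler_wpM2l ?(ltW d0)// (le_trans FZ)// (le_trans (ler_norm _))// lerDl.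
move: h; rewrite mulrDl mul1r; lra.
Qed.

End LocalLsc.

(** * Averages over windows and Tonelli's theorem *)

Section Windows.
Context {R : realType}.
Local Notation mu := (@lebesgue_measure R).
Local Notation I := (unit_itv R).
Implicit Types (f : R -> R) (r x y : R).

(** A function on the plane, so that the order of integration can be exchanged: for fixed [x] it
    restricts to a window to the right of [x], for fixed [y] it is constant on a window of the same
    length to the left of [y]. *)
Definition window f r (z : R * R) : R :=
  if (z.1 < z.2) && (z.2 < z.1 + r) then (f \_ I) z.2 else 0.

Definition window_average f n x : \bar R :=
  (n.+1%:R%:E * \int[mu]_y (window f n.+1%:R^-1 (x, y))%:E)%E.

Lemma window_ge0 f r z : (forall x, 0 <= f x) -> 0 <= window f r z.
Proof. by move=> f0; rewrite /window; case: ifP => // _; rewrite patchE; case: ifP. Qed.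

Lemma measurable_window f r : measurable_fun I f ->
  measurable_fun [set: R * R] (EFin \o window f r).
Proof.
move=> mf; apply/measurable_EFinP; rewrite /window; apply: measurable_fun_ifT; last exact: measurable_cst.
  apply: measurable_and; apply: measurable_fun_ltr => //.
  by apply: measurable_funD.
by apply: (measurableT_comp (f := f \_ I)) => //; exact/measurable_patchT.
Qed.

Lemma measurable_window_average f n : (forall x, 0 <= f x) -> measurable_fun I f ->
  measurable_fun [set: R] (window_average f n).
Proof.
move=> f0 mf; apply: measurable_funeM.
apply: (@measurable_fun_fubini_tonelli_F _ _ _ _ R mu _ (measurable_window _ mf)).
by move=> z; rewrite lee_fin; exact: window_ge0.
Qed.

Lemma window_average_ge0 f n x : (forall x, 0 <= f x) -> (0 <= window_average f n x)%E.
Proof.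
by move=> f0; apply: mule_ge0; rewrite ?lee_fin//; apply: integral_ge0 => y _; rewrite lee_fin window_ge0.
Qed.

Lemma window_averageE f n x : rshrink x n `<=` I ->
  window_average f n x = (n.+1%:R%:E * \int[mu]_(y in rshrink x n) (f y)%:E)%E.
Proof.
move=> JI; congr (_ * _)%E; rewrite [RHS]integral_mkcond; apply: eq_integral => y _.
have E : (y \in rshrink x n) = (x < y) && (y < x + n.+1%:R^-1).
  by apply/idP/idP => [/set_mem|h]; [|apply/mem_set]; rewrite /rshrink /= in_itv.
rewrite /window !patchE E; case: ifP => // h.
by rewrite mem_set//; apply: JI; rewrite -E in h; exact: set_mem.
Qed.

(** Enlarging the range of [x] from [I] to the line is where equality may be lost. Over the whole
    line each [y] lies in the windows of a set of [x] of measure [1/(n+1)], which the factor [n + 1]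
    normalizes to weight 1. *)
Lemma integral_window_average f n : (forall x, 0 <= f x) -> measurable_fun I f ->
  (\int[mu]_(x in I) window_average f n x <= \int[mu]_(x in I) (f x)%:E)%E.
Proof.
move=> f0 mf; set r : R := n.+1%:R^-1.
have r0 : 0 < r by rewrite invr_gt0.
have mw := measurable_window r mf.
have w0 z : (0 <= (EFin \o window f r) z)%E by rewrite lee_fin window_ge0.
apply: (@le_trans _ _ (\int[mu]_x window_average f n x)%E).
  apply: ge0_subset_integral => //.
  - exact: measurable_unit_itv.
  - exact: measurable_window_average.
  - by move=> x _; exact: window_average_ge0.
have inner y : (\int[mu]_x (window f r (x, y))%:E = r%:E * ((f \_ I) y)%:E)%E.
  have -> : (\int[mu]_x (window f r (x, y))%:E =
      \int[mu]_(x in `](y - r)%R, y[) (cst ((f \_ I) y)%:E x))%E.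
    rewrite [RHS]integral_mkcond; apply: eq_integral => x _.
    have E : (x \in `]y - r, y[%classic) = (x < y) && (y < x + r).
      by apply/idP/idP => [/set_mem|h]; [|apply/mem_set]; rewrite /= in_itv /= andbC ltrBlDr.
    by rewrite [RHS]patchE E /window /=; case: ifP.
  have m : mu `]y - r, y[ = r%:E.
    by rewrite lebesgue_measure_itv /= lte_fin ltrBlDr ltrDl r0 -EFinB; congr EFin; ring.
  rewrite integral_cst; first by rewrite muleC; congr (_ * _)%E; exact: m.
  exact: measurable_itv.
rewrite /window_average ge0_integralZl//.
- rewrite (@fubini_tonelli _ _ _ _ R mu mu _ mw w0).
  under eq_integral do rewrite inner.
  rewrite ge0_integralZl//.
  + rewrite muleA -EFinM mulfV// mul1e [leRHS]integral_mkcond restrict_EFin.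
    exact: lexx.
  + by apply: measurable_funE; exact/measurable_patchT.
  + by move=> y _; rewrite lee_fin patchE; case: ifP.
  + by rewrite lee_fin ltW.
- exact: (@measurable_fun_fubini_tonelli_F _ _ _ _ R mu _ mw w0).
- by move=> x _; apply: integral_ge0 => y _; exact: w0.
Qed.

End Windows.

(** * Weak lower semicontinuity of the Sadowsky functional *)

Section LowerSemicontinuity.
Context {R : realType}.
Local Notation mu := (@lebesgue_measure R).
Local Notation I := (unit_itv R).
Implicit Types (f g h : R -> R) (u v : curve R) (p km x c : R) (w : 'rV[R]_3).

(** At a common Lebesgue point of [q] and [kappa], the averages of the affine lower bound tend to
    its value at [x], which is the density of [u] because the hyperplane is chosen to touch there.
    For each fixed window, [local_lsc] handles the limit in [j]. *)
Lemma window_average_lsc A B km p (us : nat -> curve R) u : 0 < km -> 4 <= p ->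
  (forall j, Xspace A B km p (us j)) -> Xspace A B km p u -> weak_cvg p us u ->
  {ae mu, forall x, I x -> ((wdensity u x)%:E <=
    limn_einf (fun n => limn_einf (fun j => window_average (wdensity (us j)) n x)))%E}.
Proof.
move=> km0 p4 Xus Xu wc.
have p1 : 1 <= p by apply: le_trans p4; rewrite ler1n.
have av i := ae_right_average (Xspace_normal_velocity i km0 p4 Xu).1.
have ak := ae_right_average (kappa_integrable km0 p4 Xu).1.
apply: (aeS (aeI (Xspace_frenet p4 Xu) (aeI (ord3_ae av) ak))) => x [fr [hv hk]] Ix.
have {}fr := fr Ix; have {}hk := hk Ix.
pose k := kappa u x; pose q := normal_rate (wD 1 u x) (wD 2 u x) (wD 3 u x).
have k0 : 0 < k by exact: frenet_gt0 km0 fr.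
(* The contact parameters of [sadowsky_density_tangent] at the point [x], kept constant over the
   windows. *)
pose c := dotp q q / k; pose w := k^-1 *: q.
have c0 : 0 <= c by rewrite divr_ge0 ?dotp_ge0// ltW.
have mJ n : measurable (rshrink x n `&` I).
  by apply: measurableI; [exact: measurable_itv|exact: measurable_unit_itv].
have JI n : rshrink x n `&` I `<=` I by move=> y [].
pose Z n := 4 * c * (\int[mu]_(y in rshrink x n `&` I) directional_velocity w u y) -
  2 * c * dotp w w * (\int[mu]_(y in rshrink x n `&` I) kappa u y).
have cZ : n.+1%:R * Z n - c ^+ 2 @[n --> \oo] --> wdensity u x.
  have T : 4 * c * dotp w q - 2 * c * dotp w w * k - c ^+ 2 = wdensity u x.
    exact: sadowsky_density_tangent km0 fr.
  rewrite -T.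
  apply: cvgB; last exact: cvg_cst.
  rewrite (_ : (fun n => _) = fun n => 4 * c * (w 0 0 * (n.+1%:R *
        \int[mu]_(y in rshrink x n `&` I) normal_velocity u 0 y) +
      (w 0 1 * (n.+1%:R * \int[mu]_(y in rshrink x n `&` I) normal_velocity u 1 y) +
       w 0 2 * (n.+1%:R * \int[mu]_(y in rshrink x n `&` I) normal_velocity u 2 y))) -
      2 * c * dotp w w * (n.+1%:R * \int[mu]_(y in rshrink x n `&` I) kappa u y)); last first.
    apply/funext => n; rewrite /Z (directional_velocity_integral w km0 p4 Xu (mJ n) (JI n)).2.
    by ring.
  rewrite -directional_velocityE /directional_velocity.
  apply: cvgB; last by apply: cvgM hk; exact: cvg_cst.
  apply: cvgM; first exact: cvg_cst.
  apply: cvgD; first by apply: cvgM (hv 0 Ix); exact: cvg_cst.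
  by apply: cvgD; [apply: cvgM (hv 1 Ix); exact: cvg_cst|apply: cvgM (hv 2 Ix); exact: cvg_cst].
apply/lee_addgt0Pr => e e0; rewrite -leeBlDr//.
apply: limn_einf_ge.
have e20 : 0 < e / 2 by rewrite divr_gt0.
have /andP[x0 x1] : 0 < x < 1 by apply/unit_itvP.
have x10 : 0 < 1 - x by rewrite subr_gt0.
move/cvgrPdist_le : cZ => /(_ _ e20) hZ.
have /cvgrPdist_lt/(_ _ x10) hn := @cvg_harmonic R.
near=> n.
have n1 : x + n.+1%:R^-1 < 1.
  have : `|0 - harmonic n| < 1 - x :> R by near: n.
  by rewrite sub0r normrN ger0_norm ?invr_ge0// ltrBrDl.
have nJI : rshrink x n `<=` I.
  move=> y; rewrite /rshrink /= in_itv /= => /andP[xy yx].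
  by apply/unit_itvP; rewrite (lt_trans x0 xy) (lt_trans yx n1).
have Zn : `|wdensity u x - (n.+1%:R * Z n - c ^+ 2)| <= e / 2 by near: n.
have N0 : 0 < n.+1%:R :> R by [].
(* The error on the window is divided by [n + 1] in advance, since averaging multiplies it by
   [n + 1]. *)
have en0 : 0 < e / 2 / n.+1%:R by rewrite divr_gt0.
have xs : x < x + n.+1%:R^-1 by rewrite ltrDl invr_gt0.
apply: limn_einf_ge.
apply: filterS (local_lsc w km0 p4 Xus Xu wc x0 xs n1 c0 en0) => j.
rewrite -/(rshrink x n) mu_rshrink /= => h.
rewrite (window_averageE _ nJI).
have ij : mu.-integrable (rshrink x n) (EFin \o wdensity (us j)).
  apply: (integrable_sub (@measurable_unit_itv R) _ nJI (wdensity_fin km0 p4 (Xus j))).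
  exact: measurable_itv.
rewrite -(EFin_Rintegral _ ij); last exact: measurable_itv.
rewrite -EFinB -EFinM lee_fin.
have ZE : Z n = 4 * c * (\int[mu]_(y in rshrink x n) directional_velocity w u y) -
    2 * c * dotp w w * (\int[mu]_(y in rshrink x n) kappa u y).
  by rewrite /Z (setIidl nJI).
rewrite -ZE in h.
have h2 := ler_wpM2l (ltW N0) h.
have h3 : n.+1%:R * (Z n - c ^+ 2 * n.+1%:R^-1 - e / 2 / n.+1%:R) =
    n.+1%:R * Z n - c ^+ 2 - e / 2 by field; rewrite gt_eqF.
rewrite h3 in h2; apply: le_trans h2.
have := le_trans (ler_norm _) Zn.
move: (n.+1%:R * Z n) (c ^+ 2) (wdensity u x) => a b d; lra.
Unshelve. all: by end_near. Qed.

(** Fatou's lemma is used twice, in [n] and then in [j] for fixed [n]; afterwards the integral of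
    each averaged density is at most the functional of the same curve, whatever [n] is. *)
Lemma sadowsky_lsc A B km p (us : nat -> curve R) u : 0 < km -> 4 <= p ->
  (forall j, Xspace A B km p (us j)) -> Xspace A B km p u -> weak_cvg p us u ->
  (sadowsky u <= limn_einf (fun j => sadowsky (us j)))%E.
Proof.
move=> km0 p4 Xus Xu wc; have p1 : 1 <= p by apply: le_trans p4; rewrite ler1n.
have mw v : Xspace A B km p v -> measurable_fun I (wdensity v).
  by case=> Wv _; exact: measurable_wdensity Wv.
have f0 v x : 0 <= wdensity v x by exact: wdensity_ge0.
pose b j n x := window_average (wdensity (us j)) n x.
have b0 j n x : (0 <= b j n x)%E by exact: window_average_ge0.
have mb j n : measurable_fun I (b j n).
  by apply: (measurable_funS measurableT) => //; exact: measurable_window_average (mw _ (Xus j)).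
have B0 n x : (0 <= limn_einf (fun j => b j n x))%E.
  by apply: limn_einf_ge; near=> j; exact: b0.
have mB n : measurable_fun I (fun x => limn_einf (fun j => b j n x)).
  exact: (measurable_limn_einf (fun j => mb j n)).
rewrite sadowskyE.
apply: (@le_trans _ _ (\int[mu]_(x in I) limn_einf (fun n => limn_einf (fun j => b j n x)))%E).
  apply: ae_ge0_le_integral.
  - exact: measurable_unit_itv.
  - by move=> x _; rewrite lee_fin.
  - by apply: measurable_funE; exact: mw.
  - by move=> x _; apply: limn_einf_ge; near=> n; exact: B0.
  - exact: (measurable_limn_einf mB).
  - exact: window_average_lsc km0 p4 Xus Xu wc.
apply: (le_trans (@fatou _ _ _ mu I (@measurable_unit_itv R)
  (fun n x => limn_einf (fun j => b j n x)) mB (fun n x _ => B0 n x))).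
(* The right-hand side is read as the lower limit of a sequence constant in [n], so that the
   comparison can be made for each [n]. *)
rewrite -[leRHS](cvg_limn_einf_sup (cvg_cst _)).1.
apply: le_limn_einf; near=> n.
apply: (le_trans (@fatou _ _ _ mu I (@measurable_unit_itv R)
  (fun j x => b j n x) (fun j => mb j n) (fun j x _ => b0 j n x))).
apply: le_limn_einf; near=> j; rewrite sadowskyE.
exact: (integral_window_average n (f0 _) (mw _ (Xus j))).
Unshelve. all: by end_near. Qed.

End LowerSemicontinuity.

Unset Implicit Arguments.

Theorem theorem4p4 (R : realType) (A B : 'rV[R]_3 * 'rV[R]_3)
    (hA : unit_sphere A.2) (hB : unit_sphere B.2)
    (km p : R) (hkm : 0 < km) (hp : 4 <= p) :
  (forall G : curve R -> R,
     weakly_seq_lsc p (Xspace A B km p) G ->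
     (forall u, Yspace_curv A B km u -> ((G u)%:E <= sadowsky u)%E) ->
     forall u, Xspace A B km p u -> ((G u)%:E <= sadowsky u)%E) /\
  is_Gamma_limit (Xspace A B km p) (weak_cvg p) sadowsky_eps sadowsky.
Proof.
split; first by move=> G lscG GF u; exact: relaxation_bound hkm hp lscG GF u.
move=> eps eps0 epsc u Xu; split; last exact: recovery_sequence hkm hp eps0 epsc Xu.
move=> us Xus wc; apply: (le_trans (sadowsky_lsc hkm hp Xus Xu wc)).
apply: le_limn_einf; near=> j; exact: sadowsky_le_eps hp (Xus j).
Unshelve. all: by end_near. Qed.
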